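(* Let $\phi(z)=bz+cz^2+\int_{(0,\infty)}(e^{-zu}-1+zu)\,m(du)$ be a branching mechanism and let $\{x(t):t\ge 0\}$ be a càdlàg CB-process with branching mechanism $\phi$ started, under $\mathbf{P}_x$, from $x(0)=x\ge 0$. Let $\Delta x(t)=x(t)-x(t-)$. Then for any $r>0$ and $t>0$ we have $$\mathbf{P}_x\bigg\{\max_{0<s\le t}\Delta x(s)\le r\bigg\}=\exp\{-xu_r(t)\},$$ where $u_r(t)=u_r(t,m(r,\infty))$ and, for $\theta\ge 0$, $t\mapsto u_r(t,\theta)$ is the unique positive solution to $$\frac{\partial}{\partial t}u(t,\theta)=\theta-\phi_r(u(t,\theta)),\qquad u(0,\theta)=0,$$ with $$\phi_r(z)=b_rz+cz^2+\int_{(0,r]}(e^{-zu}-1+zu)\,m(du),\qquad b_r=b+\int_{(r,\infty)}u\,m(du).$$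
   Context: ''Positive'' means nonnegative. In a branching mechanism, $b\in\mathbb{R}$, $c\ge 0$ and $m$ is a $\sigma$-finite measure on $(0,\infty)$ with $\int_{(0,\infty)}(u\wedge u^2)\,m(du)<\infty$. For $\lambda\ge 0$, $t\mapsto v_t(\lambda)$ is the unique nonnegative solution of $v_t(\lambda)=\lambda-\int_0^t\phi(v_s(\lambda))\,ds$; the CB-process with branching mechanism $\phi$ is the Markov process in $[0,\infty)$ with (Feller) transition semigroup $(Q_t)_{t\ge 0}$ given by $\int_{[0,\infty)}e^{-\lambda y}Q_t(x,dy)=e^{-xv_t(\lambda)}$. (In the paper it is realized as the pathwise unique nonnegative strong solution of $x(t)=x+\int_0^t\sqrt{2cx(s-)}\,dB(s)-b\int_0^tx(s-)\,ds+\int_0^t\int_0^\infty\int_0^{x(s-)}z\,\tilde M(ds,dz,du)$, where $B$ is a standard Brownian motion, $M$ an independent Poisson random measure on $(0,\infty)^3$ with intensity $ds\,m(dz)\,du$, and $\tilde M$ its compensated measure.) *)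

(* Defs.v *)
From HB Require Import structures.
From mathcomp Require Import all_boot all_order all_algebra.
From mathcomp Require Import all_classical all_reals all_analysis.
Set Implicit Arguments.
Unset Strict Implicit.
Unset Printing Implicit Defensive.
Import Order.TTheory GRing.Theory Num.Theory.
Import numFieldNormedType.Exports.
Local Open Scope classical_set_scope.
Local Open Scope ring_scope.

(* A measure on (0, +oo) is represented by a measure m on the Borel sets of R
   that is only ever evaluated on subsets of `]0, +oo[. *)
Section BranchingMechanism.
Context {R : realType}.
Implicit Types (b c r z : R) (m : {measure set (measurableTypeR R) -> \bar R}).

Definition branching_parameters c m : Prop :=
  [/\ 0 <= c,
      sigma_finite (`]0, +oo[ : set (measurableTypeR R)) m &
      (\int[m]_(u in `]0%R, +oo[) (Num.min u (u ^+ 2))%:E < +oo)%E].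

Definition mechanism_on (D : set R) b c m z : R :=
  b * z + c * z ^+ 2 + \int[m]_(u in D) (expR (- (z * u)) - 1 + z * u).

Definition phi b c m : R -> R := mechanism_on `]0, +oo[ b c m.

Definition drift_trunc r b m : R := b + \int[m]_(u in `]r, +oo[) u.

Definition phi_trunc r b c m : R -> R :=
  mechanism_on `]0, r] (drift_trunc r b m) c m.

End BranchingMechanism.

Section CBSemigroup.
Context {R : realType}.
Local Notation RR := (measurableTypeR R).

(* The integrability clause rules out solutions for which the total
   integral operator would return a default value. *)
Definition cumulant_solution (f : R -> R) (l : R) (v : R -> R) : Prop :=
  forall t, 0 <= t ->
    [/\ 0 <= v t,
        (@lebesgue_measure R).-integrable `[0, t] (fun s => (f (v s))%:E) &
        v t = l - \int[@lebesgue_measure R]_(s in `[0, t]) f (v s)].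

(* Kernels are typed over R; the state space is [0, +oo), so Q t x matters
   only for 0 <= t and 0 <= x, where it gives no mass to (-oo, 0). *)
Definition transition_semigroup (Q : R -> R.-pker RR ~> RR) : Prop :=
  [/\ forall t x, 0 <= t -> 0 <= x -> Q t x `]-oo, 0[%classic = 0%E,
      forall x (B : set RR), 0 <= x -> measurable B -> Q 0 x B = \d_x B &
      forall s t x (B : set RR), 0 <= s -> 0 <= t -> 0 <= x -> measurable B ->
        Q (s + t) x B = (\int[Q s x]_(y in `[0%R, +oo[) Q t y B)%E].

Definition CB_semigroup (f : R -> R) (Q : R -> R.-pker RR ~> RR) : Prop :=
  transition_semigroup Q /\
  exists v : R -> R -> R,
    (forall l, 0 <= l -> cumulant_solution f l (v ^~ l)) /\
    forall t x l, 0 <= t -> 0 <= x -> 0 <= l ->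
      (\int[Q t x]_(y in `[0%R, +oo[) (expR (- (l * y)))%:E)%E
        = (expR (- (x * v t l)))%:E.

End CBSemigroup.

Section Processes.
Context {R : realType} {d : measure_display} {T : measurableType d}.
Context (P : probability T R).
Local Notation RR := (measurableTypeR R).

Definition natural_filtration (X : R -> {RV P >-> R}) (s : R) : set (set T) :=
  <<s [set A | exists q (B : set RR),
         [/\ 0 <= q, q <= s, measurable B & A = X q @^-1` B]] >>.

Definition cadlag (f : R -> R) : Prop :=
  (forall t, 0 <= t -> f x @[x --> t^'+] --> f t) /\
  (forall t, 0 < t -> cvg (f x @[x --> t^'-])).

(* f(t) - f(t-) *)
Definition jump (f : R -> R) (t : R) : R := f t - lim (f x @[x --> t^'-]).

(* Only the times t >= 0 of X are relevant. *)
Definition cadlag_CB_process (f : R -> R) (x : R) (X : R -> {RV P >-> R})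
    : Prop :=
  [/\ forall t w, 0 <= t -> 0 <= X t w,
      forall w, cadlag (fun t => X t w),
      P [set w | X 0 w = x] = 1%E &
      exists Q : R -> R.-pker RR ~> RR, CB_semigroup f Q /\
        forall s t (A : set T) (B : set RR), 0 <= s -> 0 <= t ->
          natural_filtration X s A -> measurable B ->
          P (A `&` X (s + t) @^-1` B) = (\int[P]_(w in A) Q t (X s w) B)%E].

End Processes.

Section Solutions.
Context {R : realType}.

Definition is_max (A : set R) (y : R) : Prop := A y /\ ubound A y.

(* Nonnegative solution on [0, +oo) of u' = theta - f(u), u(0) = 0; the
   derivative at 0 is the right derivative. *)
Definition ode_solution (f : R -> R) (theta : R) (u : R -> R) : Prop :=
  [/\ u 0 = 0,
      forall t, 0 <= t -> 0 <= u t,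
      h^-1 * (u h - u 0) @[h --> 0^'+] --> theta - f (u 0) &
      forall t : R, 0 < t -> is_derive t 1 u (theta - f (u t))].

Definition unique_ode_solution (f : R -> R) (theta : R) (u : R -> R) : Prop :=
  ode_solution f theta u /\
  forall w, ode_solution f theta w -> forall t, 0 <= t -> w t = u t.

End Solutions.

(* Main.v *)
(* Along dyadic partitions t_k = k h of [0, t], a cadlag path has no jump larger
   than r on (0, t] iff its increments are eventually at most r + eta, for every
   eta > 0.  So the probability is a limit of expectations of
     prod_k (1 - kap (X(t_{k+1}) - X(t_k))),
   where kap vanishes on (-oo, r + eta] and is 1 on [r + 2 eta, +oo).  This
   expectation is compared with exp (- x u(t)) by telescoping
     prod_{j<k} (1 - kap_j) * exp (- u(t - t_k) X(t_k)).
   One step costs O(h^2) + h * small.  Indeed kap z = F (e^{-z}) (1 - e^{-z})^2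
   with F Lipschitz, hence uniformly close to a polynomial, and the Markov property
   gives E[a e^{i X(s)} e^{- (w + i) X(s + h)}] for a depending on the past, with
   v_h(l) = l - h phi(l) + O(h^2).  To first order the cutoff thus contributes
   h X(s) int kap(u) e^{-wu} m(du), close to h X(s) int_{(r,oo)} e^{-wu} m(du),
   which is h X(s) (m(r,oo) + phi w - phi_r w): this replaces the generator
   term phi by phi_r - m(r,oo), so the first order cancels by the equation
   for u. *)

Require Import Defs.
From mathcomp Require Import all_boot all_order all_algebra.
From mathcomp Require Import all_classical all_reals all_analysis.
From mathcomp Require Import measurable_realfun ring lra.
Set Implicit Arguments.
Unset Strict Implicit.
Unset Printing Implicit Defensive.
Import Order.TTheory GRing.Theory Num.Theory.
Import numFieldNormedType.Exports.
Local Open Scope classical_set_scope.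
Local Open Scope ring_scope.

(** * The branching mechanism *)

Section Kernel.
Context {R : realType}.
Implicit Types z y u : R.

(** The process is accessible only through Laplace transforms, so the cutoff has to be built from
    exponentials of the increment; hence the variable e^{-z} and polynomials in it. The factor (1 -
    e^{-z})^2 makes this affordable: it produces second differences of [phi], whose integrand is
    dominated by min(u, u^2), so a uniform error del costs O(h del) per step and survives summation
    over t / h steps. Increments may be negative, so e^{X(s) - X(s + h)} is not confined to [0, 1];
    like the factors e^{i X(s)}, it is bounded only while X(s) <= K. The weights are therefore
    killed at partition times with value above K, and since cadlag paths are bounded on [0, t] the
    loss is small uniformly in the partition. Constants are chosen in the order eps, K, eta, del, p,
    h. The coefficients of p are uncontrolled, but they enter only the O(h^2) terms, and h goes to 0
    last. The ramp between r + eta and r + 2 eta leaves some jumps undecided: up to eps, e^{-x u(t)}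
    lies between the probabilities of no jump above r and of none above r + 2 eta, and eta -> 0
    closes the gap. *)

Definition exp_rem z u : R := expR (- (z * u)) - 1 + z * u.

Lemma expRN_le1 a : 0 <= a -> expR (- a) <= 1 :> R.
Proof. by move=> a0; rewrite expR_le1 oppr_le0. Qed.

Lemma expRN_ge1B a : 1 - a <= expR (- a) :> R.
Proof. exact: expR_ge1Dx. Qed.

Lemma exp_rem_0l u : exp_rem 0 u = 0.
Proof. by rewrite /exp_rem mul0r oppr0 expR0 addr0 subrr. Qed.

Lemma exp_rem_ge0 z u : 0 <= exp_rem z u.
Proof. by rewrite /exp_rem; have := expRN_ge1B (z * u); lra. Qed.

(** With d = (z - y) u the difference is d - (e^{-yu} - e^{-zu}). Factoring out e^{-yu} bounds the
    bracket above by d. Factoring out e^{-zu} bounds it below by d e^{-zu}, so the difference is at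
    most d (1 - e^{-zu}), and 1 - e^{-zu} <= (1 + z) min(1, u). *)
Lemma exp_rem_mono y z u : 0 <= y -> y <= z -> 0 <= u ->
  0 <= exp_rem z u - exp_rem y u <= (z - y) * (1 + z) * Num.min u (u ^+ 2).
Proof.
move=> y0 yz u0; have z0 := le_trans y0 yz.
pose d := (z - y) * u; have d0 : 0 <= d by rewrite mulr_ge0 ?subr_ge0.
have yu0 : 0 <= y * u by rewrite mulr_ge0.
have zu0 : 0 <= z * u by rewrite mulr_ge0.
have -> : exp_rem z u - exp_rem y u = d - (expR (- (y * u)) - expR (- (z * u))).
  by rewrite /exp_rem /d; lra.
have E1 : expR (- (z * u)) = expR (- (y * u)) * expR (- d).
  by rewrite -expRD /d; congr expR; ring.
have E2 : expR (- (y * u)) = expR (- (z * u)) * expR d.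
  by rewrite -expRD /d; congr expR; ring.
have h1 := expRN_le1 yu0; have h2 := expRN_ge1B d.
have h3 := expR_ge0 (- (y * u)); have h4 := expR_ge0 (- (z * u)).
have h5 := expR_ge1Dx d; have h6 := expRN_le1 zu0; have h7 := expRN_ge1B (z * u).
have h8 := expRN_le1 d0.
apply/andP; split.
  rewrite E1; set a := expR (- (y * u)) in h1 h3 *.
  set b := expR (- d) in h2 h8 *; nra.
have A : d - (expR (- (y * u)) - expR (- (z * u))) <= d * (1 - expR (- (z * u))).
  rewrite E2; set a := expR (- (z * u)) in h4 h6 *.
  set b := expR d in h5 *; nra.
apply: (le_trans A); rewrite /d -!mulrA ler_wpM2l ?subr_ge0//.
rewrite /Num.min; case: ifP => _.
  set a := expR (- (z * u)) in h4 h6 *; nra.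
set a := expR (- (z * u)) in h4 h6 h7 *; nra.
Qed.

Lemma exp_rem_le z u : 0 <= z -> 0 <= u ->
  `|exp_rem z u| <= z * (1 + z) * Num.min u (u ^+ 2).
Proof.
move=> z0 u0; rewrite ger0_norm ?exp_rem_ge0//.
by have /andP[_] := exp_rem_mono (lexx 0) z0 u0; rewrite exp_rem_0l !subr0.
Qed.

Lemma sqr_1BexpRN_le u : 0 <= u -> (1 - expR (- u)) ^+ 2 <= Num.min u (u ^+ 2).
Proof.
move=> u0; have h1 := expRN_le1 u0; have h2 := expRN_ge1B u; have h3 := expR_ge0 (- u).
rewrite /Num.min; case: ifP => _; set a := expR (- u) in h1 h2 h3 *; nra.
Qed.

Lemma measurable_exp_rem z (D : set R) : measurable_fun D (exp_rem z).
Proof.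
apply: measurable_funTS; apply: continuous_measurable_fun => u.
rewrite /exp_rem; apply: cvgD; last by apply: cvgM; [exact: cvg_cst|exact: cvg_id].
apply: cvgB; last exact: cvg_cst.
apply: continuous_comp; last exact: continuous_expR.
by apply: cvgN; apply: cvgM; [exact: cvg_cst|exact: cvg_id].
Qed.

End Kernel.

(** * Mechanisms as locally Lipschitz functions *)

Section Mechanism.
Context {R : realType}.
Local Notation RR := (measurableTypeR R).
Variable m : {measure set RR -> \bar R}.
Hypothesis hm : (\int[m]_(u in `]0%R, +oo[) (Num.min u (u ^+ 2))%:E < +oo)%E.
Implicit Types (D : set RR) (f : RR -> R).

Let pos : set RR := `]0%R, +oo[.

Let mpos : measurable pos. Proof. exact: measurable_itv. Qed.

Lemma measurable_min_sqr D : measurable_fun D (fun u : RR => Num.min u (u ^+ 2)).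
Proof.
apply: measurable_funTS; apply: measurable_minr => //. 
Qed.

Lemma min_sqr_ge0 (u : R) : 0 <= u -> 0 <= Num.min u (u ^+ 2).
Proof. by move=> u0; rewrite le_min u0 sqr_ge0. Qed.

Lemma integrable_min_sqr : m.-integrable pos (fun u => (Num.min u (u ^+ 2))%:E).
Proof.
apply/integrableP; split; first by apply/measurable_EFinP; exact: measurable_min_sqr.
rewrite (eq_integral (fun u : RR => (Num.min u (u ^+ 2))%:E))// => u.
rewrite inE /pos /= in_itv/= andbT => u0.
by rewrite /= ger0_norm// min_sqr_ge0// ltW.
Qed.

Definition min_sqr_mass : R := \int[m]_(u in pos) Num.min u (u ^+ 2).

Lemma min_sqr_mass_ge0 : 0 <= min_sqr_mass.
Proof.
by apply: Rintegral_ge0 => u; rewrite /pos/= in_itv/= andbT => /ltW/min_sqr_ge0.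
Qed.

Lemma integrable_dominated D f (C : R) : measurable D -> D `<=` pos ->
  measurable_fun D f -> (forall u, D u -> `|f u| <= C * Num.min u (u ^+ 2)) ->
  m.-integrable D (EFin \o f).
Proof.
move=> mD Dp mf fC.
have hC : m.-integrable D (EFin \o (fun u => C * Num.min u (u ^+ 2))).
  have := integrableS mpos mD Dp integrable_min_sqr.
  by move=> /(integrableZl mD C); apply: eq_integrable.
apply: le_integrable hC => //; first exact/measurable_EFinP.
move=> u Du /=; rewrite lee_fin (le_trans (fC _ Du))//.
by rewrite ler_norm.
Qed.

Lemma Rintegral_dominated D f (C : R) : measurable D -> D `<=` pos -> 0 <= C ->
  measurable_fun D f -> (forall u, D u -> `|f u| <= C * Num.min u (u ^+ 2)) ->
  `|\int[m]_(u in D) f u| <= C * min_sqr_mass.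
Proof.
move=> mD Dp C0 mf fC; have fi := integrable_dominated mD Dp mf fC.
apply: (le_trans (le_normr_Rintegral mD fi)).
have mi := integrableS mpos mD Dp integrable_min_sqr.
apply: (@le_trans _ _ (\int[m]_(u in D) (C * Num.min u (u ^+ 2)))).
  apply: le_Rintegral => //.
  - apply: (integrable_dominated (C := C)) => //; first exact: measurableT_comp.
    by move=> u Du; rewrite normr_id; exact: fC.
  - by have := integrableZl mD C mi; apply: eq_integrable.
rewrite RintegralZl// ler_wpM2l//.
rewrite /Rintegral fine_le//.
- exact: integrable_fin_num.
- exact: integrable_fin_num integrable_min_sqr.
apply: ge0_subset_integral => //.
- by apply/measurable_EFinP; exact: measurable_min_sqr.
- by move=> u; rewrite /pos/= in_itv/= andbT lee_fin => /ltW/min_sqr_ge0.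
Qed.

Lemma integrable_exp_rem D z : measurable D -> D `<=` pos -> 0 <= z ->
  m.-integrable D (EFin \o exp_rem z).
Proof.
move=> mD Dp z0; apply: (integrable_dominated mD Dp (C := z * (1 + z))).
  exact: measurable_exp_rem.
by move=> u /Dp; rewrite /pos/= in_itv/= andbT => u0; apply: exp_rem_le => //; exact: ltW.
Qed.

Definition lip_const (b c : R) : R := `|b| + 2 * c + min_sqr_mass.

(** The three terms of [lip_const] come from the drift, from c (z + y) <= 2 c (1 + z), and from
    [exp_rem_mono], whose bound does not depend on [D]; the full and the truncated mechanism thus
    differ only through their drift here. *)
Lemma mechanism_lipschitz D b c y z : measurable D -> D `<=` pos -> 0 <= c ->
  0 <= y -> y <= z ->
  `|mechanism_on D b c m z - mechanism_on D b c m y|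
    <= lip_const b c * (1 + z) * (z - y).
Proof.
move=> mD Dp c0 y0 yz; have z0 := le_trans y0 yz.
have iz := integrable_exp_rem mD Dp z0; have iy := integrable_exp_rem mD Dp y0.
rewrite /mechanism_on -!/(exp_rem _ _).
have -> : b * z + c * z ^+ 2 + \int[m]_(u in D) exp_rem z u -
   (b * y + c * y ^+ 2 + \int[m]_(u in D) exp_rem y u) =
   b * (z - y) + c * (z + y) * (z - y) +
   (\int[m]_(u in D) exp_rem z u - \int[m]_(u in D) exp_rem y u) by ring.
rewrite -RintegralB//.
have H : `|\int[m]_(u in D) (exp_rem z u - exp_rem y u)| <=
    (z - y) * (1 + z) * min_sqr_mass.
  apply: Rintegral_dominated => //.
  - by rewrite mulr_ge0// ?subr_ge0// addr_ge0.
  - by apply: measurable_funB; exact: measurable_exp_rem.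
  move=> u /Dp; rewrite /pos/= in_itv/= andbT => /ltW u0.
  by have /andP[? ?] := exp_rem_mono y0 yz u0; rewrite ger0_norm.
have H1 : `|b * (z - y)| <= `|b| * (1 + z) * (z - y).
  rewrite normrM (ger0_norm (_ : 0 <= z - y)) ?subr_ge0//.
  by rewrite ler_wpM2r ?subr_ge0// ler_peMr// lerDl.
have H2 : `|c * (z + y) * (z - y)| <= 2 * c * (1 + z) * (z - y).
  rewrite ger0_norm; last by apply: mulr_ge0; [apply: mulr_ge0 => //; exact: addr_ge0|rewrite subr_ge0].
  by rewrite ler_wpM2r ?subr_ge0//; nra.
rewrite (le_trans (ler_normD _ _))// (le_trans (lerD (ler_normD _ _) H))//.
by rewrite (le_trans (lerD (lerD H1 H2) (lexx _)))// /lip_const; lra.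
Qed.

Lemma lip_const_ge0 b c : 0 <= c -> 0 <= lip_const b c.
Proof.
move=> c0; rewrite /lip_const; have := min_sqr_mass_ge0; have := normr_ge0 b; lra.
Qed.

Lemma mechanism_0 D b c : mechanism_on D b c m 0 = 0.
Proof.
rewrite /mechanism_on !mulr0 expr0n/= mulr0 !add0r.
rewrite (@eq_Rintegral _ _ _ m D (cst 0)); last first.
  by move=> u _; exact: exp_rem_0l.
by rewrite /Rintegral integral0.
Qed.

End Mechanism.

(** * Jumps larger than r, and second differences of the mechanism *)

Section JumpTail.
Context {R : realType}.
Local Notation RR := (measurableTypeR R).
Variable m : {measure set RR -> \bar R}.
Hypothesis hm : (\int[m]_(u in `]0%R, +oo[) (Num.min u (u ^+ 2))%:E < +oo)%E.

Let pos : set RR := `]0%R, +oo[.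
Let tail (r : R) : set RR := `]r, +oo[.

Let mpos : measurable pos. Proof. exact: measurable_itv. Qed.
Let mtail r : measurable (tail r). Proof. exact: measurable_itv. Qed.

Lemma itvoy_sub r : 0 <= r -> tail r `<=` pos.
Proof.
by move=> r0 u; rewrite /tail /pos/= !in_itv/= !andbT; exact: le_lt_trans.
Qed.

(** [Num.min u (u ^+ 2)] is bounded away from 0 beyond [r]; this is what turns bounded functions on
    the tail into dominated ones. *)
Lemma tail_min_sqr_ge (r u : R) : 0 < r -> tail r u ->
  1 <= (Num.min r (r ^+ 2))^-1 * Num.min u (u ^+ 2).
Proof.
move=> r0; rewrite /tail/= in_itv/= andbT => ru.
have h : 0 < Num.min r (r ^+ 2) by rewrite lt_min r0 exprn_gt0.
rewrite ler_pdivlMl// mulr1 le_min !ge_min (ltW ru)/=.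
apply/orP; right; rewrite !expr2; have u0 := lt_trans r0 ru.
by rewrite ler_pM// ltW.
Qed.

Lemma integrable_tail_bounded r (f : RR -> R) (C : R) : 0 < r ->
  measurable_fun (tail r) f -> (forall u, tail r u -> `|f u| <= C) ->
  m.-integrable (tail r) (EFin \o f).
Proof.
move=> r0 mf fC; apply: (integrable_dominated hm (C := C / Num.min r (r ^+ 2))) => //.
  exact/itvoy_sub/ltW.
move=> u ru; apply: (le_trans (fC _ ru)); rewrite -mulrA ler_peMr//.
  exact: le_trans (fC _ ru).
exact: tail_min_sqr_ge.
Qed.

Lemma tail_mass_lty r : 0 < r -> (m (tail r) < +oo)%E.
Proof.
move=> r0; have h : m.-integrable (tail r) (EFin \o cst 1).
  by apply: (@integrable_tail_bounded r _ 1) => // u _; rewrite normr1.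
have := integrable_lty (mtail r) h.
by rewrite (eq_integral (cst 1%:E))// integral_cst// mul1e.
Qed.

Lemma integrable_tail_id r : 0 < r -> m.-integrable (tail r) (EFin \o id).
Proof.
move=> r0; apply: (integrable_dominated hm (C := 1 + r^-1)) => //.
  exact/itvoy_sub/ltW.
move=> u; rewrite /tail/= in_itv/= andbT => ru; have u0 := lt_trans r0 ru.
have rV : 0 < r^-1 by rewrite invr_gt0.
rewrite gtr0_norm// /Num.min; case: ifP => _; first by rewrite ler_peMl ?ltW//; lra.
have h1 : u <= r^-1 * u ^+ 2 by rewrite ler_pdivlMl// expr2 ler_wpM2r// ltW.
by apply: (le_trans h1); rewrite ler_wpM2r ?sqr_ge0// lerDr.
Qed.

Lemma measurable_expRNM (D : set RR) (z : R) :
  measurable_fun D (fun u : RR => expR (- (z * u))).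
Proof.
apply: measurable_funTS; apply: continuous_measurable_fun => u.
apply: continuous_comp; last exact: continuous_expR.
by apply: cvgN; apply: cvgM; [exact: cvg_cst|exact: cvg_id].
Qed.

Lemma integrable_tail_expR r z : 0 < r -> 0 <= z ->
  m.-integrable (tail r) (EFin \o (fun u : RR => expR (- (z * u)))).
Proof.
move=> r0 z0; apply: (@integrable_tail_bounded r _ 1) => //.
  exact: measurable_expRNM.
move=> u; rewrite /tail/= in_itv/= andbT => ru; have u0 := lt_trans r0 ru.
by rewrite ger0_norm ?expR_ge0// expRN_le1// mulr_ge0// ltW.
Qed.

(** On the tail the extra drift of [phi_trunc] supplies exactly the compensator z u, so that [phi]
    exceeds it by the integral of e^{-zu} - 1 alone, and the -1 integrates to the tail mass. *)
Lemma phi_trunc_tail b c r z : 0 < r -> 0 <= z ->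
  fine (m (tail r)) - phi_trunc r b c m z
  = \int[m]_(u in tail r) expR (- (z * u)) - phi b c m z.
Proof.
move=> r0 z0; rewrite /phi_trunc /phi /mechanism_on /drift_trunc -!/(exp_rem _ _).
have -> : \int[m]_(u in `]0%R, +oo[) exp_rem z u =
    \int[m]_(u in `]0%R, r]) exp_rem z u + \int[m]_(u in tail r) exp_rem z u.
  have E : `]0%R, +oo[%classic = `]0, r]%classic `|` tail r :> set RR.
    by rewrite /tail -itv_bndbnd_setU// bnd_simp; exact: ltW.
  rewrite E Rintegral_setU//.
  - by rewrite -E; exact: integrable_exp_rem.
  - rewrite disj_set2E; apply/eqP; rewrite -subset0 => u [].
    by rewrite /tail/= !in_itv/= andbT => /andP[_ ur] /(le_lt_trans ur); rewrite ltxx.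
have i1 : m.-integrable (tail r) (EFin \o cst 1).
  by apply: (@integrable_tail_bounded r _ 1) => // u _; rewrite normr1.
have i2 := integrable_tail_id r0.
have i3 := integrable_tail_expR r0 z0.
have i4 : m.-integrable (tail r) (EFin \o (fun u => z * u)).
  by have := integrableZl (mtail r) z i2; apply: eq_integrable.
have i5 : m.-integrable (tail r) (EFin \o (fun u => expR (- (z * u)) - 1)).
  have := integrableB (mtail r) i3 i1; exact: eq_integrable.
have -> : \int[m]_(u in tail r) exp_rem z u =
   \int[m]_(u in tail r) expR (- (z * u)) - fine (m (tail r)) + z * \int[m]_(u in tail r) u.
  rewrite /exp_rem RintegralD// RintegralB// RintegralZl//.
  by rewrite Rintegral_cst// mul1r.
rewrite -/(tail r); ring.
Qed.

Lemma sqr_diff_le w (u : RR) : 0 <= w -> 0 <= u ->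
  `|expR (- (w * u)) * (1 - expR (- u)) ^+ 2| <= Num.min u (u ^+ 2).
Proof.
move=> w0 u0; rewrite ger0_norm; last by rewrite mulr_ge0 ?expR_ge0 ?sqr_ge0.
apply: (le_trans _ (sqr_1BexpRN_le u0)); rewrite ler_piMl ?sqr_ge0//.
by apply: expRN_le1; exact: mulr_ge0.
Qed.

(** A second difference with step 1 annihilates the affine part of [exp_rem], turns e^{-wu} into
    e^{-wu} (1 - e^{-u})^2 and c w^2 into 2 c. This is how the factor (1 - e^{-Z})^2 of an increment
    is seen by the mechanism. *)
Lemma phi_second_diff b c w : 0 <= w ->
  phi b c m w - 2 * phi b c m (w + 1) + phi b c m (w + 2)
  = 2 * c + \int[m]_(u in pos) (expR (- (w * u)) * (1 - expR (- u)) ^+ 2).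
Proof.
move=> w0; rewrite /phi /mechanism_on -!/(exp_rem _ _).
have ie z : 0 <= z -> m.-integrable pos (EFin \o exp_rem z) by exact: integrable_exp_rem.
have i0 := ie _ w0; have i1 : m.-integrable pos (EFin \o exp_rem (w + 1)) by apply: ie; lra.
have i2 : m.-integrable pos (EFin \o exp_rem (w + 2)) by apply: ie; lra.
have i3 : m.-integrable pos (EFin \o (fun u => 2 * exp_rem (w + 1) u)).
  by have := integrableZl mpos 2 i1; apply: eq_integrable.
have i4 : m.-integrable pos (EFin \o (fun u => exp_rem w u - 2 * exp_rem (w + 1) u)).
  by have := integrableB mpos i0 i3; apply: eq_integrable.
have -> : \int[m]_(u in pos) (expR (- (w * u)) * (1 - expR (- u)) ^+ 2) =
   \int[m]_(u in pos) (exp_rem w u - 2 * exp_rem (w + 1) u + exp_rem (w + 2) u).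
  apply: eq_Rintegral => u _; rewrite /exp_rem.
  have -> : expR (- ((w + 1) * u)) = expR (- (w * u)) * expR (- u).
    by rewrite -expRD; congr expR; ring.
  have -> : expR (- ((w + 2) * u)) = expR (- (w * u)) * expR (- u) * expR (- u).
    by rewrite -!expRD; congr expR; ring.
  ring.
rewrite (RintegralD mpos i4 i2) (RintegralB mpos i0 i3) (RintegralZl 2 mpos i1) -/pos; ring.
Qed.

End JumpTail.

(** * The cumulant semigroup and the truncated equation *)

Section Lebesgue.
Context {R : realType}.
Local Notation mu := (@lebesgue_measure R).

Lemma measurable_itvR (i : interval R) :
  measurable ([set` i] : set (measurableTypeR R)).
Proof. exact: measurable_itv. Qed.

Lemma Rintegral_itv_cst (a b k : R) : a <= b ->
  \int[mu]_(s in `[a, b]) k = k * (b - a).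
Proof.
move=> ab; rewrite Rintegral_cst//; congr (_ * _).
have h : mu `[a, b]%classic = (b - a)%:E.
  rewrite lebesgue_measure_itv/= lte_fin.
  by move: ab; rewrite le_eqVlt => /predU1P[->|->]; rewrite ?ltxx ?subrr.
exact: (congr1 fine h).
Qed.

Lemma integrable_itv_cst (a b k : R) : mu.-integrable `[a, b] (EFin \o cst k).
Proof.
apply: continuous_compact_integrable; first exact: segment_compact.
exact/continuous_subspaceT/cst_continuous.
Qed.

Lemma Rintegral_itv_le (f : R -> R) (a b k : R) : a <= b ->
  mu.-integrable `[a, b] (EFin \o f) ->
  (forall s, a <= s <= b -> f s <= k) ->
  \int[mu]_(s in `[a, b]) f s <= k * (b - a).
Proof.
move=> ab fi fk; rewrite -Rintegral_itv_cst//.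
by apply: le_Rintegral => //; exact: integrable_itv_cst.
Qed.

Lemma Rintegral_itv_norm_le (f : R -> R) (a b k : R) : a <= b ->
  mu.-integrable `[a, b] (EFin \o f) ->
  (forall s, a <= s <= b -> `|f s| <= k) ->
  `|\int[mu]_(s in `[a, b]) f s| <= k * (b - a).
Proof.
move=> ab fi fk; apply: (le_trans (le_normr_Rintegral _ fi)) => //.
by apply: Rintegral_itv_le => //; have := integrable_norm fi.
Qed.

End Lebesgue.

(** * Short-time expansion of the cumulant *)

Section Cumulant.
Context {R : realType}.
Local Notation mu := (@lebesgue_measure R).
Variables (f : R -> R) (L beta : R).
Hypothesis L0 : 0 <= L.
Hypothesis beta0 : 0 <= beta.
Hypothesis f0 : f 0 = 0.
Hypothesis flip : forall y z : R, 0 <= y -> y <= z ->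
  `|f z - f y| <= L * (1 + z) * (z - y).
Hypothesis fge : forall z : R, 0 <= z -> - (beta * z) <= f z.

Lemma lip_segment (Z y z : R) : 0 <= y <= Z -> 0 <= z <= Z ->
  `|f z - f y| <= L * (1 + Z) * `|z - y|.
Proof.
wlog yz : y z / y <= z.
  move=> H hy hz; have [yz|/ltW zy] := leP y z; first exact: H.
  by rewrite distrC (distrC z); exact: H.
move=> /andP[y0 yZ] /andP[z0 zZ].
apply: (le_trans (flip y0 yz)); rewrite (ger0_norm (_ : 0 <= z - y)) ?subr_ge0//.
by apply: ler_wpM2r; rewrite ?subr_ge0//; apply: ler_wpM2l => //; rewrite lerD2l.
Qed.

Lemma cumulant_continuous (l : R) v (h : R) : 0 <= h -> cumulant_solution f l v ->
  {within `[0, h], continuous v}.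
Proof.
move=> h0 vs; have [_ vi _] := vs _ h0.
have := parameterized_integral_continuous h0 vi => /= cI.
have : {within `[0, h], continuous (fun t => l - \int[mu]_(s in `[0, t]) f (v s))}.
  by move=> x; apply: cvgB; [exact: cvg_cst|exact: cI].
apply: subspace_eq_continuous => t; rewrite inE/= in_itv/= => /andP[t0 _].
by have [] := vs _ t0.
Qed.

(** At a maximum point c of [v] over [0, h], the lower bound on [f] gives v c <= l + beta h v c <= l
    + v c / 2. The admissible step does not depend on [l]. *)
Lemma cumulant_bound (l : R) v (h : R) : 0 <= l -> 0 <= h -> 2 * beta * h <= 1 ->
  cumulant_solution f l v -> forall s, 0 <= s <= h -> v s <= 2 * l.
Proof.
have aux (a I B q : R) : a = q - I -> - I <= B -> B <= a / 2 -> a <= 2 * q by lra.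
move=> l0 h0 bh vs; have [c ch cmax] := EVT_max h0 (cumulant_continuous h0 vs).
have vc s : 0 <= s <= h -> v s <= v c by move=> sh; apply: cmax; rewrite in_itv.
move: ch; rewrite in_itv/= => /andP[c0 ch].
have [vc0 ci vcE] := vs _ c0.
have I1 : \int[mu]_(s in `[0, c]) - f (v s) <= beta * v c * (c - 0).
  apply: Rintegral_itv_le => //.
    by have := integrableN ci; apply: eq_integrable.
  move=> s /andP[s0 sc]; have [vs0 _ _] := vs _ s0.
  rewrite lerNl; apply: le_trans (fge vs0); rewrite lerN2 ler_wpM2l// vc//.
  by rewrite s0 (le_trans sc).
have I2 : \int[mu]_(s in `[0, c]) - f (v s) = - \int[mu]_(s in `[0, c]) f (v s).
  have := RintegralZl (-1) (measurable_itvR `[0, c]) ci; rewrite mulN1r => <-.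
  by apply: eq_Rintegral => s _; rewrite mulN1r.
have H : v c <= 2 * l.
  apply: (aux _ _ _ _ vcE); first by rewrite -I2; exact: I1.
  rewrite subr0 mulrAC ler_pdivlMr// mulrC mulrA.
  rewrite -[leRHS]mul1r ler_wpM2r//; apply: le_trans bh.
  by rewrite -mulrA !ler_wpM2l.
by move=> s sh; apply: le_trans H; exact: vc.
Qed.

(** Since [v] stays below 2 Lam, where [f] has Lipschitz constant [K], one has |f| <= 2 K Lam along
    [v], hence |v s - l| <= 2 K Lam h; integrating f (v s) - f l then gains the second power of
    [h]. *)
Lemma cumulant_expansion (Lam : R) : 0 <= Lam -> exists C, 0 <= C /\
  forall (l : R) v (h : R), 0 <= l <= Lam -> 0 <= h -> 2 * beta * h <= 1 ->
    cumulant_solution f l v -> `|v h - l + h * f l| <= C * h ^+ 2.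
Proof.
move=> Lam0; pose K := L * (1 + 2 * Lam).
have K0 : 0 <= K by rewrite mulr_ge0//; lra.
exists (K * (K * (2 * Lam))); split; first by apply: mulr_ge0 => //; apply: mulr_ge0 => //; apply: mulr_ge0.
move=> l v h /andP[l0 lLam] h0 bh vs.
have vb s : 0 <= s <= h -> 0 <= v s <= 2 * Lam.
  move=> sh; have /andP[s0 _] := sh; have [vs0 _ _] := vs _ s0.
  by rewrite vs0/= (le_trans (cumulant_bound l0 h0 bh vs sh))// ler_wpM2l.
have fb s : 0 <= s <= h -> `|f (v s)| <= K * (2 * Lam).
  move=> sh; rewrite -[f _]subr0 -f0.
  apply: (le_trans (@lip_segment (2 * Lam) _ _ _ _)); rewrite ?lexx ?vb ?mulr_ge0//.
  have /andP[? ?] := vb _ sh.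
  by rewrite subr0 ger0_norm// ler_wpM2l.
have vl s : 0 <= s <= h -> `|v s - l| <= K * (2 * Lam) * h.
  move=> /andP[s0 sh]; have [_ si vE] := vs _ s0.
  have -> : v s - l = - \int[mu]_(s in `[0, s]) f (v s) by rewrite vE; ring.
  rewrite normrN; apply: (@le_trans _ _ (K * (2 * Lam) * (s - 0))).
    apply: Rintegral_itv_norm_le => // q /andP[q0 qs]; apply: fb.
    by rewrite q0 (le_trans qs).
  by rewrite subr0 ler_wpM2l//; apply: mulr_ge0 => //; apply: mulr_ge0.
have [_ hi vE] := vs _ h0.
have ci : mu.-integrable `[0, h] (EFin \o cst (f l)) by exact: integrable_itv_cst.
have -> : v h - l + h * f l = - \int[mu]_(s in `[0, h]) (f (v s) - f l).
  by rewrite RintegralB// Rintegral_itv_cst// vE; ring.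
rewrite normrN; apply: (@le_trans _ _ (K * (K * (2 * Lam) * h) * (h - 0))).
  apply: Rintegral_itv_norm_le => //.
    by have := integrableB (measurable_itvR _) hi ci; apply: eq_integrable.
  move=> s sh; apply: (le_trans (@lip_segment (2 * Lam) _ _ _ _)).
  - by rewrite l0/=; lra.
  - exact: vb.
  - by rewrite ler_wpM2l// vl.
by rewrite subr0 expr2 !mulrA.
Qed.

End Cumulant.

(** * Existence for the truncated equation *)

Section ODEexistence.
Context {R : realType}.
Local Notation mu := (@lebesgue_measure R).
Variables (g : R -> R) (theta beta C : R).
Hypothesis theta0 : 0 <= theta.
Hypothesis beta0 : 0 <= beta.
Hypothesis C0 : 0 <= C.
Hypothesis gc : continuous g.
Hypothesis g0 : 0 <= g 0.
Hypothesis gle : forall z : R, 0 <= z -> g z <= theta + beta * z.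
Hypothesis glip : forall y z : R, 0 <= y -> y <= z ->
  `|g z - g y| <= C * (1 + z) * (z - y).

(* [B] is a supersolution, and [La'] dominates the Lipschitz constant of [g] on
   [0, B s]; the integral equation weighted by [expR La] is therefore monotone, and
   its Picard iterates from 0 increase to a solution below [B]. *)
Let kap : R := theta + beta + 1.
Let B (s : R) : R := expR (kap * s).
Let La (s : R) : R := 2 * C / kap * B s.
Let F (s z : R) : R := expR (La s) * (g z + 2 * C * B s * z).

Let kap_gt0 : 0 < kap. Proof. by rewrite /kap ltr_wpDl// addr_ge0. Qed.

Let B_ge1 (s : R) : 0 <= s -> 1 <= B s.
Proof. by move=> s0; rewrite /B -[X in X <= _]expR0 ler_expR mulr_ge0// ltW. Qed.

Let dB (s : R) : is_derive s 1 B (kap * B s).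
Proof.
have h : is_derive s (1:R) (fun s => kap * s) kap.
  by have := is_deriveZ kap (is_derive_id s (1:R)); rewrite scaler1.
have := is_derive1_comp (is_derive_expR (kap * s)) h.
by rewrite mulrC.
Qed.

Let dLa (s : R) : is_derive s 1 La (2 * C * B s).
Proof.
have := is_deriveZ (2 * C / kap) (dB s).
rewrite (_ : _ *: (kap * B s) = 2 * C * B s)// /GRing.scale/=.
by rewrite mulrA divfK// gt_eqF.
Qed.

Let cB : continuous B.
Proof. by move=> s; apply/differentiable_continuous/derivable1_diffP; case: (dB s). Qed.

Let cLa : continuous La.
Proof. by move=> s; apply/differentiable_continuous/derivable1_diffP; case: (dLa s). Qed.

Let ceLa : continuous (fun s => expR (La s)).
Proof. by move=> s; apply: continuous_comp; [exact: cLa|exact: continuous_expR]. Qed.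

Let ceNLa : continuous (fun s => expR (- La s)).
Proof.
move=> s; apply: continuous_comp; last exact: continuous_expR.
by apply: cvgN; exact: cLa.
Qed.

Let dG (s : R) : is_derive s 1 (fun s => expR (La s) * B s)
  (expR (La s) * (kap * B s + 2 * C * B s * B s)).
Proof.
have h := is_derive1_comp (is_derive_expR (La s)) (dLa s).
apply: (is_derive_eq (is_deriveM h (dB s))).
by rewrite /GRing.scale/=; ring.
Qed.

(** On [0, B s] the Lipschitz constant of [g] is at most C (1 + B s) <= 2 C B s, which the added
    linear term compensates. *)
Let F_mono (s y z : R) : 0 <= s -> 0 <= y -> y <= z -> z <= B s -> F s y <= F s z.
Proof.
move=> s0 y0 yz zB; rewrite /F ler_wpM2l ?expR_ge0//.
have := glip y0 yz; rewrite ler_norml => /andP[h _].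
have B1 := B_ge1 s0.
have : C * (1 + z) * (z - y) <= 2 * C * B s * (z - y).
  by apply: ler_wpM2r; [lra|rewrite -mulrA (mulrC 2) -mulrA ler_wpM2l//; lra].
by move: h; lra.
Qed.

Let F_ge0 (s z : R) : 0 <= s -> 0 <= z -> z <= B s -> 0 <= F s z.
Proof.
move=> s0 z0 zB; apply: le_trans (F_mono s0 (lexx 0) z0 zB).
by rewrite /F mulr0 addr0 mulr_ge0 ?expR_ge0.
Qed.

(** The value of [g] at [B s] is at most theta + beta B s <= kap B s, because B s >= 1. The right
    side is the derivative computed in [dG]. *)
Let F_leB (s z : R) : 0 <= s -> 0 <= z -> z <= B s ->
  F s z <= expR (La s) * (kap * B s + 2 * C * B s * B s).
Proof.
move=> s0 z0 zB; have B1 := B_ge1 s0.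
apply: (le_trans (F_mono s0 z0 zB (lexx _))); rewrite /F ler_wpM2l ?expR_ge0// lerD2r.
have B0 : 0 <= B s by lra.
apply: (le_trans (gle B0)); rewrite /kap !mulrDl mul1r.
by have : theta <= theta * B s; [rewrite ler_peMr|lra].
Qed.

(** As [La] has derivative 2 C B, the equation u' = g u amounts to (e^{La} u)' = F s u; solutions
    starting at 0 are the fixed points. *)
Let step (u : R -> R) (t : R) : R := expR (- La t) * \int[mu]_(s in `[0, t]) F s (u s).

Let F_within (u : R -> R) (T : R) : {within `[0, T], continuous u} ->
  {within `[0, T], continuous (fun s => F s (u s))}.
Proof.
have h1 : {within `[0, T], continuous (fun s => expR (La s))} by exact: continuous_subspaceT.
have h2 : {within `[0, T], continuous B} by exact: continuous_subspaceT.
move=> cu x; rewrite /F; apply: cvgM; first exact: h1.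
apply: cvgD; first by apply: continuous_cvg; [exact: gc|exact: cu].
apply: cvgM; last exact: cu.
by apply: cvgM; [exact: cvg_cst|exact: h2].
Qed.

Let F_int (u : R -> R) (T : R) : {within `[0, T], continuous u} ->
  mu.-integrable `[0, T] (EFin \o (fun s => F s (u s))).
Proof.
move=> cu; apply: continuous_compact_integrable; first exact: segment_compact.
exact: F_within.
Qed.

Let step_within (u : R -> R) (T : R) : 0 <= T ->
  mu.-integrable `[0, T] (EFin \o (fun s => F s (u s))) ->
  {within `[0, T], continuous (step u)}.
Proof.
have h1 : {within `[0, T], continuous (fun s => expR (- La s))} by exact: continuous_subspaceT.
move=> T0 hi x; rewrite /step; apply: cvgM; first exact: h1.
exact: (parameterized_integral_continuous T0 hi).
Qed.

Let step_le (u w : R -> R) (t : R) : 0 <= t ->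
  mu.-integrable `[0, t] (EFin \o (fun s => F s (u s))) ->
  mu.-integrable `[0, t] (EFin \o (fun s => F s (w s))) ->
  (forall s, 0 <= s <= t -> [/\ 0 <= u s, u s <= w s & w s <= B s]) ->
  step u t <= step w t.
Proof.
move=> t0 ui wi uw; rewrite /step ler_wpM2l ?expR_ge0//.
apply: le_Rintegral => // s; rewrite /= in_itv/= => st; have [? ? ?] := uw _ st.
by apply: F_mono => //; case/andP: st.
Qed.

(** By [F_leB] the integrand is below the derivative of [G], so the integral is at most G t - G 0 <=
    G t. *)
Let step_B (u : R -> R) (t : R) : 0 <= t ->
  mu.-integrable `[0, t] (EFin \o (fun s => F s (u s))) ->
  (forall s, 0 <= s <= t -> 0 <= u s <= B s) -> step u t <= B t.
Proof.
move=> t0 ui uB; rewrite /step expRN mulrC ler_pdivrMr ?expR_gt0//.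
pose G s := expR (La s) * B s.
pose G' s := expR (La s) * (kap * B s + 2 * C * B s * B s).
have cG : continuous G.
  by move=> s; apply/differentiable_continuous/derivable1_diffP; case: (dG s).
have cG' : continuous G'.
  move=> s; apply: cvgM; first exact: ceLa.
  apply: cvgD; first by apply: cvgM; [exact: cvg_cst|exact: cB].
  by apply: cvgM; [apply: cvgM; [exact: cvg_cst|exact: cB]|exact: cB].
have [->|t_neq0] := eqVneq t 0.
  by rewrite set_itv1 Rintegral_set1 mulr_ge0 ?expR_ge0.
have tp : 0 < t by rewrite lt_neqAle eq_sym t_neq0.
have FTC : \int[mu]_(s in `[0, t]) G' s = G t - G 0.
  rewrite /Rintegral (@continuous_FTC2 _ G' G)//.
  - exact: continuous_subspaceT.
  - split; first by move=> x _; case: (dG x).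
      exact: cvg_at_right_filter (cG 0).
    exact: cvg_at_left_filter (cG t).
  - by move=> x _; rewrite derive1E; have [_ ->] := dG x.
have : \int[mu]_(s in `[0, t]) F s (u s) <= \int[mu]_(s in `[0, t]) G' s.
  apply: le_Rintegral => //.
    apply: continuous_compact_integrable; first exact: segment_compact.
    exact: continuous_subspaceT.
  move=> s; rewrite /= in_itv/= => st; have /andP[? ?] := uB _ st.
  by apply: F_leB => //; case/andP: st.
move=> /le_trans; apply; rewrite FTC /G mulrC gerBl.
by rewrite mulr_ge0 ?expR_ge0.
Qed.

Let it n : R -> R := iter n step (fun _ => 0).

Let it_within n (T : R) : 0 <= T -> {within `[0, T], continuous (it n)}.
Proof.
move=> T0; elim: n => [|n IH] /=; first exact/continuous_subspaceT/cst_continuous.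
by apply: step_within => //; exact: F_int.
Qed.

Let it_int n (t : R) : 0 <= t -> mu.-integrable `[0, t] (EFin \o (fun s => F s (it n s))).
Proof. by move=> t0; apply: F_int; exact: it_within. Qed.

Let it_bnd n (t : R) : 0 <= t -> [/\ 0 <= it n t, it n t <= it n.+1 t & it n.+1 t <= B t].
Proof.
elim: n t => [|n IH] t t0.
  have h s : 0 <= s -> 0 <= B s by move=> /B_ge1; lra.
  rewrite /it /=; split => //.
    rewrite /step mulr_ge0 ?expR_ge0//; apply: Rintegral_ge0 => s.
    by rewrite /= in_itv/= => /andP[s0 _]; apply: F_ge0 => //; exact: h.
  apply: (@step_B (it 0) t t0 (it_int 0 t0)).
  by move=> s /andP[s0 _]; rewrite lexx h.
have [h1 h2 h3] := IH _ t0; split; first exact: le_trans h2.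
  apply: (@step_le (it n) (it n.+1) t t0 (it_int n t0) (it_int n.+1 t0)).
  by move=> s /andP[s0 _]; exact: IH.
apply: (@step_B (it n.+1) t t0 (it_int n.+1 t0)).
by move=> s /andP[s0 _]; have [? ? ?] := IH _ s0; apply/andP; split => //; apply: le_trans; eauto.
Qed.

Let u (t : R) : R := limn (it ^~ t).

Let it_cvg t : it ^~ t @ \oo --> u t.
Proof.
have [t0|t0] := leP 0 t.
  apply: nondecreasing_is_cvgn.
    by apply/nondecreasing_seqP => n; have [] := it_bnd n t0.
  by exists (B t) => _ [n _ <-]; have [_ h] := it_bnd n t0; exact: le_trans h.
(* For negative [t] the domain of integration is empty, so the iterates are 0 and the limit still
   exists. *)
apply: (cvgP (0 : R)); apply: cvg_near_cst; exists 1%N => //= -[//|n] _.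
rewrite /it /= /step.
rewrite (_ : `[0, t]%classic = set0) ?Rintegral_set0 ?mulr0//.
by apply/seteqP; split => // x; rewrite /= in_itv/= => /andP[x0 xt]; have := le_lt_trans (le_trans x0 xt) t0; rewrite ltxx.
Qed.

Let u_bnd (t : R) : 0 <= t -> 0 <= u t <= B t.
Proof.
move=> t0; apply/andP; split.
  apply: limr_ge; first by apply: cvgP; exact: it_cvg.
  by near=> n; have [] := it_bnd n t0.
apply: limr_le; first by apply: cvgP; exact: it_cvg.
by near=> n; have [_ h] := it_bnd n t0; exact: le_trans h.
Unshelve. all: by end_near. Qed.

(** Dominated convergence along the iterates, with the majorant of [F_leB]. Integrability comes with
    the fixed point equation because the continuity of [u] is deduced from it afterwards. *)
Let u_fix_int (t : R) : 0 <= t -> mu.-integrable `[0, t] (EFin \o (fun s => F s (u s))) /\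
  u t = step u t.
Proof.
move=> t0.
pose G' s := expR (La s) * (kap * B s + 2 * C * B s * B s).
have cG' : continuous G'.
  move=> s; apply: cvgM; first exact: ceLa.
  apply: cvgD; first by apply: cvgM; [exact: cvg_cst|exact: cB].
  by apply: cvgM; [apply: cvgM; [exact: cvg_cst|exact: cB]|exact: cB].
have G'i : mu.-integrable `[0, t] (EFin \o G').
  apply: continuous_compact_integrable; first exact: segment_compact.
  exact: continuous_subspaceT.
have mi : measurable (`[0, t]%classic : set (measurableTypeR R)) by exact: measurable_itvR.
have mf n : measurable_fun `[0, t] (EFin \o (fun s => F s (it n s))).
  exact: (measurable_int mu (it_int n t0)).
have Fc s : F s (it n s) @[n --> \oo] --> F s (u s).
  apply: cvgM; first exact: cvg_cst.
  apply: cvgD; last by apply: cvgM; [exact: cvg_cst|exact: it_cvg].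
  by apply: continuous_cvg; [exact: gc|exact: it_cvg].
have FcE s : (F s (it n s))%:E @[n --> \oo] --> (F s (u s))%:E.
  by apply: cvg_EFin; [exact: nearW|exact: Fc].
pose Fn n (s : measurableTypeR R) : \bar R := (F s (it n s))%:E.
have mF : measurable_fun `[0, t] (EFin \o (fun s => F s (u s))).
  by apply: (@emeasurable_fun_cvg _ _ R _ Fn) => // s _; exact: FcE.
have dom (s : measurableTypeR R) n : `[0, t]%classic s -> (`|Fn n s| <= (EFin \o G') s)%E.
  rewrite /= in_itv/= => /andP[s0 _].
  have [b1 b2 b3] := it_bnd n s0; have b4 := le_trans b2 b3.
  by rewrite lee_fin ger0_norm; [exact: F_leB|exact: F_ge0].
have [ui _ ucv] : [/\ mu.-integrable `[0, t] (EFin \o (fun s => F s (u s))),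
   (\int[mu]_(s in `[0%R, t]) `|Fn n s - (F s (u s))%:E|)%E @[n --> \oo] --> 0%E &
   (\int[mu]_(s in `[0%R, t]) Fn n s)%E @[n --> \oo]
     --> (\int[mu]_(s in `[0%R, t]) (F s (u s))%:E)%E].
  apply: (@dominated_convergence _ _ R mu _ mi Fn _ (EFin \o G')) => //.
  - by apply: aeW => s _; exact: FcE.
  - by apply: aeW => s n; exact: dom.
split => //.
have : it n.+1 t @[n --> \oo] --> step u t.
  rewrite /it /= /step; apply: cvgM; first exact: cvg_cst.
  by apply: fine_cvg; rewrite fineK ?integrable_fin_num.
move=> h; have := @it_cvg t; rewrite -(cvg_shiftS (it ^~ t)) => h2.
have e1 := cvg_lim (@Rhausdorff R) h; have e2 := cvg_lim (@Rhausdorff R) h2.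
exact: etrans (esym (e2 _)) (e1 _).
Qed.

Let u_within (T : R) : 0 <= T -> {within `[0, T], continuous u}.
Proof.
move=> T0; have [ui _] := u_fix_int T0.
have := step_within T0 ui; apply: subspace_eq_continuous => t.
by rewrite inE/= in_itv/= => /andP[/u_fix_int[_ h] _].
Qed.

Lemma ode_exists : exists w : R -> R, [/\ w 0 = 0, forall t, 0 <= t -> 0 <= w t,
  h^-1 * (w h - w 0) @[h --> 0^'+] --> g (w 0) &
  forall t : R, 0 < t -> is_derive t 1 w (g (w t))].
Proof.
have w0 : u 0 = 0.
  by have [_ ->] := u_fix_int (lexx 0); rewrite /step set_itv1 Rintegral_set1 mulr0.
exists u; split => //.
- by move=> t /u_bnd/andP[].
- rewrite w0; have cF := F_within (u_within ler01).
  have [_ cF0 _] := (continuous_within_itvP _ ltr01).1 cF.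
  (* The average of the integrand over [0, h] tends to its right limit at 0; with the fixed point
     equation this gives the right derivative of [u]. *)
  have I0 : h^-1 * (\int[mu]_(s in `[0, h]) F s (u s)) @[h --> 0^'+] --> F 0 (u 0).
    apply/cvgrPdist_le => e e0.
    have /cvgrPdist_le/(_ e e0) := cF0.
    move=> [d /= d0 dF].
    near=> h.
    have h0 : 0 < h by near: h; exact: nbhs_right_gt.
    have hd : h < d by near: h; exact: nbhs_right_lt.
    have [hi _] := u_fix_int (ltW h0).
    have ci := integrable_itv_cst 0 h (F 0 (u 0)).
    have H : `|\int[mu]_(s in `[0, h]) (F 0 (u 0) - F s (u s))| <= e * (h - 0).
      apply: Rintegral_itv_norm_le; first exact: ltW.
        by have := integrableB (measurable_itvR _) ci hi; apply: eq_integrable.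
      move=> s /andP[]; rewrite le_eqVlt => /predU1P[<- _|s0 sh].
        by rewrite subrr normr0 ltW.
      by apply: dF => //=; rewrite sub0r normrN gtr0_norm// (le_lt_trans sh).
    have HI := RintegralB (measurable_itvR _) ci hi.
    rewrite HI (Rintegral_itv_cst _ (ltW h0)) subr0 in H.
    rewrite -[X in `|X - _|](mulKf (lt0r_neq0 h0)) -mulrBr normrM.
    by rewrite gtr0_norm ?invr_gt0// ler_pdivrMl// mulrC (mulrC h).
  have : expR (- La h) * (h^-1 * (\int[mu]_(s in `[0, h]) F s (u s)))
     @[h --> 0^'+] --> expR (- La 0) * F 0 (u 0).
    by apply: cvgM => //; exact: cvg_at_right_filter (@ceNLa 0).
  rewrite /F w0 mulr0 addr0 mulrA -expRD addNr expR0 mul1r.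
  apply: cvg_trans; apply: near_eq_cvg; near=> h.
  have h0 : 0 <= h by near: h; exact: nbhs_right_ge.
  by rewrite subr0; have [_ ->] := u_fix_int h0; rewrite /step /F; ring.
- move=> t t0.
  (* An equality of functions on the whole line, so that the derivative can be transferred; for
     negative arguments both sides are 0. *)
  have uE : u = step u.
    apply/funext => x; have [/u_fix_int[]//|x0] := leP 0 x.
    rewrite /step (_ : `[0, x]%classic = set0) ?Rintegral_set0 ?mulr0//; last first.
      by apply/seteqP; split => // y; rewrite /= in_itv/= => /andP[y0 yx]; have := le_lt_trans (le_trans y0 yx) x0; rewrite ltxx.
    apply/cvg_lim => //; apply: cvg_near_cst; exists 1%N => //= -[//|n] _.
    rewrite /it /= /step.
    rewrite (_ : `[0, x]%classic = set0) ?Rintegral_set0 ?mulr0//.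
    by apply/seteqP; split => // y; rewrite /= in_itv/= => /andP[y0 yx]; have := le_lt_trans (le_trans y0 yx) x0; rewrite ltxx.
  have t1 : t < t + 1 by lra.
  have tp1 : 0 < t + 1 by lra.
  have [hi _] := u_fix_int (ltW tp1).
  have cF : {for t, continuous (fun s => F s (u s))}.
    apply: (within_continuous_continuous tp1); last by rewrite in_itv/= t0.
    by apply: F_within; apply: u_within; exact: ltW.
  have [dI IE] := continuous_FTC1_closed t1 hi t0 cF.
  have dI' : is_derive t 1 (fun x => \int[mu]_(s in `[0, x]) F s (u s)) (F t (u t)).
    by apply: DeriveDef; [exact: dI|rewrite -derive1E; exact: IE].
  have dE := @is_derive1_comp R expR (- La) t _ _ (is_derive_expR (- La t)) (is_deriveN (dLa t)).
  have dM := is_deriveM dE dI'.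
  have -> : is_derive t 1 u (g (u t)) = is_derive t 1 (step u) (g (u t)) by rewrite -uE.
  apply: (is_derive_eq dM); rewrite /GRing.scale/=.
  (* The derivative of the weight expR (- La) contributes - 2 C B t u t, which cancels the linear
     term added in [F]. *)
  rewrite {2}/F mulrA -expRD addNr expR0 mul1r.
  have -> : \int[mu]_(s in `[0, t]) F s (u s) = expR (La t) * u t.
    have [_ ->] := u_fix_int (ltW t0).
    by rewrite /step mulrA -expRD subrr expR0 mul1r.
  have : expR (La t) * expR (- La t) = 1 by rewrite -expRD subrr expR0.
  move=> E.
  transitivity (g (u t) + 2 * C * B t * u t - expR (La t) * expR (- La t) * (2 * C * B t * u t)).
    by ring.
  by rewrite E mul1r addrK.
Unshelve. all: by end_near. Qed.

End ODEexistence.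

(** * Uniqueness and second-order expansion for the truncated equation *)

Section ODEproperties.
Context {R : realType}.
Variables (f : R -> R) (theta L : R).
Hypothesis theta0 : 0 <= theta.
Hypothesis L0 : 0 <= L.
Hypothesis f0 : f 0 = 0.
Hypothesis flip : forall y z : R, 0 <= y -> y <= z ->
  `|f z - f y| <= L * (1 + z) * (z - y).

Lemma ode_within (w : R -> R) (T : R) : 0 < T -> ode_solution f theta w ->
  {within `[0, T], continuous w}.
Proof.
move=> T0 [w0 wp w'0 w'].
have wc t : 0 < t -> {for t, continuous w}.
  by move=> t0; apply/differentiable_continuous/derivable1_diffP; have [] := w' _ t0.
apply/(continuous_within_itvP _ T0); split.
- by move=> t; rewrite in_itv/= => /andP[t0 _]; exact: wc.
- have h : h * (h^-1 * (w h - w 0)) + w 0 @[h --> 0^'+] --> 0 * (theta - f (w 0)) + w 0.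
    apply: cvgD; last exact: cvg_cst.
    by apply: cvgM => //; apply: cvg_at_right_filter; exact: cvg_id.
  rewrite mul0r add0r in h; apply: cvg_trans h; apply: near_eq_cvg; near=> h.
  have h0 : 0 < h by near: h; exact: nbhs_right_gt.
  by rewrite mulrA mulfV ?gt_eqF// mul1r subrK.
- exact/cvg_at_left_filter/wc.
Unshelve. all: by end_near. Qed.

Lemma ode_bounded (w : R -> R) (T : R) : 0 < T -> ode_solution f theta w ->
  exists2 W, 0 <= W & forall t, 0 <= t <= T -> 0 <= w t <= W.
Proof.
move=> T0 ws; have [c cT cmax] := EVT_max (ltW T0) (ode_within T0 ws).
have [_ wp _ _] := ws.
exists (w c); first by move: cT; rewrite in_itv/= => /andP[/wp].
by move=> t tT; rewrite cmax ?in_itv// wp//; case/andP: tT.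
Qed.

(** Gronwall in differential form: with K a Lipschitz constant of [f] on the common range of both
    solutions over [0, t], the square of w - u weighted by e^{-2Ks} has nonpositive derivative, and
    it starts at 0. *)
Lemma ode_unique (u w : R -> R) : ode_solution f theta u -> ode_solution f theta w ->
  forall t, 0 <= t -> w t = u t.
Proof.
move=> us ws t; rewrite le_eqVlt => /predU1P[<-|t0].
  by have [-> _ _ _] := us; have [-> _ _ _] := ws.
have [U U0 uU] := ode_bounded t0 us; have [W W0 wW] := ode_bounded t0 ws.
pose Z := Num.max U W; pose K := L * (1 + Z).
have lip s : 0 <= s <= t -> `|f (w s) - f (u s)| <= K * `|w s - u s|.
  move=> st; have /andP[u1 u2] := uU _ st; have /andP[w1 w2] := wW _ st.
  by apply: lip_segment => //; rewrite ?u1 ?w1/= /Z le_max ?u2 ?w2 ?orbT.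
pose e (s : R) := (w s - u s) ^+ 2 * expR (- (2 * K * s)).
have [u0 _ _ u'] := us; have [w0 _ _ w'] := ws.
have de (s : R) : 0 < s -> is_derive s 1 e
  (2 * expR (- (2 * K * s)) * (- (w s - u s) * (f (w s) - f (u s)) - K * (w s - u s) ^+ 2)).
  move=> s0; have d1 := is_deriveX 2 (is_deriveB (w' _ s0) (u' _ s0)).
  have d2 : is_derive s (1:R) (fun s => - (2 * K * s)) (- (2 * K)).
    have := is_deriveN (is_deriveZ (2 * K) (is_derive_id s (1:R))).
    by rewrite scaler1.
  have d3 := @is_derive1_comp R expR _ s _ _ (is_derive_expR _) d2.
  apply: (is_derive_eq (is_deriveM d1 d3)).
  by rewrite /GRing.scale /= !fctE /=; ring.
have cu := ode_within t0 us; have cw := ode_within t0 ws.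
have ce : {within `[0, t], continuous e}.
  have cexp : {within `[0, t], continuous (fun s : R => expR (- (2 * K * s)))}.
    apply: continuous_subspaceT => s; apply: continuous_comp; last exact: continuous_expR.
    by apply: cvgN; apply: cvgM; [exact: cvg_cst|exact: cvg_id].
  move=> s; apply: cvgM; last exact: cexp.
  by apply: cvgM; (apply: cvgB; [exact: cw|exact: cu]).
have : e t <= e 0.
  apply: (@ler0_derive1_nincr _ e 0 t) => //; last exact: ltW.
  - by move=> s; rewrite in_itv/= => /andP[/de[]].
  - move=> s; rewrite in_itv/= => /andP[s0 st].
    have [_] := de _ s0; rewrite derive1E => ->.
    rewrite mulr_ge0_le0// ?mulr_ge0 ?expR_ge0//.
    have sT : 0 <= s <= t by rewrite (ltW s0) (ltW st).
    have := lip _ sT.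
    set x := w s - u s; set y := f (w s) - f (u s) => hy.
    have : `|x * y| <= K * x ^+ 2.
      rewrite normrM -(real_normK (num_real x)) expr2 mulrA (mulrC K) -mulrA.
      by rewrite ler_wpM2l.
    by rewrite ler_norml => /andP[h _]; rewrite mulNr; lra.
rewrite /e w0 u0 subrr expr0n/= mul0r => h.
have : (w t - u t) ^+ 2 <= 0.
  by move: h; rewrite pmulr_lle0// expR_gt0.
by move=> h2; apply/eqP; rewrite -subr_eq0 -sqrf_eq0 eq_le h2 sqr_ge0.
Qed.

(** The mean value theorem is used twice: it writes the increment as h (theta - f (u c)) for some c
    in [s, s + h], and then bounds |u c - u s| by D h, so that the Lipschitz bound on [f] yields the
    constant K D. *)
Lemma ode_expansion (u : R -> R) (T : R) : 0 < T -> ode_solution f theta u ->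
  exists W C : R, [/\ 0 <= W, 0 <= C,
    forall t, 0 <= t <= T -> 0 <= u t <= W &
    forall s h, 0 <= s -> 0 <= h -> s + h <= T ->
      `|u (s + h) - u s - h * (theta - f (u s))| <= C * h ^+ 2].
Proof.
move=> T0 us; have [W W0 uW] := ode_bounded T0 us.
have cu := ode_within T0 us; have [u0 up _ u'] := us.
pose K := L * (1 + W); have K0 : 0 <= K by rewrite mulr_ge0//; lra.
pose D := theta + K * W; have D0 : 0 <= D by rewrite addr_ge0// mulr_ge0.
have mvt (a b : R) : 0 <= a -> a <= b -> b <= T ->
    exists2 c, a <= c <= b & u b - u a = (theta - f (u c)) * (b - a).
  move=> a0 ab bT.
  have [] := @MVT_segment _ u (fun c => theta - f (u c)) a b ab.
  - by move=> x; rewrite in_itv/= => /andP[ax _]; apply: u'; exact: le_lt_trans ax.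
  - apply: continuous_subspaceW cu => x; rewrite /= !in_itv/= => /andP[ax xb].
    by rewrite (le_trans a0 ax) (le_trans xb bT).
  - by move=> c; rewrite in_itv/=; exists c.
have lip s c : 0 <= s <= T -> 0 <= c <= T -> `|f (u c) - f (u s)| <= K * `|u c - u s|.
  by move=> sT cT; apply: lip_segment => //; exact: uW.
have du s : 0 <= s <= T -> `|theta - f (u s)| <= D.
  move=> sT; apply: (le_trans (ler_normB _ _)); rewrite ger0_norm// lerD2l.
  have := @lip_segment _ f L L0 flip W 0 (u s); rewrite f0 !subr0 lexx => h.
  have /andP[us0 usW] := uW _ sT.
  apply: (le_trans (h W0 (uW _ sT))); rewrite ger0_norm// ler_wpM2l//.
exists W, (K * D); split => //; first by rewrite mulr_ge0.
move=> s h s0 h0 shT.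
have sT : 0 <= s <= T by rewrite s0; lra.
have ssh : s <= s + h by lra.
have [c /andP[sc ch] ->] := mvt _ _ s0 ssh shT.
have cT : c <= T by lra.
have [c2 /andP[sc2 c2c] E2] := mvt _ _ s0 sc cT.
have c0 : 0 <= c by lra.
have -> : (theta - f (u c)) * (s + h - s) - h * (theta - f (u s))
    = - (h * (f (u c) - f (u s))) by ring.
rewrite normrN normrM ger0_norm// expr2 mulrA mulrC ler_wpM2r//.
apply: (le_trans (lip _ _ sT _)); first by rewrite c0.
rewrite -mulrA ler_wpM2l// E2 normrM ler_pM//.
  by apply: du; rewrite (le_trans s0 sc2) (le_trans c2c).
by rewrite ger0_norm ?subr_ge0//; lra.
Qed.

End ODEproperties.

Section TruncatedMechanism.
Context {R : realType}.
Variables (b c r : R) (m : {measure set (measurableTypeR R) -> \bar R}).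
Hypothesis c0 : 0 <= c.
Hypothesis hm : (\int[m]_(u in `]0%R, +oo[) (Num.min u (u ^+ 2))%:E < +oo)%E.

Lemma phi_trunc_lipschitz (y z : R) : 0 <= y -> y <= z ->
  `|phi_trunc r b c m z - phi_trunc r b c m y|
    <= lip_const m (drift_trunc r b m) c * (1 + z) * (z - y).
Proof.
apply: (mechanism_lipschitz hm) => //.
by move=> x; rewrite /= !in_itv/= => /andP[->].
Qed.

Lemma phi_trunc0 : phi_trunc r b c m 0 = 0.
Proof. exact: mechanism_0. Qed.

End TruncatedMechanism.

Lemma trunc_ode_solution {R : realType} (b c r : R)
    (m : {measure set (measurableTypeR R) -> \bar R}) :
  branching_parameters c m -> 0 < r -> exists u : R -> R -> R,
  forall theta, 0 <= theta ->
    unique_ode_solution (phi_trunc r b c m) theta (fun t => u t theta).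
Proof.
move=> [c0 _ hm] r0; set f := phi_trunc r b c m; set b' := drift_trunc r b m.
pose L := lip_const m b' c.
have L0 : 0 <= L by exact: lip_const_ge0.
have flip (y z : R) : 0 <= y -> y <= z -> `|f z - f y| <= L * (1 + z) * (z - y).
  exact: phi_trunc_lipschitz.
have f0 : f 0 = 0 by exact: phi_trunc0.
(* A single [u] has to serve all theta, hence the choice; for negative theta any function will
   do. *)
suff : forall theta : R, exists v : R -> R, 0 <= theta -> unique_ode_solution f theta v.
  by move=> /choice[u hu]; exists (fun t theta => u theta t).
move=> theta; have [th0|] := leP 0 theta; last by exists (fun=> 0).
(* [f] is controlled only on [0, +oo), so it is frozen at its value at 0 on the negative side;
   nonnegative solutions do not see the change. *)
pose g (z : R) := theta - f (Num.max z 0).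
have max0 (z : R) : 0 <= Num.max z 0 by rewrite le_max lexx orbT.
have gE (z : R) : 0 <= z -> g z = theta - f z by move=> z0; rewrite /g max_l.
have glip (y z : R) : 0 <= y -> y <= z -> `|g z - g y| <= L * (1 + z) * (z - y).
  move=> y0 yz; rewrite !gE// ?(le_trans y0)//.
  have -> : theta - f z - (theta - f y) = - (f z - f y) by ring.
  by rewrite normrN flip.
have gc : continuous g.
  move=> x; apply/cvgrPdist_le => e e0.
  pose Z := `|x| + 1; pose K := L * (1 + Z) + 1.
  have K0 : 0 < K.
    by rewrite ltr_wpDl// mulr_ge0// addr_ge0// addr_ge0.
  have d0 : 0 < Num.min 1 (e / K) by rewrite lt_min ltr01 divr_gt0.
  have idc : (y : R) @[y --> x] --> x by exact: cvg_id.
  have /cvgrPdist_le/(_ _ d0) nb := idc.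
  near=> y.
  have yx : `|x - y| <= Num.min 1 (e / K) by near: y.
  move: yx; rewrite le_min => /andP[y1 yeK].
  have yZ : y <= Z.
    rewrite /Z; have := ler_norm x; move: y1; rewrite ler_norml => /andP[h _]; lra.
  have xZ : x <= Z by rewrite /Z; have := ler_norm x; lra.
  have Z0 : 0 <= Z by rewrite addr_ge0.
  have h1 : `|f (Num.max y 0) - f (Num.max x 0)| <= L * (1 + Z) * `|Num.max y 0 - Num.max x 0|.
    by apply: lip_segment => //; rewrite max0/= ge_max ?xZ ?yZ.
  have h2 : `|Num.max y 0 - Num.max x 0| <= `|x - y|.
    rewrite distrC; have [hx|hx] := leP 0 x; have [hy|hy] := leP 0 y;
      rewrite ?subr0 ?sub0r ?subrr ?normr0 ?normrN//.
    - by rewrite (ger0_norm hx) (ger0_norm (_ : 0 <= x - y)); lra.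
    - by rewrite (ger0_norm hy) (ler0_norm (_ : x - y <= 0)); lra.
  have -> : g x - g y = f (Num.max y 0) - f (Num.max x 0) by rewrite /g; ring.
  apply: (le_trans h1); apply: (@le_trans _ _ (K * (e / K))).
    apply: ler_pM => //; first by rewrite mulr_ge0// addr_ge0.
      by rewrite /K lerDl.
    exact: le_trans h2 _.
  by rewrite mulrC divfK// gt_eqF.
(* The quadratic term and the integral in [f] are nonnegative, so only the drift can make [g]
   grow. *)
have gle (z : R) : 0 <= z -> g z <= theta + `|b'| * z.
  move=> z0; rewrite gE// lerD2l lerNl.
  rewrite /f /phi_trunc /mechanism_on -/b'.
  have h1 : 0 <= c * z ^+ 2 by rewrite mulr_ge0// sqr_ge0.
  have h2 : 0 <= \int[m]_(u in `]0, r]) (expR (- (z * u)) - 1 + z * u).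
    by apply: Rintegral_ge0 => u _; exact: exp_rem_ge0.
  have h3 : - (`|b'| * z) <= b' * z.
    by rewrite -mulNr ler_wpM2r// lerNl -normrN ler_norm.
  by rewrite -addrA (le_trans h3)// lerDl addr_ge0.
have g0 : 0 <= g 0 by rewrite gE// f0 subr0.
have [w [w0 wp wd0 wd]] := ode_exists th0 (normr_ge0 b') L0 gc g0 gle glip.
exists w => _; have ws : ode_solution f theta w.
  split => //; first by rewrite -gE; [exact: wd0|rewrite w0].
  by move=> t t0; rewrite -gE; [exact: wd|apply: wp; exact: ltW].
by split => // v vs; exact: (ode_unique L0 flip ws vs).
Unshelve. all: by end_near. Qed.

(** * Jumps and dyadic increments of cadlag paths *)

Section Paths.
Context {R : realType}.
Implicit Types (f : R -> R) (s t r e d : R).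

(** Bolzano-Weierstrass, phrased so that the index can be taken beyond any [N]: the same index often
    has to meet a second requirement, such as a small mesh. *)
Lemma segment_accumulation (p : nat -> R) t : (forall n, 0 <= p n <= t) ->
  exists2 s, 0 <= s <= t & forall d (N : nat), 0 < d ->
    exists2 n, (N <= n)%N & `|p n - s| < d.
Proof.
move=> pt; have [|g ginc gcv] := @bolzano_weierstrass R p.
  exists (`|t|); split; first exact: num_real.
  move=> x tx y _; have /andP[p0 pl] := pt y.
  by rewrite /= ger0_norm// (le_trans pl)// (le_trans (ler_norm t))// ltW.
have gn n : (n <= g n)%N.
  elim: n => [//|n IH]; apply: (leq_ltn_trans IH).
  by have := leW_mono ginc n n.+1; rewrite ltEnat /= ltnSn.
set s := lim ((p \o g) @ \oo) in gcv.
exists s.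
  by apply/andP; split; [apply: limr_ge|apply: limr_le] => //;
    near=> n; rewrite /=; case/andP: (pt (g n)).
move=> d N d0; have /cvgrPdist_lt/(_ d d0)[M _ HM] := gcv.
exists (g (maxn N M)); first by rewrite (leq_trans (leq_maxl N M)).
by rewrite distrC; apply: HM; rewrite /= leq_maxr.
Unshelve. all: by end_near. Qed.

Lemma cadlag_right f s e : cadlag f -> 0 <= s -> 0 < e ->
  exists2 d, 0 < d & forall x, s <= x < s + d -> `|f x - f s| <= e.
Proof.
move=> [fr _] s0 e0; have /cvgrPdist_le/(_ e e0)[d /= d0 fd] := fr s s0.
exists d => // x /andP[]; rewrite le_eqVlt => /predU1P[<- _|sx xd].
  by rewrite subrr normr0 ltW.
rewrite distrC; apply: fd => //=.
by rewrite distrC gtr0_norm ?subr_gt0// ltrBlDl.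
Qed.

Lemma cadlag_left f s e : cadlag f -> 0 < s -> 0 < e ->
  exists2 d, 0 < d & forall x, s - d < x < s -> `|f x - (f s - jump f s)| <= e.
Proof.
move=> [_ fl] s0 e0; have /cvgrPdist_le/(_ e e0)[d /= d0 fd] := fl s s0.
exists d => // x /andP[sx xs]; rewrite /jump subKr distrC.
apply: fd => //=.
by rewrite gtr0_norm ?subr_gt0// ltrBlDl -ltrBlDr.
Qed.

Lemma cadlag_local f s e : cadlag f -> 0 <= s -> 0 < e ->
  exists2 d, 0 < d &
    (forall x, s <= x < s + d -> `|f x - f s| <= e) /\
    (0 < s -> forall x, s - d < x < s -> `|f x - (f s - jump f s)| <= e).
Proof.
move=> cf s0 e0; have [d1 d10 h1] := cadlag_right cf s0 e0.
move: s0; rewrite le_eqVlt => /predU1P[s0|s0].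
  by exists d1 => //; split => //; rewrite -s0 ltxx.
have [d2 d20 h2] := cadlag_left cf s0 e0.
exists (Num.min d1 d2); first by rewrite lt_min d10.
split=> [x /andP[sx xd]|_ x /andP[sx xs]]; [apply: h1|apply: h2].
  by rewrite sx (lt_le_trans xd)// lerD2l ge_min lexx.
by rewrite xs andbT (le_lt_trans _ sx)// lerD2l lerN2 ge_min lexx orbT.
Qed.

(** Otherwise points where [f] exceeds every integer accumulate at some [s]; but near [s] the path
    stays below the larger of its two one-sided values plus 1. *)
Lemma cadlag_bounded f t : cadlag f ->
  exists K : nat, forall s, 0 <= s <= t -> f s <= K%:R.
Proof.
move=> cf; apply: contrapT => /forallNP H.
have {}H (K : nat) : exists s, 0 <= s <= t /\ K%:R < f s.
  have := H K; rewrite -existsNE => -[s /not_implyP[st /negP]].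
  by rewrite -ltNge => ?; exists s.
move/choice : H => [p hp].
have [|s /andP[s0 _] hs] := @segment_accumulation p t; first by move=> n; case: (hp n).
have [d d0 [h1 h2]] := cadlag_local cf s0 ltr01.
pose B := Num.max (f s) (f s - jump f s) + 1.
have [N hN] : exists N : nat, B <= N%:R.
  by exists (Num.truncn `|B|).+1; rewrite (le_trans (ler_norm B))// ltW// truncnS_gt.
have [n Nn pns] := hs d N d0.
have [pnt pn] := hp n; have /andP[pn0 _] := pnt.
have : f (p n) <= B.
  have [sp|ps] := leP s (p n).
    have /ler_normlP[_] : `|f (p n) - f s| <= 1.
      apply: h1; rewrite sp/= -ltrBlDl; exact: le_lt_trans (ler_norm _) pns.
    rewrite lerBlDr addrC => /le_trans; apply.
    by rewrite /B lerD2r le_max lexx.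
  have sp0 : 0 < s by exact: le_lt_trans ps.
  have /ler_normlP[_] : `|f (p n) - (f s - jump f s)| <= 1.
    apply: (h2 sp0); rewrite ps andbT ltrBlDr -ltrBlDl.
    by apply: le_lt_trans pns; rewrite distrC ler_norm.
  rewrite lerBlDr addrC => /le_trans; apply.
  by rewrite /B lerD2r le_max lexx orbT.
move=> /le_trans/(_ hN) h; have := lt_le_trans pn h.
by rewrite ltr_nat ltnNge Nn.
Qed.

Definition dyadic t n (k : nat) : R := t * (k%:R / (2 ^ n)%:R).

Lemma dyadic0 t n : dyadic t n 0 = 0.
Proof. by rewrite /dyadic mul0r mulr0. Qed.

Lemma dyadicE t n : dyadic t n (2 ^ n) = t.
Proof. by rewrite /dyadic divff ?mulr1// pnatr_eq0 expn_eq0. Qed.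

Lemma dyadicS t n k : dyadic t n k.+1 = dyadic t n k + t / (2 ^ n)%:R.
Proof. by rewrite /dyadic -natr1; ring. Qed.

Lemma dyadic_le t n k l : 0 <= t -> (k <= l)%N -> dyadic t n k <= dyadic t n l.
Proof. by move=> t0 kl; rewrite ler_wpM2l// ler_pM2r ?invr_gt0 ?ltr0n ?expn_gt0// ler_nat. Qed.

Lemma dyadic_ge0 t n k : 0 <= t -> 0 <= dyadic t n k.
Proof. by move=> t0; rewrite -(dyadic0 t n) dyadic_le. Qed.

Lemma dyadic_mesh t d : 0 <= t -> 0 < d -> exists N : nat, forall n, (N <= n)%N ->
  t / (2 ^ n)%:R < d.
Proof.
move=> t0 d0; exists (Num.truncn (t / d)).+1 => n Nn.
rewrite ltr_pdivrMr ?ltr0n ?expn_gt0// mulrC -ltr_pdivrMr//.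
apply: (lt_le_trans (Num.Theory.truncnS_gt _)); rewrite ler_nat (leq_trans Nn)//.
by rewrite ltnW// ltn_expl.
Qed.

(** Offending intervals of shrinking length would accumulate at some [s]. If both ends lie on the
    same side of [s], the increment is at most 2 e = r' - r, which is at most r' as r >= 0; if they
    straddle [s], it is at most the jump plus 2 e. *)
Lemma increments_small f t r r' : cadlag f -> 0 <= t -> 0 <= r -> r < r' ->
  (forall s, 0 < s <= t -> jump f s <= r) ->
  exists N : nat, forall n k, (N <= n)%N -> (k < 2 ^ n)%N ->
    f (dyadic t n k.+1) - f (dyadic t n k) <= r'.
Proof.
move=> cf t0 r0 rr' fr; apply: contrapT => /forallNP H.
have {}H (N : nat) : exists pq : R * R, [/\ 0 <= pq.1, pq.1 <= pq.2, pq.2 <= t,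
    pq.2 - pq.1 <= t / (2 ^ N)%:R & r' < f pq.2 - f pq.1].
  have := H N; rewrite -existsNE => -[n]; rewrite -existsNE => -[k].
  move=> /not_implyP[Nn /not_implyP[kn /negP]]; rewrite -ltNge => fk.
  exists (dyadic t n k, dyadic t n k.+1); split => //=.
  - exact: dyadic_ge0.
  - exact: dyadic_le.
  - by rewrite -{2}(dyadicE t n) dyadic_le.
  - rewrite dyadicS addrAC subrr add0r ler_wpM2l// lef_pV2 ?posrE ?ltr0n ?expn_gt0//.
    by rewrite ler_nat leq_exp2l.
move/choice : H => [pq hpq].
have [|s /andP[s0 st] hs] := @segment_accumulation (fun n => (pq n).1) t.
  by move=> n; have [h1 h2 h3 _ _] := hpq n; rewrite h1 (le_trans h2).
pose e := (r' - r) / 2; have e0 : 0 < e by rewrite /e; lra.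
have [d d0 [h1 h2]] := cadlag_local cf s0 e0.
(* Left end within d / 2 of [s] and mesh below d / 2 put both ends within d of [s]. *)
have d20 : 0 < d / 2 by rewrite divr_gt0.
have [N hN] := dyadic_mesh t0 d20.
have [n Nn] := hs _ N d20.
have [] := hpq n; have := hN _ Nn.
move: (pq n).1 (pq n).2 (t / (2 ^ n)%:R) => p q mesh md p0 pq' qt qpm fpq.
rewrite ltr_norml => /andP[ps1 ps2].
have e2 : 2 * e = r' - r by rewrite /e; lra.
have [sp|ps] := leP s p.
  have A : `|f p - f s| <= e by apply: h1; lra.
  have B : `|f q - f s| <= e by apply: h1; lra.
  by move: A B; rewrite !ler_norml; lra.
have s0' : 0 < s by lra.
have [sq|qs] := leP s q.
  have A : `|f p - (f s - jump f s)| <= e by apply: (h2 s0'); lra.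
  have B : `|f q - f s| <= e by apply: h1; lra.
  have C : jump f s <= r by apply: fr; lra.
  by move: A B; rewrite !ler_norml; lra.
have A : `|f p - (f s - jump f s)| <= e by apply: (h2 s0'); lra.
have B : `|f q - (f s - jump f s)| <= e by apply: (h2 s0'); lra.
by move: A B; rewrite !ler_norml; lra.
Qed.

(** The first partition point at or after [s] and its predecessor straddle [s], so the increment is
    within 2 e of the jump, where e is a third of the excess over r'. *)
Lemma increments_large f t s r' : cadlag f -> 0 < s <= t -> r' < jump f s ->
  exists N : nat, forall n, (N <= n)%N ->
    exists2 k, (k < 2 ^ n)%N & r' < f (dyadic t n k.+1) - f (dyadic t n k).
Proof.
move=> cf /andP[s0 st] hr; have t0 : 0 < t by lra.
pose e := (jump f s - r') / 3; have e0 : 0 < e by rewrite /e; lra.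
have [d d0 [h1 h2]] := cadlag_local cf (ltW s0) e0.
have [N hN] := dyadic_mesh (ltW t0) d0; exists N => n /hN md.
have ex : exists k, s <= dyadic t n k by exists (2 ^ n)%N; rewrite dyadicE.
case: (ex_minnP ex) => -[|k]; first by rewrite dyadic0 leNgt s0.
move=> sk kmin; exists k; first by apply: kmin; rewrite dyadicE.
have ks : dyadic t n k < s.
  by rewrite ltNge; apply/negP => /kmin; rewrite ltnn.
have := dyadicS t n k; move: sk ks md.
move: (dyadic t n k) (dyadic t n k.+1) (t / (2 ^ n)%:R) => p q mesh sq ps md qE.
have A : `|f p - (f s - jump f s)| <= e by apply: (h2 s0); lra.
have B : `|f q - f s| <= e by apply: h1; lra.
have e3 : 3 * e = jump f s - r' by rewrite /e; lra.
by move: A B; rewrite !ler_norml; lra.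
Qed.

Lemma jump_le f s a d e : cadlag f -> 0 < s -> 0 < d ->
  (forall x, s - d < x <= s -> `|f x - a| <= e) -> `|jump f s| <= 2 * e.
Proof.
move=> cf s0 d0 fd; apply/ler_addgt0Pr => eta eta0.
have [d2 d20 h2] := cadlag_left cf s0 eta0.
pose dd := Num.min d d2 / 2; have dm : 0 < Num.min d d2 by rewrite lt_min d0.
have dd1 : Num.min d d2 <= d by rewrite ge_min lexx.
have dd2 : Num.min d d2 <= d2 by rewrite ge_min lexx orbT.
have A : `|f (s - dd) - (f s - jump f s)| <= eta by apply: h2; rewrite /dd; lra.
have B : `|f (s - dd) - a| <= e by apply: fd; rewrite /dd; lra.
have C : `|f s - a| <= e by apply: fd; lra.
by move: A B C; rewrite !ler_norml; lra.
Qed.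

(* Needed because the maximum of the jumps is attained: when no jump is positive,
   it is 0, which has to be the jump at some time.  By Baire, a cadlag path has a
   continuity point in (0, t]. *)
Lemma exists_jump0 f t : cadlag f -> 0 < t -> exists2 s, 0 < s <= t & jump f s = 0.
Proof.
(* Extended by a constant to negative arguments, where the cadlag property says nothing. *)
move=> cf t0; pose g (x : R) := f (Num.max x 0).
have gE x : 0 <= x -> g x = f x by move=> x0; rewrite /g max_l.
(* A common point of all [U n] is a continuity point. Openness is immediate; density is where right
   continuity enters, as the path is nearly constant just to the right of any point. *)
pose U (n : nat) := [set s : R | exists2 d, 0 < d &
  forall x y, `|x - s| < d -> `|y - s| < d -> `|g x - g y| <= n.+1%:R^-1].
have : dense (\bigcap_i U i).
  apply: Baire => n; split.
    rewrite openE => s [d d0 hd]; exists (d / 2); first by rewrite /= divr_gt0.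
    move=> y /=; rewrite /ball_/= => sy; exists (d / 2); first by rewrite divr_gt0.
    have h z : `|z - y| < d / 2 -> `|z - s| < d.
      move=> zy; have -> : z - s = (z - y) - (s - y) by ring.
      by apply: (le_lt_trans (ler_normB _ _)); lra.
    by move=> x z /h hx /h hz; exact: hd.
  move=> O [s Os] oO; have [d /= d0 hd] := open_nbhs_nbhs (conj oO Os).
  have [s0|s0] := leP 0 s; last first.
    exists s; split => //; exists (- s); first by lra.
    have h x : `|x - s| < - s -> g x = f 0.
      by rewrite ltr_norml => hx; rewrite /g max_r//; lra.
    by move=> x y /h -> /h ->; rewrite subrr normr0 invr_ge0.
  have e0 : 0 < n.+1%:R^-1 / 2 :> R by rewrite divr_gt0.
  have [d2 d20 h2] := cadlag_right cf s0 e0.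
  pose dd := Num.min d d2 / 2; have dm : 0 < Num.min d d2 by rewrite lt_min d0.
  have dd1 : Num.min d d2 <= d by rewrite ge_min lexx.
  have dd2 : Num.min d d2 <= d2 by rewrite ge_min lexx orbT.
  exists (s + dd); split.
    by apply: hd; rewrite /ball_/= opprD addrA subrr sub0r normrN gtr0_norm /dd; lra.
  exists dd; first by rewrite /dd; lra.
  have h x : `|x - (s + dd)| < dd -> `|g x - f s| <= n.+1%:R^-1 / 2.
    by rewrite ltr_norml => hx; rewrite gE; [apply: h2; rewrite /dd in hx *; lra|lra].
  by move=> x y /h hx /h; move: hx; rewrite !ler_norml; move: (_^-1) => q; lra.
move=> /(_ `]0, t[%classic).
case; first by exists (t / 2); rewrite /= in_itv/=; lra.
  exact: itv_open.
move=> s [/=]; rewrite in_itv/= => /andP[s0 st] Us.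
exists s; first by rewrite s0 ltW.
apply/eqP; rewrite -normr_le0; apply/ler_addgt0Pr => e e0; rewrite add0r.
have [n ne] : exists n : nat, n.+1%:R^-1 <= e / 2.
  exists (Num.truncn (2 / e)); rewrite invf_ple ?posrE ?divr_gt0//.
  by rewrite invf_div ltW// truncnS_gt.
have [d d0 hd] := Us n I.
have -> : e = 2 * (e / 2) by lra.
apply: (@jump_le _ _ (f s) (Num.min d s)) => //; first by rewrite lt_min d0.
have m1 : Num.min d s <= d by rewrite ge_min lexx.
have m2 : Num.min d s <= s by rewrite ge_min lexx orbT.
move=> x hx; have x0 : 0 <= x by lra.
rewrite -(gE x x0) -(gE s (ltW s0)); apply: le_trans ne.
apply: hd; last by rewrite subrr normr0.
by rewrite ler0_norm; lra.
Qed.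

(** Large jumps are isolated: times with jump above half of a positive supremum accumulate at some
    [s], while all other times near [s] have jumps at most a quarter of it, so the approximating
    times equal [s] infinitely often. A supremum equal to 0 is attained at a time without jump. *)
Lemma exists_max_jump f t r : cadlag f -> 0 < t ->
  (forall s, 0 < s <= t -> jump f s <= r) ->
  exists y, is_max [set jump f s | s in `]0, t]] y.
Proof.
move=> cf t0 fr; set S := [set jump f s | s in `]0, t]].
have [z zt z0] := exists_jump0 cf t0.
have S0 : S 0 by exists z; rewrite //= in_itv.
have Sub : ubound S r by move=> _ [s /= + <-]; rewrite in_itv; exact: fr.
have hS : has_sup S by split; [exists 0|exists r].
have supS : ubound S (sup S) by move=> y Sy; exact: ub_le_sup hS.2 _ Sy.
have := supS _ S0; rewrite le_eqVlt => /predU1P[S00|sup0].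
  by exists 0; split => //; rewrite S00.
exists (sup S); split => //.
(* The margin is at most half of the supremum for every [N], and tends to 0. *)
have /choice[p hp] : forall N : nat, exists s, 0 < s <= t /\
    sup S - sup S / (2 * N.+1%:R) < jump f s.
  move=> N; have eN : 0 < sup S / (2 * N.+1%:R) by rewrite divr_gt0// mulr_gt0.
  have [_ [s /= + <-] h] := sup_adherent eN hS.
  by rewrite in_itv/= => ?; exists s.
have [|s /andP[s0 st] hs] := @segment_accumulation p t.
  by move=> n; have [/andP[h1 h2] _] := hp n; rewrite (ltW h1).
pose e := sup S / 8; have e0 : 0 < e by rewrite /e; lra.
have [d d0 [h1 h2]] := cadlag_local cf s0 e0.
have key N : exists2 n, (N <= n)%N & p n = s.
  have [n Nn pns] := hs d N d0; exists n => //.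
  have [/andP[pn0 pnt] pnj] := hp n.
  have half : sup S / (2 * n.+1%:R) <= sup S / 2.
    by rewrite ler_wpM2l ?(ltW sup0)// lef_pV2 ?posrE ?mulr_gt0// ler_peMr// ler1n.
  have big : sup S / 2 < jump f (p n).
    by move: pnj half; move: (sup S / (2 * _)) => q; lra.
  apply: contrapT => /eqP; rewrite neq_lt => /orP[ps|sp].
    have sp0 : 0 < s by lra.
    have : `|jump f (p n)| <= 2 * e.
      move: pns; rewrite ltr_norml => /andP[q1 q2].
      apply: (@jump_le _ _ (f s - jump f s) (p n - (s - d))) => //; first by lra.
      by move=> x hx; apply: (h2 sp0); lra.
    by rewrite ler_norml /e; lra.
  have : `|jump f (p n)| <= 2 * e.
    move: pns; rewrite ltr_norml => /andP[q1 q2].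
    apply: (@jump_le _ _ (f s) (p n - s)) => //; first by lra.
    by move=> x hx; apply: h1; lra.
  by rewrite ler_norml /e; lra.
have [n0 _ pn0] := key 0%N.
exists s; first by rewrite /= in_itv/= -pn0; case: (hp n0).
apply/eqP; rewrite eq_le; apply/andP; split.
  by apply: supS; exists s => //; rewrite /= in_itv/= -pn0; case: (hp n0).
apply/ler_addgt0Pr => eta eta0.
have [N hN] : exists N : nat, sup S / (2 * N.+1%:R) <= eta.
  exists (Num.truncn (sup S / eta)).
  rewrite ler_pdivrMr ?mulr_gt0// mulrC -ler_pdivrMr//.
  have := Num.Theory.truncnS_gt (sup S / eta).
  have : 0 <= sup S / eta by rewrite divr_ge0// ltW.
  by move: (sup S / eta) (_%:R) => q1 q2; lra.
have [n Nn pn] := key N; have [_] := hp n; rewrite pn => hj.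
have : sup S / (2 * n.+1%:R) <= sup S / (2 * N.+1%:R).
  by rewrite ler_wpM2l ?(ltW sup0)// lef_pV2 ?posrE ?mulr_gt0// ler_wpM2l// ler_nat.
by move: hj hN; move: (sup S / (2 * n.+1%:R)) (sup S / (2 * N.+1%:R)) => q1 q2; lra.
Qed.

End Paths.

(** * Polynomial approximation of Lipschitz functions *)

Section Bernstein.
Context {R : realType}.

(* The expectation of [h] under the binomial law, as a polynomial in the success
   probability; the recursion conditions on the first trial. *)
Fixpoint bernstein (n : nat) (h : nat -> R) : {poly R} :=
  if n is n'.+1 then (1 - 'X) * bernstein n' h + 'X * bernstein n' (h \o S)
  else (h 0)%:P.

Lemma bernsteinS n h x : (bernstein n.+1 h).[x] =
  (1 - x) * (bernstein n h).[x] + x * (bernstein n (h \o S)).[x].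
Proof. by rewrite /= !hornerE. Qed.

Lemma bernstein_le n h1 h2 x : 0 <= x <= 1 -> (forall k, h1 k <= h2 k) ->
  (bernstein n h1).[x] <= (bernstein n h2).[x].
Proof.
move=> /andP[x0 x1]; elim: n h1 h2 => [|n IH] h1 h2 h; first by rewrite /= !hornerC.
rewrite !bernsteinS lerD// ler_wpM2l// ?subr_ge0//; first exact: IH.
by apply: IH => k; exact: h.
Qed.

(** Mean n x and variance n x (1 - x) of the binomial law. The centre [a] is left free because
    conditioning on a success shifts it by 1. *)
Lemma bernstein_sqr n (al be ga a x : R) :
  (bernstein n (fun k => al + be * k%:R + ga * (k%:R - a) ^+ 2)).[x] =
  al + be * (n%:R * x) + ga * (n%:R * x * (1 - x) + (n%:R * x - a) ^+ 2).
Proof.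
elim: n al a => [|n IH] al a; first by rewrite /= hornerC; ring.
rewrite bernsteinS IH.
have -> : (fun k => al + be * k%:R + ga * (k%:R - a) ^+ 2) \o S =
    fun k : nat => (al + be) + be * k%:R + ga * (k%:R - (a - 1)) ^+ 2.
  by apply/funext => k /=; rewrite -natr1; ring.
by rewrite IH -natr1; ring.
Qed.

(** Bernstein's argument: if d is the distance from the frequency k / n to x, then L b d <= e + A
    d^2 with A = L^2 b^2 / e, and the binomial mean of d^2 is at most 1 / n; so n > A / e gives a
    total of at most 2 e = del. *)
Lemma lipschitz_poly_approx (F : R -> R) (b L del : R) : 0 < b -> 0 <= L -> 0 < del ->
  (forall y z, 0 <= y -> 0 <= z -> `|F y - F z| <= L * `|y - z|) ->
  exists p : {poly R}, forall s, 0 <= s <= b -> `|F s - p.[s]| <= del.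
Proof.
move=> b0 L0 del0 hF; pose e := del / 2; have e0 : 0 < e by rewrite divr_gt0.
pose A := L ^+ 2 * b ^+ 2 / e.
have A0 : 0 <= A by rewrite divr_ge0 ?mulr_ge0 ?sqr_ge0// ltW.
have [n n0 nA] : exists2 n : nat, 0 < n%:R :> R & A / e < n%:R.
  by exists (Num.truncn (A / e)).+1; [rewrite ltr0n|exact: Num.Theory.truncnS_gt].
pose h (k : nat) := F (k%:R / n%:R * b).
exists (bernstein n h \Po (b^-1 *: 'X)) => s /andP[s0 sb].
rewrite horner_comp !hornerE; set x := b^-1 * s.
have x01 : 0 <= x <= 1.
  by rewrite /x mulr_ge0 ?invr_ge0 ?(ltW b0)//= ler_pdivrMl// mulr1.
have sE : s = x * b by rewrite /x mulrAC mulVf ?mul1r// gt_eqF.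
have hk k : `|F s - h k| <= e + A * (k%:R / n%:R - x) ^+ 2.
  have kn : 0 <= k%:R / n%:R :> R by rewrite divr_ge0.
  have h1 := hF _ _ s0 (mulr_ge0 kn (ltW b0)).
  apply: (le_trans h1); rewrite sE -mulrBl normrM (gtr0_norm b0) distrC.
  set d := `|_ - x|; rewrite -(real_normK (num_real (_ - x))) -/d.
  have -> : A * d ^+ 2 = (L * (d * b)) ^+ 2 / e by rewrite /A; ring.
  have y0 : 0 <= L * (d * b) by rewrite mulr_ge0// mulr_ge0 ?normr_ge0// ltW.
  move: y0; move: (L * (d * b)) => y y0.
  rewrite -(ler_pM2r e0) mulrDl divfK ?gt_eqF//; nra.
have Aen : A * (n%:R * x * (1 - x) + (n%:R * x - n%:R * x) ^+ 2) / n%:R ^+ 2 <= e.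
  rewrite subrr expr0n/= addr0.
  have -> : A * (n%:R * x * (1 - x)) / n%:R ^+ 2 = A * (x * (1 - x)) / n%:R.
    by field; rewrite gt_eqF.
  rewrite ler_pdivrMr//; move: nA; rewrite ltr_pdivrMr// mulrC => /ltW; apply: le_trans.
  rewrite -[leRHS]mulr1 ler_wpM2l//; case/andP: x01 => ? ?; nra.
(* The signs 1 and -1 give the two sides of the absolute value. *)
have up (sg : R) : `|sg| <= 1 -> (bernstein n (fun k => sg * (h k - F s))).[x] <= del.
  move=> hsg; have -> : del = e + e by rewrite /e; lra.
  apply: (@le_trans _ _ (bernstein n (fun k => e + 0 * k%:R
     + A / n%:R ^+ 2 * (k%:R - n%:R * x) ^+ 2)).[x]).
    apply: bernstein_le => // k; apply: (le_trans (ler_norm _)); rewrite normrM.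
    apply: (@le_trans _ _ `|F s - h k|).
      by rewrite distrC -[leRHS]mul1r ler_wpM2r.
    apply: (le_trans (hk k)); rewrite mul0r addr0 lerD2l le_eqVlt; apply/orP; left.
    by apply/eqP; field; rewrite gt_eqF.
  rewrite bernstein_sqr mul0r addr0 lerD2l; apply: le_trans Aen.
  by rewrite le_eqVlt; apply/orP; left; apply/eqP; ring.
have lin (sg c : R) m (g : nat -> R) :
    (bernstein m (fun k => sg * (g k - c))).[x] = sg * ((bernstein m g).[x] - c).
  elim: m g => [|m IH] g; first by rewrite /= !hornerC.
  by rewrite !bernsteinS IH (IH (g \o S)); ring.
have := up 1; rewrite normr1 lexx lin => /(_ isT) u1.
have := up (-1); rewrite normrN1 lexx lin => /(_ isT) u2.
by rewrite distrC ler_norml; move: u1 u2; move: (_.[x]) (F s) => q1 q2; lra.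
Qed.

End Bernstein.

(** * The Markov property for Laplace transforms *)

Section FunctionalExtension.
Context {d} {T : measurableType d} {R : realType}.

(** Rounds a nonnegative [y] down to a multiple of [del], capped at [n] steps. The form as a sum of
    indicators of level sets lets additivity alone determine a functional on it. *)
Fixpoint staircase (del : R) (n : nat) (y : R) : R :=
  if n is n'.+1 then staircase del n' y + del * (n'.+1%:R * del <= y)%R%:R else 0.

Lemma staircase_bounds del n y : 0 < del -> 0 <= y ->
  (n%:R * del <= y -> staircase del n y = n%:R * del) /\
  (y < n%:R * del -> y - del <= staircase del n y <= y).
Proof.
move=> del0 y0; elim: n => [|n [IH1 IH2]]; first by rewrite /= mul0r; split; lra.
rewrite /=; have nS : n.+1%:R * del = n%:R * del + del by rewrite -natr1; ring.
rewrite nS; split=> [ny|yn].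
  by rewrite ny mulr1 IH1//; lra.
rewrite (lt_geF yn) mulr0 addr0; have [ny|yn2] := leP (n%:R * del) y; last exact: IH2.
by rewrite IH1//; lra.
Qed.

Lemma staircase_indic (f : T -> R) del n : staircase del n.+1 \o f =
  (staircase del n \o f) \+ (fun x => del * \1_(f @^-1` `[n.+1%:R * del, +oo[) x).
Proof.
apply/funext => x /=; rewrite indicE; congr (_ + del * (nat_of_bool _)%:R).
by apply/idP/idP => [h|]; rewrite ?inE/= in_itv/= andbT.
Qed.

Definition bounded_ge0 (f : T -> R) :=
  measurable_fun setT f /\ exists K : R, forall x, 0 <= f x <= K.

Lemma bounded_ge0_indic (A : set T) c : measurable A -> 0 <= c ->
  bounded_ge0 (fun x => c * \1_A x).
Proof.
move=> mA c0; split; first by apply: measurable_funM => //; exact: measurable_indic.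
by exists c => x; rewrite indicE; case: (_ \in _); rewrite ?mulr1 ?mulr0 ?lexx ?c0.
Qed.

Lemma bounded_ge0_staircase (f : T -> R) del n : 0 < del -> measurable_fun setT f ->
  bounded_ge0 (staircase del n \o f).
Proof.
move=> d0 mf; elim: n => [|n [m1 [K hK]]].
  split; first exact: measurable_cst.
  by exists 0 => x /=; rewrite lexx.
have mA : measurable (f @^-1` `[n.+1%:R * del, +oo[).
  by rewrite -[X in measurable X]setTI; apply: mf => //; exact: measurable_itv.
have [m2 [K2 hK2]] := bounded_ge0_indic mA (ltW d0).
rewrite staircase_indic; split; first exact: measurable_funD.
by exists (K + K2) => x /=; have := hK x; have := hK2 x; rewrite /=; lra.
Qed.

(** The functionals agree on staircases, by additivity; [f] lies between a staircase and the same
    staircase plus [del], and [I] of the constant [del] is arbitrarily small. Exchanging [I] and [J]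
    gives equality. The abstract form serves twice: for functions of the future and for weights on
    the past. *)
Lemma functional_ext (I J : (T -> R) -> \bar R) :
  (forall f g, bounded_ge0 f -> bounded_ge0 g -> I (f \+ g)%R = I f + I g)%E ->
  (forall f g, bounded_ge0 f -> bounded_ge0 g -> J (f \+ g)%R = J f + J g)%E ->
  (forall A c, measurable A -> 0 <= c ->
    I (fun x => c * \1_A x) = J (fun x => c * \1_A x)) ->
  (forall f g, bounded_ge0 f -> bounded_ge0 g -> (forall x, f x <= g x)%R ->
    I f <= I g)%E ->
  (forall f g, bounded_ge0 f -> bounded_ge0 g -> (forall x, f x <= g x)%R ->
    J f <= J g)%E ->
  (forall c, (0 <= c)%R -> I (cst c) = c%:E * I (cst 1%R))%E ->
  I (cst 1) \is a fin_num -> (0 <= I (cst 1%R))%E ->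
  forall f, bounded_ge0 f -> (I f <= J f)%E.
Proof.
move=> ID JD IJ Ile Jle Icst I1 I10 f bf; have [mf [K0 fK0]] := bf.
(* Strictly above the range of [f], so that the cap of the staircase is never reached. *)
pose K := K0 + 1; have K_gt0 : 0 < K.
  by rewrite /K; have := fK0 point; lra.
have step n del : 0 < del -> I (staircase del n \o f) = J (staircase del n \o f).
  move=> d0; elim: n => [|n IH].
    have -> : staircase del 0 \o f = (fun x => 0 * \1_set0 x).
      by apply/funext => x; rewrite mul0r.
    exact: IJ.
  have mA : measurable (f @^-1` `[n.+1%:R * del, +oo[).
    by rewrite -[X in measurable X]setTI; apply: mf => //; exact: measurable_itv.
  have bi : bounded_ge0 (fun x => del * \1_(f @^-1` `[n.+1%:R * del, +oo[) x).
    by apply: bounded_ge0_indic => //; exact: ltW.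
  have bn := bounded_ge0_staircase n d0 mf.
  by rewrite staircase_indic ID// JD// IH IJ// ltW.
apply/lee_addgt0Pr => e e0.
pose M := fine (I (cst 1)) + 1.
have M0 : 0 < M by rewrite ltr_wpDl// fine_ge0.
(* Enough steps for the error, [del] times the mass I (cst 1), to be at most [e]. *)
pose n := (Num.truncn (K * M / e)).+1; pose del := K / n%:R.
have del0 : 0 < del by rewrite divr_gt0.
have delM : del * M <= e.
  rewrite /del mulrAC ler_pdivrMr// -ler_pdivrMl// mulrC.
  by rewrite ltW// /n Num.Theory.truncnS_gt.
have nd : n%:R * del = K by rewrite /del mulrC divfK// pnatr_eq0.
have bs := bounded_ge0_staircase n del0 mf.
have bc : bounded_ge0 (cst del : T -> R).
  by split; [exact: measurable_cst|exists del => x; rewrite lexx ltW].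
have fb x : staircase del n (f x) <= f x <= staircase del n (f x) + del.
  have /andP[f0 fk] := fK0 x.
  have [_] := staircase_bounds n del0 f0; rewrite nd => H.
  have fK : f x < K by rewrite /K; lra.
  by have := H fK; lra.
have bsum : bounded_ge0 ((staircase del n \o f) \+ cst del).
  have [m1 [K1 hK1]] := bs; split; first exact: measurable_funD.
  by exists (K1 + del) => x /=; have := hK1 x; rewrite /=; lra.
apply: (@le_trans _ _ (I ((staircase del n \o f) \+ cst del))).
  by apply: Ile => // x /=; case/andP: (fb x).
rewrite ID// step//; apply: leeD.
  by apply: Jle => // x /=; case/andP: (fb x).
rewrite Icst; last exact: ltW.
rewrite -(fineK I1) -EFinM lee_fin; apply: le_trans delM.
by rewrite ler_wpM2l ?(ltW del0)// /M lerDl.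
Qed.

End FunctionalExtension.

Section MarkovProperty.
Context {R : realType} {d : measure_display} {T : measurableType d}.
Context (P : probability T R).
Local Notation RR := (measurableTypeR R).
Variable X : R -> {RV P >-> R}.
Hypothesis X0 : forall (t : R) w, 0 <= t -> 0 <= X t w.

Definition past_events (s : R) : set (set T) :=
  [set A | exists q (B : set RR),
     [/\ 0 <= q, q <= s, measurable B & A = X q @^-1` B]].

(** The sample space carrying the sigma-algebra of the past, so that adaptedness of a weight is
    plain measurability on this type. *)
Definition past (s : R) := g_sigma_algebraType (past_events s).

Lemma past_measurable s (A : set T) : natural_filtration X s A -> measurable A.
Proof.
apply: smallest_sub; first exact: sigma_algebra_measurable.
move=> _ [q [B [_ _ mB ->]]]; rewrite -[X in measurable X]setTI.
exact: measurable_funPT.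
Qed.

Lemma past_measurable_fun s (a : T -> R) :
  measurable_fun [set: past s] a -> measurable_fun [set: T] a.
Proof.
move=> ma _ B mB; rewrite setTI; apply: (@past_measurable s).
by rewrite -[X in natural_filtration _ _ X]setTI; exact: ma.
Qed.

Lemma past_RV q s : 0 <= q -> q <= s -> measurable_fun [set: past s] (X q : T -> R).
Proof.
move=> q0 qs _ B mB; rewrite setTI; apply: sub_sigma_algebra.
by exists q, B; split.
Qed.

Lemma past_le s t (a : T -> R) : s <= t ->
  measurable_fun [set: past s] a -> measurable_fun [set: past t] a.
Proof.
move=> st ma _ B mB.
have sub : past_events s `<=` past_events t.
  by move=> A [q [C [q0 qs mC AE]]]; exists q, C; split => //; exact: le_trans st.
by apply: (sub_sigma_algebra2 sub); exact: ma.
Qed.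

Variables (f : R -> R) (Q : R -> R.-pker RR ~> RR) (v : R -> R -> R).
Hypothesis Qv : forall t x l : R, 0 <= t -> 0 <= x -> 0 <= l ->
  (\int[Q t x]_(y in `[0%R, +oo[) (expR (- (l * y)))%:E)%E = (expR (- (x * v t l)))%:E.
Hypothesis QX : forall (s t : R) (A : set T) (B : set RR), 0 <= s -> 0 <= t ->
  natural_filtration X s A -> measurable B ->
  P (A `&` X (s + t) @^-1` B) = (\int[P]_(w in A) Q t (X s w) B)%E.

Let measurable_kernel_int (s t : R) (A : set T) (phi : RR -> R) :
  bounded_ge0 phi ->
  measurable_fun A (fun w => \int[Q t (X s w)]_y (phi y)%:E)%E.
Proof.
move=> [mphi [K hK]]; apply: measurable_funTS.
apply: (measurableT_comp (f := fun x => (\int[Q t x]_y (phi y)%:E)%E)) => //.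
apply: measurable_fun_integral_kernel.
- by move=> U mU; exact: measurable_kernel.
- by move=> z; rewrite lee_fin; case/andP: (hK z).
- exact/measurable_EFinP.
- exact: (measurable_funPT (X s)).
Qed.

(** The Markov property is given for indicators of [B]; both sides are additive and monotone in the
    function of the future, so [functional_ext] extends it. *)
Let markov_bounded (s t : R) (A : set T) (phi : RR -> R) : 0 <= s -> 0 <= t ->
  natural_filtration X s A -> bounded_ge0 phi ->
  (\int[P]_(w in A) (phi (X (s + t)%R w))%:E)%E =
  (\int[P]_(w in A) \int[Q t (X s w)]_y (phi y)%:E)%E.
Proof.
move=> s0 t0 FA bphi; have mA := past_measurable FA.
pose I (g : RR -> R) := (\int[P]_(w in A) (g (X (s + t)%R w))%:E)%E.
pose J (g : RR -> R) := (\int[P]_(w in A) \int[Q t (X s w)]_y (g y)%:E)%E.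
have mI g : bounded_ge0 g -> measurable_fun A (fun w => (g (X (s + t) w))%:E).
  move=> [mg _]; apply/measurable_EFinP; apply: measurable_funTS.
  exact: measurableT_comp.
have g0 (g : RR -> R) y : bounded_ge0 g -> (0 <= (g y)%:E)%E.
  by move=> [_ [K hK]]; rewrite lee_fin; case/andP: (hK y).
have mg (g : RR -> R) : bounded_ge0 g -> measurable_fun setT (EFin \o g).
  by move=> [? _]; exact/measurable_EFinP.
have Jg0 (g : RR -> R) w : bounded_ge0 g -> (0 <= \int[Q t (X s w)]_y (g y)%:E)%E.
  by move=> bg; apply: integral_ge0 => y _; exact: g0.
have ID g h : bounded_ge0 g -> bounded_ge0 h -> (I (g \+ h)%R = I g + I h)%E.
  move=> bg bh; rewrite /I -ge0_integralD//; try exact: mI; by move=> w _; exact: g0.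
have JD g h : bounded_ge0 g -> bounded_ge0 h -> (J (g \+ h)%R = J g + J h)%E.
  move=> bg bh; rewrite /J -ge0_integralD//.
  - apply: eq_integral => w _ /=.
    rewrite -ge0_integralD//; try exact: mg; by move=> y _; exact: g0.
  - by move=> w _; exact: Jg0.
  - exact: measurable_kernel_int.
  - by move=> w _; exact: Jg0.
  - exact: measurable_kernel_int.
have IJ B c : measurable B -> 0 <= c ->
    I (fun x => c * \1_B x) = J (fun x => c * \1_B x).
  move=> mB c0; rewrite /I /J.
  have E1 (w : T) : (\int[Q t (X s w)]_y (c * \1_B y)%:E)%E = (c%:E * Q t (X s w) B)%E.
    under eq_integral do rewrite EFinM.
    rewrite ge0_integralZl//; last by apply/measurable_EFinP; exact: measurable_indic.
    by rewrite integral_indic// setIT.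
  under [RHS]eq_integral do rewrite E1.
  have mXB : measurable (X (s + t) @^-1` B).
    by rewrite -[Y in measurable Y]setTI; exact: measurable_funPT.
  rewrite ge0_integralZl//; first last.
  - apply: measurable_funTS.
    apply: (measurableT_comp (f := fun x => Q t x B)); first exact: measurable_kernel.
    exact: (measurable_funPT (X s)).
  rewrite -QX//; under eq_integral do rewrite EFinM.
  rewrite ge0_integralZl//; first last.
    apply/measurable_EFinP; apply: measurable_funTS.
    by apply: measurableT_comp => //; exact: measurable_indic.
  congr (_ * _)%E; rewrite setIC -integral_indic//.
have Ile g h : bounded_ge0 g -> bounded_ge0 h -> (forall x, g x <= h x) -> (I g <= I h)%E.
  move=> bg bh gh; apply: ge0_le_integral => //; try exact: mI.
  - by move=> w _; exact: g0.
  - by move=> w _; rewrite lee_fin.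
have Jle g h : bounded_ge0 g -> bounded_ge0 h -> (forall x, g x <= h x) -> (J g <= J h)%E.
  move=> bg bh gh; apply: ge0_le_integral => //; try exact: measurable_kernel_int.
  - by move=> w _; exact: Jg0.
  - move=> w _; apply: ge0_le_integral => //; try exact: mg.
    + by move=> y _; exact: g0.
    + by move=> y _; rewrite lee_fin.
have IcstE c : I (cst c) = (c%:E * P A)%E.
  by rewrite -(integral_cst P mA); apply: eq_integral.
have Icst c : 0 <= c -> I (cst c) = (c%:E * I (cst 1%R))%E.
  by move=> c0; rewrite !IcstE mul1e.
have IJ1 c : 0 <= c -> I (cst c) = J (cst c).
  move=> c0; have -> : cst c = (fun x : RR => c * \1_setT x).
    by apply/funext => y; rewrite indicT mulr1.
  exact: IJ.
have I1 : I (cst 1) \is a fin_num.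
  by rewrite IcstE mul1e fin_num_measure.
have I10 : (0 <= I (cst 1%R))%E by rewrite IcstE mul1e.
apply/eqP; rewrite eq_le; apply/andP; split.
  exact: (functional_ext ID JD IJ Ile Jle Icst).
apply: (functional_ext JD ID _ Jle Ile) => //.
- by move=> B c mB c0; rewrite IJ.
- by move=> c c0; rewrite -!IJ1//; exact: Icst.
- by rewrite -IJ1.
- by rewrite -IJ1.
Qed.

Lemma measurable_expRNM_comp d' (T' : measurableType d') (Y : T' -> R) (l : R) :
  measurable_fun setT Y -> measurable_fun setT (fun w => expR (- (l * Y w))).
Proof.
move=> mY; apply: measurableT_comp => //; apply: measurableT_comp => //.
exact: measurable_funM.
Qed.

Let markov_event (s t l : R) (A : set T) : 0 <= s -> 0 <= t -> 0 <= l ->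
  natural_filtration X s A ->
  (\int[P]_(w in A) (expR (- (l * X (s + t)%R w)))%:E)%E =
  (\int[P]_(w in A) (expR (- (v t l * X s w)))%:E)%E.
Proof.
move=> s0 t0 l0 FA.
(* The kernels live on all of R, where e^{-ly} may be unbounded. The indicator makes [phi] bounded
   and matches the domain of the Laplace formula; as X >= 0 it changes nothing on the left side. *)
pose phi (y : RR) : R := \1_(`[0, +oo[%classic : set RR) y * expR (- (l * y)).
have bphi : bounded_ge0 phi.
  split.
    apply: measurable_funM; first exact: measurable_indic.
    exact: measurable_expRNM_comp.
  exists 1 => y; rewrite /phi indicE; case: (boolP (y \in _)) => [|_]; last first.
    by rewrite mul0r lexx ler01.
  rewrite inE/= in_itv/= andbT => y0.
  by rewrite mul1r expR_ge0/= expR_le1 oppr_le0 mulr_ge0.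
transitivity (\int[P]_(w in A) (phi (X (s + t)%R w))%:E)%E.
  apply: eq_integral => w _; rewrite /phi indicE mem_set ?mul1r//=.
  by rewrite in_itv/= andbT; apply: X0; exact: addr_ge0.
rewrite markov_bounded//; apply: eq_integral => w _.
rewrite mulrC -Qv//; last exact: X0.
rewrite [RHS]integral_mkcond; apply: eq_integral => y _.
by rewrite patchE /phi indicE; case: ifP; rewrite ?mul1r ?mul0r.
Qed.

(** A second extension, this time in the weight: [markov_event] covers indicators of past events. *)
Lemma markov_laplace (s t l : R) (a : T -> R) (K : R) :
  0 <= s -> 0 <= t -> 0 <= l -> 0 <= v t l ->
  measurable_fun [set: past s] a -> (forall w, 0 <= a w <= K) ->
  \int[P]_w (a w * expR (- (l * X (s + t) w))) =
  \int[P]_w (a w * expR (- (v t l * X s w))).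
Proof.
move=> s0 t0 l0 vt0 ma aK; congr fine.
pose I (Y : T -> R) (g : past s -> R) : \bar R := (\int[P]_w (g w * expR (- Y w))%:E)%E.
have mpast (g : past s -> R) : bounded_ge0 g -> measurable_fun [set: T] g.
  by move=> [mg _]; exact: past_measurable_fun mg.
have mI (Y : T -> R) (g : past s -> R) : measurable_fun [set: T] Y -> bounded_ge0 g ->
    measurable_fun [set: T] (fun w => (g w * expR (- Y w))%:E).
  move=> mY bg; apply/measurable_EFinP; apply: measurable_funM; first exact: mpast.
  by apply: measurableT_comp => //; exact: measurableT_comp.
have g0 (Y : T -> R) (g : past s -> R) w : bounded_ge0 g -> (0 <= (g w * expR (- Y w))%:E)%E.
  by move=> [_ [M hM]]; rewrite lee_fin mulr_ge0 ?expR_ge0//; case/andP: (hM w).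
have ID (Y : T -> R) (g h : past s -> R) : measurable_fun [set: T] Y -> bounded_ge0 g -> bounded_ge0 h ->
    (I Y (g \+ h)%R = I Y g + I Y h)%E.
  move=> mY bg bh; rewrite /I -ge0_integralD//; try exact: mI; first last.
  - by move=> w _; exact: g0.
  - by move=> w _; exact: g0.
  by apply: eq_integral => w _ /=; rewrite mulrDl.
have Ile (Y : T -> R) (g h : past s -> R) : measurable_fun [set: T] Y -> bounded_ge0 g -> bounded_ge0 h ->
    (forall w, g w <= h w) -> (I Y g <= I Y h)%E.
  move=> mY bg bh gh; apply: ge0_le_integral => //; try exact: mI.
  - by move=> w _; exact: g0.
  - by move=> w _; rewrite lee_fin ler_wpM2r ?expR_ge0.
have bcst (c : R) : 0 <= c -> bounded_ge0 (cst c : past s -> R).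
  by move=> c0; split; [exact: measurable_cst|exists c => w; rewrite c0 lexx].
have Icst (Y : T -> R) (c : R) : measurable_fun [set: T] Y -> 0 <= c ->
    I Y (cst c) = (c%:E * I Y (cst 1%R))%E.
  move=> mY c0; rewrite /I -ge0_integralZl//.
  - by apply: eq_integral => w _ /=; rewrite mul1r.
  - by apply: (mI Y (cst 1)) => //; exact: bcst.
  - by move=> w _; apply: (g0 Y (cst 1)); exact: bcst.
have I10 (Y : T -> R) : measurable_fun [set: T] Y -> (0 <= I Y (cst 1%R))%E.
  by move=> mY; apply: integral_ge0 => w _; apply: (g0 Y (cst 1)); exact: bcst.
have I1 (Y : T -> R) : measurable_fun [set: T] Y -> (forall w, 0 <= Y w) -> I Y (cst 1) \is a fin_num.
  move=> mY Y0; rewrite ge0_fin_numE ?I10//.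
  apply: (@le_lt_trans _ _ (\int[P]_w (cst 1%E) w)%E); last first.
    by rewrite integral_cst// mul1e -ge0_fin_numE// fin_num_measure.
  apply: ge0_le_integral => //.
  - by move=> w _; apply: (g0 Y (cst 1)); exact: bcst.
  - by apply: (mI Y (cst 1)) => //; exact: bcst.
  - by move=> w _; rewrite /= mul1r lee_fin expR_le1 oppr_le0.
pose Y1 w := l * X (s + t) w; pose Y2 w := v t l * X s w.
have mY1 : measurable_fun setT Y1 by exact: measurable_funM.
have mY2 : measurable_fun setT Y2 by exact: measurable_funM.
have Y10 w : 0 <= Y1 w by apply: mulr_ge0 => //; apply: X0; exact: addr_ge0.
have Y20 w : 0 <= Y2 w by apply: mulr_ge0 => //; exact: X0.
have IA (Y : T -> R) (A : set (past s)) (c : R) : measurable_fun [set: T] Y -> measurable A -> 0 <= c ->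
    I Y (fun w => c * \1_A w) = (c%:E * \int[P]_(w in A) (expR (- Y w))%:E)%E.
  move=> mY mA c0; have mA' : measurable (A : set T) by exact: (@past_measurable s).
  rewrite -ge0_integralZl//; first last.
  - apply/measurable_EFinP; apply: measurable_funTS.
    by apply: measurableT_comp => //; exact: measurableT_comp.
  rewrite [RHS]integral_mkcond; apply: eq_integral => w _.
  by rewrite patchE indicE; case: ifP => _; rewrite ?mulr1 ?mulr0 ?mul0r.
have IJ (A : set (past s)) (c : R) : measurable A -> 0 <= c ->
    I Y1 (fun w => c * \1_A w) = I Y2 (fun w => c * \1_A w).
  move=> mA c0; rewrite (IA Y1 A c mY1 mA c0) (IA Y2 A c mY2 mA c0); congr (_ * _)%E.
  exact: (markov_event s0 t0 l0 mA).
have ba : bounded_ge0 (a : past s -> R) by split => //; exists K.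
apply/eqP; rewrite eq_le; apply/andP; split.
  exact: (functional_ext (fun g h => ID Y1 g h mY1) (fun g h => ID Y2 g h mY2) IJ
    (fun g h => Ile Y1 g h mY1) (fun g h => Ile Y2 g h mY2)
    (fun c => Icst Y1 c mY1) (I1 Y1 mY1 Y10) (I10 Y1 mY1) ba).
exact: (functional_ext (fun g h => ID Y2 g h mY2) (fun g h => ID Y1 g h mY1)
  (fun A c mA c0 => esym (IJ A c mA c0))
  (fun g h => Ile Y2 g h mY2) (fun g h => Ile Y1 g h mY1)
  (fun c => Icst Y2 c mY2) (I1 Y2 mY2 Y20) (I10 Y2 mY2) ba).
Qed.

End MarkovProperty.

(** * The one-step estimate *)

Section Cutoff.
Context {R : realType}.
Variables al be : R.
Hypothesis beal : be < al.
Hypothesis al1 : al < 1.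

(** A decreasing ramp, because in the variable s = e^{-z} the large increments are the small [s]. *)
Definition cutoff (s : R) : R := Num.max 0 (Num.min 1 ((al - s) / (al - be))).

(* It is this quotient, not [cutoff], that is approximated by polynomials: the error
   is then multiplied by [(1 - e^{-Z})^2], whose expectation over a step of length
   [h] is O(h). *)
Definition cutoff_quot (s : R) : R := cutoff s * (1 - Num.min s al)^-1 ^+ 2.

Let ab0 : 0 < al - be. Proof. by rewrite subr_gt0. Qed.

Lemma cutoff01 s : 0 <= cutoff s <= 1.
Proof. by rewrite /cutoff le_max lexx/= ge_max ler01/= ge_min lexx. Qed.

Lemma cutoff_ge s : al <= s -> cutoff s = 0.
Proof.
move=> als; rewrite /cutoff max_l// ge_min; apply/orP; right.
by rewrite ler_pdivrMr// mul0r subr_le0.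
Qed.

Lemma cutoff_le s : s <= be -> cutoff s = 1.
Proof.
move=> sbe; rewrite /cutoff min_l ?max_r//.
by rewrite ler_pdivlMr// mul1r lerD2l lerN2.
Qed.

(** Capping [s] at [al] keeps the denominator away from 0 and only matters where [cutoff]
    vanishes. *)
Lemma cutoff_quotE s : cutoff_quot s * (1 - s) ^+ 2 = cutoff s.
Proof.
rewrite /cutoff_quot; have [sal|als] := leP s al.
  by rewrite -mulrA -exprMn mulVf ?expr1n ?mulr1// gt_eqF// subr_gt0 (le_lt_trans sal).
by rewrite cutoff_ge ?ltW// !mul0r.
Qed.

Lemma clamp_lipschitz (x y : R) :
  `|Num.max 0 (Num.min 1 x) - Num.max 0 (Num.min 1 y)| <= `|x - y|.
Proof.
wlog xy : x y / x <= y.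
  move=> H; have [/H//|/ltW/H] := leP x y; by rewrite distrC (distrC x).
rewrite (ler0_norm (_ : x - y <= 0)) ?subr_le0// opprB ler_norml.
by case: (leP 1 x) => ?; case: (leP 1 y) => ?; case: (leP 0 (1 : R)) => ?;
  case: (leP 0 x) => ?; case: (leP 0 y) => ?; lra.
Qed.

Lemma cutoff_lipschitz x y : `|cutoff x - cutoff y| <= (al - be)^-1 * `|x - y|.
Proof.
apply: (le_trans (clamp_lipschitz _ _)).
have -> : (al - x) / (al - be) - (al - y) / (al - be) = (al - be)^-1 * (y - x) by ring.
by rewrite normrM gtr0_norm ?invr_gt0// (distrC x).
Qed.

Lemma min_lipschitz (x y : R) : `|Num.min x al - Num.min y al| <= `|x - y|.
Proof.
wlog xy : x y / x <= y.
  move=> H; have [/H//|/ltW/H] := leP x y; by rewrite distrC (distrC x).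
rewrite (ler0_norm (_ : x - y <= 0)) ?subr_le0// opprB ler_norml.
by case: (leP x al) => ?; case: (leP y al) => ?; lra.
Qed.

(** A product of bounded Lipschitz factors: the ramp has slope at most A, and the inverse is bounded
    by B with Lipschitz constant B^2. *)
Lemma cutoff_quot_lipschitz : exists2 L, 0 <= L &
  forall x y, 0 <= x -> 0 <= y -> `|cutoff_quot x - cutoff_quot y| <= L * `|x - y|.
Proof.
pose B := (1 - al)^-1; pose A := (al - be)^-1.
have B0 : 0 < B by rewrite invr_gt0 subr_gt0.
have A0 : 0 < A by rewrite invr_gt0.
pose g (s : R) := (1 - Num.min s al)^-1.
have den s : 1 - al <= 1 - Num.min s al by rewrite lerD2l lerN2 ge_min lexx orbT.
have al10 : 0 < 1 - al by rewrite subr_gt0.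
have den0 s : 0 < 1 - Num.min s al by exact: lt_le_trans (den s).
have g0 s : 0 <= g s <= B.
  by rewrite /g invr_ge0 (ltW (den0 s))/= lef_pV2 ?posrE.
have gl x y : `|g x - g y| <= B ^+ 2 * `|x - y|.
  have -> : g x - g y = g x * g y * (Num.min x al - Num.min y al).
    by rewrite /g; field; rewrite !gt_eqF.
  have /andP[gx0 gxB] := g0 x; have /andP[gy0 gyB] := g0 y.
  rewrite normrM ger0_norm ?mulr_ge0// ler_pM ?mulr_ge0//; last exact: min_lipschitz.
  by rewrite expr2 ler_pM.
exists (A * B ^+ 2 + 2 * B ^+ 3); first by rewrite addr_ge0 ?mulr_ge0 ?exprn_ge0// ltW.
move=> x y _ _; rewrite /cutoff_quot -!/(g _).
have -> : cutoff x * g x ^+ 2 - cutoff y * g y ^+ 2 =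
  (cutoff x - cutoff y) * g x ^+ 2 + cutoff y * (g x + g y) * (g x - g y) by ring.
have /andP[gx0 gxB] := g0 x; have /andP[gy0 gyB] := g0 y.
have /andP[c0 c1] := cutoff01 y.
apply: (le_trans (ler_normD _ _)); rewrite [leRHS]mulrDl; apply: lerD.
  rewrite normrM (ger0_norm (sqr_ge0 _)) mulrAC ler_pM ?sqr_ge0//.
    exact: cutoff_lipschitz.
  by rewrite lerXn2r ?nnegrE// (le_trans gx0).
rewrite normrM ger0_norm; last by rewrite mulr_ge0// addr_ge0.
have -> : 2 * B ^+ 3 * `|x - y| = 2 * B * (B ^+ 2 * `|x - y|) by ring.
apply: ler_pM => //; first by rewrite mulr_ge0// addr_ge0.
by rewrite -[leRHS]mul1r ler_pM// ?addr_ge0//; lra.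
Qed.

End Cutoff.

Section ExpApprox.
Context {R : realType}.

(** From e^x >= 1 + x follows e^{-x} <= 1 / (1 + x) <= 1 - x + 2 x^2 when |x| <= 1/2. *)
Lemma expRN_second_order (x : R) : `|x| <= 2^-1 -> `|expR (- x) - 1 + x| <= 2 * x ^+ 2.
Proof.
rewrite ler_norml => /andP[xl xu]; have h := expRN_ge1B x.
rewrite ger0_norm; last by lra.
have h2 : expR (- x) * (1 + x) <= 1.
  have := expR_ge1Dx x; have := expR_ge0 (- x); have : expR (- x) * expR x = 1.
    by rewrite -expRD addNr expR0.
  by move: (expR (- x)) (expR x) => E F; nra.
have x1 : 0 < 1 + x by lra.
move: h2; rewrite -ler_pdivlMr// => h2.
suff : 1 / (1 + x) <= 1 - x + 2 * x ^+ 2 by lra.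
rewrite ler_pdivrMr//; nra.
Qed.

(** [D] is an increment of the exponent with first-order part h g; it will be v_h(l) - l, with g = -
    phi l, and w' - w along the solution of the equation. The last hypothesis keeps |D y| below
    1/2. *)
Lemma expRN_approx (D g C G K y h : R) : `|D - h * g| <= C * h ^+ 2 -> `|g| <= G ->
  0 <= C -> 0 <= y <= K -> 0 <= h <= 1 -> 2 * (G + C) * K * h <= 1 ->
  `|expR (- (D * y)) - 1 + h * y * g| <= (C * K + 2 * ((G + C) * K) ^+ 2) * h ^+ 2.
Proof.
move=> hD hg C0 /andP[y0 yK] /andP[h0 h1] hK.
have G0 : 0 <= G by exact: le_trans hg.
have K0 : 0 <= K by lra.
have D1 : `|D| <= h * (G + C).
  have -> : D = (D - h * g) + h * g by ring.
  apply: (le_trans (ler_normD _ _)); rewrite normrM (ger0_norm h0).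
  have : C * h ^+ 2 <= C * h by rewrite ler_wpM2l// expr2 ler_piMl.
  have : h * `|g| <= h * G by rewrite ler_wpM2l.
  by lra.
have Dy : `|D * y| <= h * ((G + C) * K).
  by rewrite normrM (ger0_norm y0) mulrA ler_pM.
have H : `|expR (- (D * y)) - 1 + D * y| <= 2 * (D * y) ^+ 2.
  apply: expRN_second_order; apply: (le_trans Dy); lra.
have -> : expR (- (D * y)) - 1 + h * y * g =
   (expR (- (D * y)) - 1 + D * y) - (D - h * g) * y by ring.
apply: (le_trans (ler_normB _ _)); rewrite addrC [leRHS]mulrDl; apply: lerD.
  rewrite normrM (ger0_norm y0) mulrAC; apply: ler_pM => //.
apply: (le_trans H); rewrite -mulrA ler_wpM2l// -exprMn (mulrC _ h).
by rewrite -(real_normK (num_real (D * y))) lerXn2r ?nnegrE// (le_trans _ Dy).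
Qed.

End ExpApprox.

Section PolynomialSecondDifference.
Context {R : realType}.
Local Notation RR := (measurableTypeR R).
Variable m : {measure set RR -> \bar R}.
Hypothesis hm : (\int[m]_(u in `]0%R, +oo[) (Num.min u (u ^+ 2))%:E < +oo)%E.

Definition second_diff (g : R -> R) (l : R) : R := g l - 2 * g (l + 1) + g (l + 2).

(** The second difference kills the constant 1, and 4 = 1 + 2 + 1 is the sum of its absolute
    weights. *)
Lemma second_diff_approx (g k : R -> R) (y h l E : R) :
  `|g l - 1 - h * (y * k l)| <= E ->
  `|g (l + 1) - 1 - h * (y * k (l + 1))| <= E ->
  `|g (l + 2) - 1 - h * (y * k (l + 2))| <= E ->
  `|second_diff g l - h * (y * second_diff k l)| <= 4 * E.
Proof.
move=> g0 g1 g2.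
have -> : second_diff g l - h * (y * second_diff k l) =
  (g l - 1 - h * (y * k l)) - 2 * (g (l + 1) - 1 - h * (y * k (l + 1)))
  + (g (l + 2) - 1 - h * (y * k (l + 2))) by rewrite /second_diff; ring.
move: g0 g1 g2; rewrite !ler_norml.
by move: (g l - 1 - _) (g (l + 1) - 1 - _) (g (l + 2) - 1 - _) => z0 z1 z2; lra.
Qed.

Let pos : set RR := `]0%R, +oo[.
Let mpos : measurable pos. Proof. exact: measurable_itv. Qed.

Lemma Rintegral_sum d (T : measurableType d) (mu : {measure set T -> \bar R})
    (D : set T) n (f : nat -> T -> R) : measurable D ->
  (forall i, mu.-integrable D (EFin \o f i)) ->
  mu.-integrable D (EFin \o (fun x => \sum_(i < n) f i x)) /\
  \int[mu]_(x in D) (\sum_(i < n) f i x) = \sum_(i < n) \int[mu]_(x in D) f i x.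
Proof.
move=> mD fi; elim: n => [|n [IH1 IH2]].
  split; last first.
    rewrite big_ord0 (@eq_Rintegral _ _ _ _ _ (cst 0)).
      by rewrite /Rintegral integral0.
    by move=> x _; rewrite big_ord0.
  apply: (eq_integrable mD (cst 0%E)); last exact: integrable0.
  by move=> x _ /=; rewrite big_ord0.
split.
  apply: (eq_integrable mD (fun x => (\sum_(i < n) f i x)%:E + (f n x)%:E)%E).
    by move=> x _ /=; rewrite big_ord_recr.
  exact: integrableD IH1 (fi n).
rewrite big_ord_recr /= -IH2 -(RintegralD mD IH1 (fi n)).
by apply: eq_Rintegral => x _; rewrite big_ord_recr.
Qed.

Lemma integrable_sqr_diff (w : R) (f : RR -> R) (C : R) : 0 <= w -> 0 <= C ->
  measurable_fun pos f -> (forall u, 0 < u -> `|f u| <= C) ->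
  m.-integrable pos (EFin \o (fun u => expR (- (w * u)) * (1 - expR (- u)) ^+ 2 * f u)) /\
  `|\int[m]_(u in pos) (expR (- (w * u)) * (1 - expR (- u)) ^+ 2 * f u)|
    <= C * min_sqr_mass m.
Proof.
move=> w0 C0 mf fC.
have mk : measurable_fun pos (fun u : RR => expR (- (w * u)) * (1 - expR (- u)) ^+ 2 * f u).
  apply: measurable_funM => //; apply: measurable_funM; first exact: measurable_expRNM.
  apply: measurable_funX; apply: measurable_funB => //.
  by under eq_fun do rewrite -[X in - X]mul1r; exact: measurable_expRNM.
have b u : pos u -> `|expR (- (w * u)) * (1 - expR (- u)) ^+ 2 * f u|
    <= C * Num.min u (u ^+ 2).
  rewrite /pos/= in_itv/= andbT => u0; rewrite normrM mulrC ler_pM// ?fC//.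
  exact: sqr_diff_le w0 (ltW u0).
by split; [apply: (integrable_dominated hm mpos (C := C))|
  apply: (Rintegral_dominated hm mpos (C := C))].
Qed.

Lemma measurable_horner_expRN (p : {poly R}) (D : set RR) :
  measurable_fun D (fun u : RR => p.[expR (- u)]).
Proof.
apply: measurable_funTS; apply: measurableT_comp.
  exact: (continuous_measurable_fun (@continuous_horner R p)).
by under eq_fun do rewrite -[X in - X]mul1r; exact: measurable_expRNM.
Qed.

(** A factor e^{-ju} shifts [w] to w + j, so this is [phi_second_diff] summed against the
    coefficients; the Gaussian terms add up to 2 c times the sum of the coefficients, which is
    p.[1]. *)
Lemma poly_second_diff (p : {poly R}) b c w : 0 <= w ->
  \sum_(j < size p) p`_j * second_diff (phi b c m) (w + j%:R) =
  2 * c * p.[1] +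
  \int[m]_(u in pos) (expR (- (w * u)) * (1 - expR (- u)) ^+ 2 * p.[expR (- u)]).
Proof.
move=> w0; pose f (j : nat) (u : RR) :=
  p`_j * (expR (- ((w + j%:R) * u)) * (1 - expR (- u)) ^+ 2).
have i1 (j : nat) : m.-integrable pos
    (EFin \o (fun u => expR (- ((w + j%:R) * u)) * (1 - expR (- u)) ^+ 2)).
  have wj : 0 <= w + j%:R by rewrite addr_ge0.
  have [] := @integrable_sqr_diff (w + j%:R) (cst 1) 1 wj ler01.
  - exact: measurable_cst.
  - by move=> u _; rewrite normr1.
  by move=> h _; apply: eq_integrable h => // u _ /=; rewrite mulr1.
have fi j : m.-integrable pos (EFin \o f j).
  by have := integrableZl mpos p`_j (i1 j); apply: eq_integrable.
have [_ E] := Rintegral_sum (size p) mpos fi.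
have -> : \int[m]_(u in pos) (expR (- (w * u)) * (1 - expR (- u)) ^+ 2 * p.[expR (- u)])
   = \int[m]_(u in pos) (\sum_(j < size p) f j u).
  apply: eq_Rintegral => u _; rewrite horner_coef big_distrr/=.
  apply: eq_bigr => j _; rewrite /f mulrDl opprD expRD -expRM_natl.
  by rewrite mulrN; ring.
rewrite E horner_coef big_distrr -big_split/=; apply: eq_bigr => j _.
rewrite /f RintegralZl// /second_diff expr1n mulr1.
by rewrite (phi_second_diff hm) ?addr_ge0//; ring.
Qed.

(** The case of the polynomial 1, which governs the mean of (1 - e^{-Z})^2 over one step. *)
Lemma second_diff_phi_bound b c w : 0 <= c -> 0 <= w ->
  0 <= second_diff (phi b c m) w <= 2 * c + min_sqr_mass m.
Proof.
move=> c0 w0; rewrite /second_diff (phi_second_diff hm)//.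
have [] := @integrable_sqr_diff w (cst 1) 1 w0 ler01.
- exact: measurable_cst.
- by move=> u _; rewrite normr1.
move=> _; rewrite mul1r => h; rewrite lerD2l.
have -> : \int[m]_(u in pos) (expR (- (w * u)) * (1 - expR (- u)) ^+ 2) =
  \int[m]_(u in pos) (expR (- (w * u)) * (1 - expR (- u)) ^+ 2 * cst 1 u).
  by apply: eq_Rintegral => u _; rewrite mulr1.
rewrite (le_trans (ler_norm _) h) andbT addr_ge0 ?mulr_ge0//.
by apply: Rintegral_ge0 => u _; rewrite mulr1 mulr_ge0 ?expR_ge0 ?sqr_ge0.
Qed.

End PolynomialSecondDifference.

(** * The rate of large jumps in polynomial form *)

Section JumpRate.
Context {R : realType}.
Local Notation RR := (measurableTypeR R).
Variable m : {measure set RR -> \bar R}.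
Hypothesis hm : (\int[m]_(u in `]0%R, +oo[) (Num.min u (u ^+ 2))%:E < +oo)%E.
Variables r eta : R.
Hypothesis r0 : 0 < r.
Hypothesis eta0 : 0 < eta.

Let al := expR (- (r + eta)).
Let be := expR (- (r + 2 * eta)).
Let pos : set RR := `]0%R, +oo[.
Let tail : set RR := `]r, +oo[.
Let gap : set RR := `]r, r + 2 * eta].
Let mpos : measurable pos. Proof. exact: measurable_itv. Qed.
Let mtail : measurable tail. Proof. exact: measurable_itv. Qed.
Let mgap : measurable gap. Proof. exact: measurable_itv. Qed.

Definition jump_cutoff (z : R) : R :=
  cutoff (expR (- (r + eta))) (expR (- (r + 2 * eta))) (expR (- z)).

Lemma jump_cutoff_params : be < al /\ al < 1.
Proof.
rewrite /be /al; split; first by rewrite ltr_expR; have := eta0; lra.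
by rewrite expR_lt1; have := eta0; have := r0; lra.
Qed.

Lemma jump_cutoff01 z : 0 <= jump_cutoff z <= 1.
Proof. exact: cutoff01. Qed.

Lemma jump_cutoff_small z : z <= r + eta -> jump_cutoff z = 0.
Proof.
move=> zr; have [h2 h3] := jump_cutoff_params.
by apply: cutoff_ge => //; rewrite ler_expR lerN2.
Qed.

Lemma jump_cutoff_large z : r + 2 * eta <= z -> jump_cutoff z = 1.
Proof.
move=> zr; have [h2 h3] := jump_cutoff_params.
by apply: cutoff_le => //; rewrite ler_expR lerN2.
Qed.

Lemma measurable_jump_cutoff d (T : measurableType d) (D : set T) (Z : T -> R) :
  measurable_fun D Z -> measurable_fun D (fun w => jump_cutoff (Z w)).
Proof.
move=> mZ; rewrite /jump_cutoff /cutoff.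
apply: measurable_maxr; first exact: measurable_cst.
apply: measurable_minr; first exact: measurable_cst.
apply: measurable_funM; last exact: measurable_cst.
apply: measurable_funB; first exact: measurable_cst.
by apply: measurableT_comp => //; exact: measurableT_comp.
Qed.

(** Jump sizes above [r] on which the cutoff may differ from 1; their mass is the price of a
    continuous cutoff. *)
Definition jump_gap : R := fine (m gap).

Let gap_tail : gap `<=` tail.
Proof. by move=> u; rewrite /gap /tail/= !in_itv/= => /andP[->]. Qed.

Lemma jump_gap_ge0 : 0 <= jump_gap.
Proof. exact: fine_ge0. Qed.

Lemma integrable_cutoff w : 0 <= w ->
  m.-integrable tail (EFin \o (fun u => jump_cutoff u * expR (- (w * u)))) /\
  m.-integrable pos (EFin \o (fun u => jump_cutoff u * expR (- (w * u)))).
Proof.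
move=> w0.
have mk (D : set RR) : measurable_fun D (fun u : RR => jump_cutoff u * expR (- (w * u))).
  by apply: measurable_funM; [exact: measurable_jump_cutoff|exact: measurable_expRNM].
have b (u : R) : 0 <= u -> `|jump_cutoff u * expR (- (w * u))| <= 1.
  move=> u0; have /andP[k0 k1] := jump_cutoff01 u.
  rewrite ger0_norm ?mulr_ge0 ?expR_ge0// mulr_ile1 ?expR_ge0//.
  by rewrite expRN_le1// mulr_ge0.
have it : m.-integrable tail (EFin \o (fun u => jump_cutoff u * expR (- (w * u)))).
  apply: (integrable_tail_bounded hm r0 (mk _) (C := 1)) => u.
  by rewrite /= in_itv/= andbT => ru; apply: b; have := r0; lra.
split => //.
apply: (integrable_dominated hm mpos (C := (Num.min r (r ^+ 2))^-1)) => // u.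
rewrite /pos/= in_itv/= andbT => u0; have [ur|ru] := leP u r.
  rewrite jump_cutoff_small ?mul0r ?normr0; last by have := eta0; lra.
  by rewrite mulr_ge0 ?invr_ge0 ?min_sqr_ge0 ?ltW.
apply: (le_trans (b _ (ltW u0))); apply: tail_min_sqr_ge => //.
by rewrite /= in_itv/= ru.
Qed.

Lemma tail_cutoff w : 0 <= w ->
  `|\int[m]_(u in tail) expR (- (w * u)) -
    \int[m]_(u in pos) (jump_cutoff u * expR (- (w * u)))| <= jump_gap.
Proof.
move=> w0; have [it ip] := integrable_cutoff w0.
have ie := integrable_tail_expR hm r0 w0.
have -> : \int[m]_(u in pos) (jump_cutoff u * expR (- (w * u))) =
    \int[m]_(u in tail) (jump_cutoff u * expR (- (w * u))).
  have E : pos = `]0, r]%classic `|` tail.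
    by rewrite /tail -itv_bndbnd_setU// bnd_simp; exact: ltW.
  have m0 : measurable (`]0, r]%classic : set RR) by exact: measurable_itv.
  have dj : [disjoint (`]0, r]%classic : set RR) & tail].
    rewrite disj_set2E; apply/eqP; rewrite -subset0 => u [].
    by rewrite /tail/= !in_itv/= andbT => /andP[_ ur] /(le_lt_trans ur); rewrite ltxx.
  rewrite E in ip *; rewrite (Rintegral_setU m0 mtail ip dj).
  rewrite (@eq_Rintegral _ _ _ _ _ (cst 0)).
    by rewrite /Rintegral integral0 add0r.
  move=> u; rewrite inE/= in_itv/= => /andP[_ ur].
  by rewrite jump_cutoff_small ?mul0r//; have := eta0; lra.
have H := RintegralB mtail ie it; rewrite -H.
have mgl : (m gap < +oo)%E.
  apply: le_lt_trans (tail_mass_lty hm r0).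
  by apply: le_measure => //; rewrite inE.
have ig : m.-integrable tail (EFin \o \1_gap).
  apply: (integrable_tail_bounded hm r0 (C := 1)); first exact: measurable_indic.
  by move=> u _; rewrite indicE; case: (_ \in _); rewrite ?normr1 ?normr0.
have idif : m.-integrable tail (EFin \o (fun u => expR (- (w * u)) - jump_cutoff u * expR (- (w * u)))).
  by have := integrableB mtail ie it; apply: eq_integrable.
apply: (le_trans (le_normr_Rintegral mtail idif)).
have -> : jump_gap = \int[m]_(u in tail) \1_gap u.
  by rewrite /Rintegral/= integral_indic// setIidl.
apply: le_Rintegral => //; first exact: (integrable_norm idif).
move=> u; rewrite /tail/= in_itv/= andbT => ru.
have /andP[k0 k1] := jump_cutoff01 u.
have u0 : 0 <= u by have := r0; lra.
have e1 : expR (- (w * u)) <= 1 by rewrite expRN_le1// mulr_ge0.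
have e0 := expR_ge0 (- (w * u)).
have -> : expR (- (w * u)) - jump_cutoff u * expR (- (w * u)) =
  (1 - jump_cutoff u) * expR (- (w * u)) by ring.
rewrite indicE; have [ug|gu] := leP u (r + 2 * eta).
  rewrite mem_set ?ger0_norm/= ?mulr_ge0 ?subr_ge0//; last by rewrite /gap/= in_itv/= ru.
  by rewrite mulr_ile1 ?subr_ge0// gerBl.
by rewrite jump_cutoff_large ?(ltW gu)// subrr mul0r normr0.
Qed.

Variables (p : {poly R}) (del : R).
Hypothesis del0 : 0 <= del.
Hypothesis pdel : forall s : R, 0 <= s <= 1 -> `|cutoff_quot al be s - p.[s]| <= del.

(** Three errors: [jump_gap] from the ramp; [del] times the mass of min(u, u^2) from replacing the
    quotient by [p]; and the Gaussian term 2 c p.[1], small because the quotient vanishes at 1, that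
    is, the cutoff ignores small increments. *)
Lemma poly_jump_rate b c w : 0 <= c -> 0 <= w ->
  `|\int[m]_(u in tail) expR (- (w * u)) -
    \sum_(j < size p) p`_j * second_diff (phi b c m) (w + j%:R)|
  <= del * (2 * c + min_sqr_mass m) + jump_gap.
Proof.
move=> c0 w0; rewrite (poly_second_diff hm)//.
have [h2 h3] := jump_cutoff_params.
have p1 : `|p.[1]| <= del.
  have := @pdel 1; rewrite ler01 lexx => /(_ isT).
  by rewrite /cutoff_quot cutoff_ge ?(ltW h3)// mul0r sub0r normrN.
have mp := @measurable_horner_expRN R p pos.
have [_ ip] := integrable_cutoff w0.
have pC : exists C, 0 <= C /\ forall u : R, 0 < u -> `|p.[expR (- u)]| <= C.
  exists (\sum_(i < size p) `|p`_i|); split; first by apply: sumr_ge0.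
  move=> u u0; rewrite horner_coef; apply: (le_trans (ler_norm_sum _ _ _)).
  apply: ler_sum => i _; rewrite normrM ler_piMr// normrX exprn_ile1//.
  by rewrite ger0_norm ?expR_ge0// expRN_le1// ltW.
have [C [C0 hC]] := pC.
have [iq _] := integrable_sqr_diff hm w0 C0 mp hC.
have D : `|\int[m]_(u in pos) (jump_cutoff u * expR (- (w * u))) -
    \int[m]_(u in pos) (expR (- (w * u)) * (1 - expR (- u)) ^+ 2 * p.[expR (- u)])|
    <= del * min_sqr_mass m.
  have := RintegralB mpos ip iq => <-; apply: (Rintegral_dominated hm) => //.
    apply: measurable_funB.
      by have /measurable_int/measurable_EFinP := ip.
    by have /measurable_int/measurable_EFinP := iq.
  move=> u; rewrite /pos/= in_itv/= andbT => u0.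
  have -> : jump_cutoff u * expR (- (w * u)) -
     expR (- (w * u)) * (1 - expR (- u)) ^+ 2 * p.[expR (- u)] =
     expR (- (w * u)) * (1 - expR (- u)) ^+ 2 * (cutoff_quot al be (expR (- u)) - p.[expR (- u)]).
    by rewrite /jump_cutoff -cutoff_quotE//; ring.
  rewrite normrM mulrC ler_pM//.
    by apply: pdel; rewrite expR_ge0 expRN_le1// ltW.
  exact: sqr_diff_le w0 (ltW u0).
have A := tail_cutoff w0.
have B : `|2 * c * p.[1]| <= del * (2 * c).
  by rewrite normrM (ger0_norm (_ : 0 <= 2 * c)) ?mulr_ge0// mulrC ler_wpM2r ?mulr_ge0.
move: A B D; rewrite mulrDr.
move: (\int[m]_(u in tail) _) (\int[m]_(u in pos) _) (\int[m]_(u in pos) _) (2 * c * p.[1]) => x1 x2 x3 x4.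
move: (del * (2 * c)) (del * _) => d1 d2.
by rewrite !ler_norml; lra.
Qed.

End JumpRate.

Section BoundedExpectation.
Context {R : realType} {d : measure_display} {T : measurableType d}.
Context (P : probability T R).

Definition bounded_measurable (f : T -> R) :=
  measurable_fun setT f /\ exists K : R, forall w, `|f w| <= K.

Lemma bounded_integrable f : bounded_measurable f -> P.-integrable setT (EFin \o f).
Proof.
move=> [mf [K hK]].
apply: (le_integrable measurableT (g := EFin \o cst K)).
- exact/measurable_EFinP.
- by move=> w _ /=; rewrite lee_fin (le_trans (hK w))// ler_norm.
- exact: finite_measure_integrable_cst.
Qed.

Lemma bounded_measurableD f g : bounded_measurable f -> bounded_measurable g ->
  bounded_measurable (fun w => f w + g w).
Proof.
move=> [mf [K hK]] [mg [L hL]]; split; first exact: measurable_funD.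
by exists (K + L) => w; rewrite (le_trans (ler_normD _ _))// lerD.
Qed.

Lemma bounded_measurableM f g : bounded_measurable f -> bounded_measurable g ->
  bounded_measurable (fun w => f w * g w).
Proof.
move=> [mf [K hK]] [mg [L hL]]; split; first exact: measurable_funM.
by exists (K * L) => w; rewrite normrM ler_pM.
Qed.

Lemma bounded_measurable_cst c : bounded_measurable (fun=> c).
Proof. by split; [exact: measurable_cst|exists `|c|]. Qed.

Lemma bounded_measurableZ c f : bounded_measurable f ->
  bounded_measurable (fun w => c * f w).
Proof. exact/bounded_measurableM/bounded_measurable_cst. Qed.

Lemma bounded_measurableB f g : bounded_measurable f -> bounded_measurable g ->
  bounded_measurable (fun w => f w - g w).
Proof.
move=> bf bg; have := bounded_measurableD bf (bounded_measurableZ (-1) bg).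
by under eq_fun do rewrite mulN1r.
Qed.

Lemma expectD f g : bounded_measurable f -> bounded_measurable g ->
  \int[P]_w (f w + g w) = \int[P]_w f w + \int[P]_w g w.
Proof. by move=> /bounded_integrable ? /bounded_integrable ?; exact: RintegralD. Qed.

Lemma expectB f g : bounded_measurable f -> bounded_measurable g ->
  \int[P]_w (f w - g w) = \int[P]_w f w - \int[P]_w g w.
Proof. by move=> /bounded_integrable ? /bounded_integrable ?; exact: RintegralB. Qed.

Lemma expectZ c f : bounded_measurable f ->
  \int[P]_w (c * f w) = c * \int[P]_w f w.
Proof. by move=> /bounded_integrable ?; exact: RintegralZl. Qed.

Lemma expect_sum n (f : nat -> T -> R) : (forall i, bounded_measurable (f i)) ->
  \int[P]_w (\sum_(i < n) f i w) = \sum_(i < n) \int[P]_w f i w.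
Proof.
by move=> bf; apply: (Rintegral_sum _ measurableT _).2 => i; exact: bounded_integrable.
Qed.

Lemma bounded_measurable_sum n (f : nat -> T -> R) :
  (forall i, bounded_measurable (f i)) ->
  bounded_measurable (fun w => \sum_(i < n) f i w).
Proof.
move=> bf; elim: n => [|n IH].
  by under eq_fun do rewrite big_ord0; exact: bounded_measurable_cst.
by under eq_fun do rewrite big_ord_recr/=; exact: bounded_measurableD.
Qed.

Lemma expect_le f g : bounded_measurable f -> bounded_measurable g ->
  (forall w, f w <= g w) -> \int[P]_w f w <= \int[P]_w g w.
Proof.
by move=> /bounded_integrable ? /bounded_integrable ? fg; apply: le_Rintegral.
Qed.

Lemma expect_cst c : \int[P]_w c = c.
Proof.
rewrite Rintegral_cst//; have -> : fine (P setT) = 1.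
  by have := probability_setT P => ->.
by rewrite mulr1.
Qed.

Lemma expect_norm_le f g : bounded_measurable f -> bounded_measurable g ->
  (forall w, `|f w| <= g w) -> `|\int[P]_w f w| <= \int[P]_w g w.
Proof.
move=> bf bg fg; rewrite ler_norml; apply/andP; split.
  rewrite -mulN1r -expectZ//; apply: expect_le => //; first exact: bounded_measurableZ.
  by move=> w; rewrite mulN1r lerNl; have := fg w; rewrite ler_norml lerNl => /andP[].
by apply: expect_le => // w; exact: le_trans (ler_norm _) (fg w).
Qed.

Lemma expect_norm_le_cst f c : bounded_measurable f -> (forall w, `|f w| <= c) ->
  `|\int[P]_w f w| <= c.
Proof.
move=> bf fc; rewrite -[leRHS]expect_cst; apply: expect_norm_le => //.
exact: bounded_measurable_cst.
Qed.

End BoundedExpectation.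

(** * Comparison over one step *)

Section OneStep.
Context {R : realType} {d : measure_display} {T : measurableType d}.
Context (P : probability T R).
Local Notation RR := (measurableTypeR R).
Variables (X : R -> {RV P >-> R}) (b c : R) (m : {measure set RR -> \bar R}).
Variables (Q : R -> R.-pker RR ~> RR) (v : R -> R -> R).
Hypothesis c0 : 0 <= c.
Hypothesis hm : (\int[m]_(u in `]0%R, +oo[) (Num.min u (u ^+ 2))%:E < +oo)%E.
Hypothesis X0 : forall (t : R) w, 0 <= t -> 0 <= X t w.
Hypothesis vs : forall l : R, 0 <= l -> cumulant_solution (phi b c m) l (v ^~ l).
Hypothesis Qv : forall t x l : R, 0 <= t -> 0 <= x -> 0 <= l ->
  (\int[Q t x]_(y in `[0%R, +oo[) (expR (- (l * y)))%:E)%E = (expR (- (x * v t l)))%:E.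
Hypothesis QX : forall (s t : R) (A : set T) (B : set RR), 0 <= s -> 0 <= t ->
  natural_filtration X s A -> measurable B ->
  P (A `&` X (s + t) @^-1` B) = (\int[P]_(w in A) Q t (X s w) B)%E.

Let f := phi b c m.
Let L := lip_const m b c.

Let mpos : measurable (`]0, +oo[%classic : set RR).
Proof. exact: measurable_itv. Qed.

Let L0 : 0 <= L. Proof. exact: lip_const_ge0. Qed.

Let f0 : f 0 = 0. Proof. exact: mechanism_0. Qed.

Let flip (y z : R) : 0 <= y -> y <= z -> `|f z - f y| <= L * (1 + z) * (z - y).
Proof. exact: mechanism_lipschitz. Qed.

Let fge (z : R) : 0 <= z -> - (`|b| * z) <= f z.
Proof.
move=> z0; rewrite /f /phi /mechanism_on.
have h1 : 0 <= c * z ^+ 2 by rewrite mulr_ge0// sqr_ge0.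
have h2 : 0 <= \int[m]_(u in `]0, +oo[) (expR (- (z * u)) - 1 + z * u).
  by apply: Rintegral_ge0 => u _; exact: exp_rem_ge0.
have h3 : - (`|b| * z) <= b * z.
  by rewrite -mulNr ler_wpM2r// lerNl -normrN ler_norm.
by rewrite -addrA (le_trans h3)// lerDl addr_ge0.
Qed.

(** The conditional mean of e^{-l X(s + h)} given the past is e^{-l X(s)} times this factor at y =
    X(s). *)
Let e (h l y : R) : R := expR (- ((v h l - l) * y)).

(** The expansion of p(sg) (1 - sg)^2, with [t i] in place of the power sg^i. *)
Let sum_second_diff (p : {poly R}) (t : nat -> R) : R :=
  \sum_(j < size p) p`_j * (t j - 2 * t j.+1 + t j.+2).

(* Expanding [p], the integrand is a combination of the products
   [e^{i X_s} e^{- (w + i) X_{s+h}}], to which [markov_laplace] applies; [a] has to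
   vanish for large [X_s] because of the growing factor. *)
Lemma laplace_increment (s h w K : R) (a : T -> R) (p : {poly R}) :
  0 <= s -> 0 <= h -> 0 <= w -> 
  measurable_fun [set: past X s] a -> (forall o, 0 <= a o <= 1) ->
  (forall o, K < X s o -> a o = 0) ->
  bounded_measurable (fun o => a o * expR (- (w * X (s + h) o)) *
    (p.[expR (X s o - X (s + h) o)] * (1 - expR (X s o - X (s + h) o)) ^+ 2)) /\
  bounded_measurable (fun o => a o * expR (- (w * X s o)) *
      \sum_(j < size p) p`_j * second_diff (e h ^~ (X s o)) (w + j%:R)) /\
  \int[P]_o (a o * expR (- (w * X (s + h) o)) *
    (p.[expR (X s o - X (s + h) o)] * (1 - expR (X s o - X (s + h) o)) ^+ 2)) =
  \int[P]_o (a o * expR (- (w * X s o)) *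
      \sum_(j < size p) p`_j * second_diff (e h ^~ (X s o)) (w + j%:R)).
Proof.
move=> s0 h0 w0 ma a01 aK.
have sh0 : 0 <= s + h by rewrite addr_ge0.
have vh0 (l : R) : 0 <= l -> 0 <= v h l by move=> l0; have [] := vs l0 h0.
pose ai (i : nat) (o : T) : R := a o * expR (i%:R * X s o).
have mXp := @past_RV _ _ _ P X s s s0 (lexx s).
have mai i : measurable_fun [set: past X s] (ai i).
  apply: measurable_funM => //; apply: measurableT_comp => //; exact: measurable_funM.
have aiB i o : 0 <= ai i o <= expR (i%:R * `|K|).
  have /andP[a0 a1] := a01 o; rewrite /ai mulr_ge0 ?expR_ge0//=.
  have [XK|KX] := leP (X s o) K; last by rewrite aK// mul0r expR_ge0.
  rewrite -[leRHS]mul1r ler_pM ?expR_ge0// ler_expR ler_wpM2l//.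
  exact: le_trans (ler_norm K).
have mai' i := past_measurable_fun (mai i).
have bai i (Y : T -> R) : measurable_fun setT Y -> (forall o, 0 <= Y o) ->
    bounded_measurable (fun o => ai i o * expR (- Y o)).
  move=> mY Y0; apply: (@bounded_measurableM _ _ _ (ai i)).
    split => //; exists (expR (i%:R * `|K|)) => o.
    by have /andP[? ?] := aiB i o; rewrite ger0_norm.
  split; first by apply: measurableT_comp => //; exact: measurableT_comp.
  by exists 1 => o; rewrite ger0_norm ?expR_ge0// expRN_le1.
pose t1 (i : nat) (o : T) : R := ai i o * expR (- ((w + i%:R) * X (s + h) o)).
pose t2 (i : nat) (o : T) : R := ai i o * expR (- (v h (w + i%:R) * X s o)).
have wi (i : nat) : 0 <= w + i%:R by rewrite addr_ge0.
have b1 i : bounded_measurable (t1 i).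
  apply: (bai i) => [|o]; first exact: measurable_funM.
  by rewrite mulr_ge0// X0.
have b2 i : bounded_measurable (t2 i).
  apply: (bai i) => [|o]; first exact: measurable_funM.
  by rewrite mulr_ge0 ?vh0// X0.
have E12 i : \int[P]_o t1 i o = \int[P]_o t2 i o.
  exact: (markov_laplace X0 Qv QX s0 h0 (wi i) (vh0 _ (wi i)) (mai i) (aiB i)).
have bD (t : nat -> T -> R) : (forall i, bounded_measurable (t i)) -> forall j,
    bounded_measurable (fun o => p`_j * (t j o - 2 * t j.+1 o + t j.+2 o)).
  move=> bt j; apply: bounded_measurableZ; apply: bounded_measurableD => //.
  by apply: bounded_measurableB => //; exact: bounded_measurableZ.
have EI (t : nat -> T -> R) : (forall i, bounded_measurable (t i)) ->
    \int[P]_o sum_second_diff p (t ^~ o) = sum_second_diff p (fun i => \int[P]_o t i o).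
  move=> bt; rewrite /sum_second_diff (expect_sum P _ (bD t bt)).
  apply: eq_bigr => j _; rewrite expectZ; last first.
    by apply: bounded_measurableD => //; apply: bounded_measurableB => //; exact: bounded_measurableZ.
  rewrite expectD//; last by apply: bounded_measurableB => //; exact: bounded_measurableZ.
  by rewrite expectB ?expectZ//; exact: bounded_measurableZ.
have F1 : (fun o => a o * expR (- (w * X (s + h) o)) *
    (p.[expR (X s o - X (s + h) o)] * (1 - expR (X s o - X (s + h) o)) ^+ 2)) =
    (fun o => sum_second_diff p (t1 ^~ o)).
  apply/funext => o; rewrite horner_coef big_distrl/= big_distrr/=.
  apply: eq_bigr => j _; set sg := expR (X s o - _).
  have E i : t1 i o = a o * expR (- (w * X (s + h) o)) * sg ^+ i.
    rewrite /t1 /ai /sg -expRM_natl -!mulrA -!expRD; congr (_ * expR _); ring.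
  by rewrite !E !exprS; ring.
have F2 : (fun o => a o * expR (- (w * X s o)) *
      \sum_(j < size p) p`_j * second_diff (e h ^~ (X s o)) (w + j%:R)) =
    (fun o => sum_second_diff p (t2 ^~ o)).
  apply/funext => o; rewrite big_distrr/=; apply: eq_bigr => j _.
  (* Writing v_h(w + i) - i = w + (v_h(w + i) - (w + i)) separates the common factor from [e]. *)
  have E i : t2 i o = a o * expR (- (w * X s o)) * e h (w + i%:R) (X s o).
    rewrite /t2 /ai /e -!mulrA -!expRD; congr (_ * expR _); ring.
  rewrite /second_diff !E -(natr1 j) -(natr1 j.+1) -(natr1 j).
  have -> : w + (j%:R + 1 + 1) = w + j%:R + 2 by ring.
  by rewrite (addrA w); ring.
rewrite F1 F2; split; first exact: bounded_measurable_sum (bD t1 b1).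
split; first exact: bounded_measurable_sum (bD t2 b2).
by rewrite (EI t1 b1) (EI t2 b2); apply: eq_bigr => j _; rewrite !E12.
Qed.

Variables (r eta K W del : R) (p : {poly R}).
Hypothesis r0 : 0 < r.
Hypothesis eta0 : 0 < eta.
Hypothesis K0 : 0 <= K.
Hypothesis W0 : 0 <= W.
Hypothesis del0 : 0 <= del.
Hypothesis pdel : forall s : R, 0 <= s <= expR K ->
  `|cutoff_quot (expR (- (r + eta))) (expR (- (r + 2 * eta))) s - p.[s]| <= del.

(** The right side of the equation for [u] when theta is the tail mass. *)
Let psi (w : R) : R := fine (m `]r, +oo[%classic) - phi_trunc r b c m w.

Let kap (o : T) (s h : R) : R := jump_cutoff r eta (X (s + h) o - X s o).

(** Both exponential factors get common constants. The range of [l] has to contain w + j + 2 for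
    every exponent j of [p]. *)
Lemma increment_expansion (C1 : R) : 0 <= C1 -> exists C2 h1 : R, [/\ 0 <= C2, 0 < h1,
  (forall h l y : R, 0 <= h <= h1 -> 0 <= l <= W + (size p)%:R + 2 -> 0 <= y <= K ->
    `|e h l y - 1 - h * (y * f l)| <= C2 * h ^+ 2) &
  (forall h w w' y : R, 0 <= h <= h1 -> 0 <= w <= W -> 0 <= y <= K ->
    `|w' - w - h * psi w| <= C1 * h ^+ 2 ->
    `|expR (- ((w' - w) * y)) - 1 + h * (y * psi w)| <= C2 * h ^+ 2)].
Proof.
move=> C10; pose Lam : R := W + (size p)%:R + 2.
have Lam0 : 0 <= Lam by rewrite !addr_ge0.
have [Cv [Cv0 hv]] := cumulant_expansion L0 (normr_ge0 b) f0 flip fge Lam0.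
have mt0 : 0 <= fine (m `]r, +oo[%classic) by exact: fine_ge0.
(* Bounds |f| on [0, Lam] and, through [phi_trunc_tail], |psi| on [0, W]. *)
pose G : R := L * (1 + Lam) * Lam + fine (m `]r, +oo[%classic).
have G0 : 0 <= G by rewrite addr_ge0// !mulr_ge0// addr_ge0.
have fG (l : R) : 0 <= l <= Lam -> `|f l| <= L * (1 + Lam) * Lam.
  move=> /andP[l0 lL]; have := lip_segment L0 flip (Z := Lam) (y := 0) (z := l).
  rewrite f0 !subr0 lexx l0 lL Lam0 => /(_ isT isT) h; apply: (le_trans h).
  by rewrite ger0_norm// ler_wpM2l// mulr_ge0// addr_ge0.
have psiG (w : R) : 0 <= w <= W -> `|psi w| <= G.
  move=> /andP[w0 wW]; rewrite /psi (phi_trunc_tail hm)// addrC.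
  apply: (le_trans (ler_normD _ _)); rewrite normrN; apply: lerD.
    by apply: fG; rewrite w0 /Lam -addrA (le_trans wW)// lerDl addr_ge0.
  rewrite ger0_norm; last by apply: Rintegral_ge0 => u _; exact: expR_ge0.
  have mtl : measurable (`]r, +oo[%classic : set RR) by exact: measurable_itv.
  have -> : fine (m `]r, +oo[%classic) = \int[m]_(u in `]r, +oo[) 1.
    by rewrite Rintegral_cst// mul1r.
  apply: le_Rintegral => //; first exact: integrable_tail_expR.
    apply: (integrable_tail_bounded hm r0 (C := 1)) => // u _.
    by rewrite normr1.
  move=> u; rewrite /= in_itv/= andbT => ru.
  by rewrite expRN_le1// mulr_ge0// ltW// (lt_trans r0).
pose C := Cv + C1; have Cp : 0 <= C by rewrite addr_ge0.
pose C2 := C * K + 2 * ((G + C) * K) ^+ 2.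
have GC0 : 0 <= 2 * (G + C) * K by rewrite !mulr_ge0// addr_ge0.
(* The sum of the three quantities whose product with [h] must stay below 1, so any h <= 1 / D is
   admissible. *)
pose D := 2 * (G + C) * K + 2 * `|b| + 1.
have D0 : 0 < D by rewrite ltr_wpDl// addr_ge0// mulr_ge0.
have Dh h : 0 <= h <= D^-1 -> [/\ 0 <= h <= 1, 2 * (G + C) * K * h <= 1 & 2 * `|b| * h <= 1].
  move=> /andP[h0 hD].
  have h2 : h * D <= 1 by rewrite -ler_pdivlMr// mul1r.
  have e1 : 0 <= 2 * `|b| * h by rewrite !mulr_ge0.
  have e2 : 0 <= 2 * (G + C) * K * h by rewrite mulr_ge0.
  by move: h2 e1 e2; rewrite /D; split; lra.
exists C2, D^-1; split.
- by apply: addr_ge0; [exact: mulr_ge0|apply: mulr_ge0 => //; exact: sqr_ge0].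
- by rewrite invr_gt0.
- move=> h l y /Dh[h01 hG hb] lL yK; have /andP[hh0 _] := h01.
  have /andP[l0 _] := lL.
  have A : `|(v h l - l) - h * - f l| <= C * h ^+ 2.
    have := hv l (v ^~ l) h lL hh0 hb (vs l0); rewrite mulrN opprK => A.
    by apply: (le_trans A); rewrite ler_wpM2r ?sqr_ge0// lerDl.
  have B : `|- f l| <= G by rewrite normrN (le_trans (fG l lL))// lerDl.
  have -> : e h l y - 1 - h * (y * f l) =
      expR (- ((v h l - l) * y)) - 1 + h * y * (- f l) by rewrite /e; ring.
  exact: expRN_approx A B Cp yK h01 hG.
- move=> h w w' y /Dh[h01 hG hb] wW yK A.
  have A' : `|(w' - w) - h * psi w| <= C * h ^+ 2.
    by apply: (le_trans A); rewrite ler_wpM2r ?sqr_ge0// lerDr.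
  have := expRN_approx A' (psiG w wW) Cp yK h01 hG.
  by rewrite mulrA.
Qed.

(** To first order the three terms are 1 + h y f(w), 1 - h y psi(w), and h y times the polynomial
    second difference of [f]. What remains is h y times psi(w) + f(w) minus that second difference,
    and psi(w) + f(w) is the tail integral that [poly_jump_rate] estimates. *)
Lemma increment_pointwise (C1 : R) : 0 <= C1 -> exists C2 C3 h1 : R,
  [/\ 0 <= C2, 0 <= C3, 0 < h1,
  (forall h w y : R, 0 <= h <= h1 -> 0 <= w <= W -> 0 <= y <= K ->
    `|second_diff (e h ^~ y) w| <= h * K * (2 * c + min_sqr_mass m) + C2 * h ^+ 2) &
  (forall h w w' y : R, 0 <= h <= h1 -> 0 <= w <= W -> 0 <= y <= K ->
    `|w' - w - h * psi w| <= C1 * h ^+ 2 ->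
    `|e h w y - expR (- ((w' - w) * y)) -
       \sum_(j < size p) p`_j * second_diff (e h ^~ y) (w + j%:R)|
    <= h * K * (del * (2 * c + min_sqr_mass m) + jump_gap m r eta) + C3 * h ^+ 2)].
Proof.
move=> C10; have [C2 [h1 [C20 h10 eE psiE]]] := increment_expansion C10.
have [S S0 SE] : exists2 S : R, 0 <= S & S = \sum_(j < size p) `|p`_j|.
  by exists (\sum_(j < size p) `|p`_j|) => //; exact: sumr_ge0.
pose M := 2 * c + min_sqr_mass m.
have N0 : 0 <= (size p)%:R :> R by [].
have D2 h l y : 0 <= h <= h1 -> 0 <= l <= W + (size p)%:R -> 0 <= y <= K ->
    `|second_diff (e h ^~ y) l - h * (y * second_diff f l)| <= 4 * (C2 * h ^+ 2).
  move=> hh /andP[l0 lW] yK.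
  have lr (k : R) : 0 <= k <= 2 -> 0 <= l + k <= W + (size p)%:R + 2.
    by move=> /andP[k0 k2]; rewrite addr_ge0//= lerD.
  apply: second_diff_approx; [|apply: eE => //|apply: eE => //].
  - by apply: eE => //; have := lr 0; rewrite addr0 lexx ler0n; exact.
  - by apply: lr; rewrite ler01 ler1n.
  - by apply: lr; rewrite lexx ler0n.
exists (4 * C2), (2 * C2 + 4 * C2 * S), h1; split => //.
- exact: mulr_ge0.
- by apply: addr_ge0; [exact: mulr_ge0|apply: mulr_ge0 => //; exact: mulr_ge0].
- move=> h w y hh /andP[w0 wW] yK; have /andP[h0 _] := hh; have /andP[y0 yK'] := yK.
  have wl : 0 <= w <= W + (size p)%:R by rewrite w0/= (le_trans wW)// lerDl.
  have := D2 h w y hh wl yK; rewrite (mulrA 4) => A.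
  have /andP[B0 B1] := second_diff_phi_bound hm b c0 w0.
  have B : `|h * (y * second_diff f w)| <= h * K * M.
    rewrite ger0_norm; last by apply: mulr_ge0 => //; exact: mulr_ge0.
    by rewrite -mulrA; apply: ler_wpM2l => //; apply: ler_pM.
  have -> : second_diff (e h ^~ y) w = h * (y * second_diff f w) +
      (second_diff (e h ^~ y) w - h * (y * second_diff f w)) by ring.
  by apply: (le_trans (ler_normD _ _)); exact: lerD.
- move=> h w w' y hh wW yK hw; have /andP[h0 _] := hh; have /andP[y0 yK'] := yK.
  have /andP[w0 wleW] := wW.
  have wl : 0 <= w <= W + (size p)%:R + 2.
    by rewrite w0 -addrA /= (le_trans wleW)// lerDl addr_ge0.
  have g1 := eE h w y hh wl yK; have g2 := psiE h w w' y hh wW yK hw.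
  have g3 : `|\sum_(j < size p) p`_j * second_diff (e h ^~ y) (w + j%:R) -
      h * (y * \sum_(j < size p) p`_j * second_diff f (w + j%:R))| <= 4 * C2 * S * h ^+ 2.
    rewrite !big_distrr/= -sumrB.
    have -> : 4 * C2 * S * h ^+ 2 = \sum_(j < size p) `|p`_j| * (4 * (C2 * h ^+ 2)).
      by rewrite -big_distrl /= -SE; ring.
    apply: (le_trans (ler_norm_sum _ _ _)); apply: ler_sum => j _.
    have -> : p`_j * second_diff (e h ^~ y) (w + j%:R) -
       h * (y * (p`_j * second_diff f (w + j%:R))) =
       p`_j * (second_diff (e h ^~ y) (w + j%:R) - h * (y * second_diff f (w + j%:R))) by ring.
    rewrite normrM; apply: ler_wpM2l => //; apply: D2 => //.
    by rewrite addr_ge0//= lerD// ler_nat ltnW.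
  have rate : psi w + f w = \int[m]_(u in `]r, +oo[) expR (- (w * u)).
    by rewrite /psi (phi_trunc_tail hm)// subrK.
  (* Under [m] all jumps are positive, so the approximation is needed here only on [0, 1]. *)
  have pdel1 (z : R) : 0 <= z <= 1 ->
      `|cutoff_quot (expR (- (r + eta))) (expR (- (r + 2 * eta))) z - p.[z]| <= del.
    move=> /andP[z0 z1]; apply: pdel; rewrite z0 (le_trans z1)//.
    by rewrite -[leLHS]expR0 ler_expR.
  have J := poly_jump_rate hm r0 eta0 del0 pdel1 b c0 w0.
  rewrite -rate -/f in J; move: g1 g2 g3 J.
  move: (\sum_(j < size p) _ * second_diff (e h ^~ y) _) => sm.
  move: (\sum_(j < size p) _ * second_diff f _) => smf g1 g2 g3 J.
  have -> : e h w y - expR (- ((w' - w) * y)) - sm =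
    h * y * (psi w + f w - smf) + ((e h w y - 1 - h * (y * f w))
    - (expR (- ((w' - w) * y)) - 1 + h * (y * psi w))
    - (sm - h * (y * smf))) by ring.
  apply: (le_trans (ler_normD _ _)); apply: lerD.
    rewrite normrM ger0_norm; last exact: mulr_ge0.
    apply: ler_pM => //; first exact: mulr_ge0.
    exact: ler_wpM2l.
  have -> : (2 * C2 + 4 * C2 * S) * h ^+ 2 = C2 * h ^+ 2 + C2 * h ^+ 2 + 4 * C2 * S * h ^+ 2 by ring.
  apply: (le_trans (ler_normB _ _)); apply: lerD => //.
  by apply: (le_trans (ler_normB _ _)); exact: lerD.
Qed.

Lemma weighted_expect_le (a z : T -> R) (Y : T -> R) (w B : R) : 0 <= w -> 0 <= B ->
  (forall o, 0 <= a o <= 1) -> (forall o, 0 <= Y o) ->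
  bounded_measurable (fun o => a o * expR (- (w * Y o)) * z o) ->
  (forall o, a o != 0 -> `|z o| <= B) ->
  `|\int[P]_o (a o * expR (- (w * Y o)) * z o)| <= B.
Proof.
move=> w0 B0 a01 Y0 bz hz; apply: (expect_norm_le_cst P bz) => o.
have [->|ao] := eqVneq (a o) 0; first by rewrite !mul0r normr0.
have /andP[a0 a1] := a01 o.
have e1 : expR (- (w * Y o)) <= 1 by apply: expRN_le1; exact: mulr_ge0.
rewrite normrM ger0_norm; last by apply: mulr_ge0 => //; exact: expR_ge0.
rewrite -[leRHS]mul1r; apply: ler_pM => //; last exact: hz.
  by apply: mulr_ge0 => //; exact: expR_ge0.
by apply: mulr_ile1 => //; exact: expR_ge0.
Qed.

Let bexp (l : R) (Y : T -> R) : 0 <= l -> measurable_fun setT Y -> (forall o, 0 <= Y o) ->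
  bounded_measurable (fun o => expR (- (l * Y o))).
Proof.
move=> l0 mY Y0; split; first exact: measurable_expRNM_comp.
exists 1 => o; rewrite ger0_norm ?expR_ge0//; apply: expRN_le1; exact: mulr_ge0.
Qed.

Lemma bounded_kap s h : bounded_measurable (fun o => kap o s h).
Proof.
split; first by apply: measurable_jump_cutoff; exact: measurable_funB.
exists 1 => o; have /andP[? ?] := jump_cutoff01 r eta (X (s + h) o - X s o).
by rewrite ger0_norm.
Qed.

(** Where [a] is nonzero, sg = e^{X(s) - X(s + h)} lies in [0, e^K], so [p] is within [del] of the
    quotient there. The other factor, a e^{-w X(s + h)} (1 - sg)^2, is the integrand for the
    polynomial 1, whose mean bound [B] will be O(h). *)
Lemma cutoff_compare (s h w B : R) (a : T -> R) : 0 <= s + h -> 0 <= w ->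
  bounded_measurable a -> (forall o, 0 <= a o <= 1) ->
  (forall o, K < X s o -> a o = 0) ->
  bounded_measurable (fun o => a o * expR (- (w * X (s + h) o)) *
    (p.[expR (X s o - X (s + h) o)] * (1 - expR (X s o - X (s + h) o)) ^+ 2)) ->
  bounded_measurable (fun o => a o * expR (- (w * X (s + h) o)) *
    ((1%:P : {poly R}).[expR (X s o - X (s + h) o)] * (1 - expR (X s o - X (s + h) o)) ^+ 2)) ->
  \int[P]_o (a o * expR (- (w * X (s + h) o)) *
    ((1%:P : {poly R}).[expR (X s o - X (s + h) o)] * (1 - expR (X s o - X (s + h) o)) ^+ 2)) <= B ->
  `|\int[P]_o (a o * (kap o s h * expR (- (w * X (s + h) o)))) -
    \int[P]_o (a o * expR (- (w * X (s + h) o)) *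
    (p.[expR (X s o - X (s + h) o)] * (1 - expR (X s o - X (s + h) o)) ^+ 2))| <= del * B.
Proof.
move=> sh0 w0 ba a01 aK bp b1 hB.
have bx := bexp w0 (measurable_funPT (X (s + h))) (fun o => X0 o sh0).
have bk := bounded_measurableM ba (bounded_measurableM (bounded_kap s h) bx).
rewrite -(expectB P bk bp); apply: le_trans (ler_wpM2l del0 hB).
rewrite -(expectZ P del b1); apply: expect_norm_le.
- exact: bounded_measurableB bk bp.
- exact: bounded_measurableZ b1.
move=> o; rewrite hornerC mul1r.
have [ao|ao] := eqVneq (a o) 0; first by rewrite ao !mul0r subrr normr0 mulr0.
have /andP[a0 a1] := a01 o.
have yK : X s o <= K by rewrite leNgt; apply: contra_neqN ao => /aK.
have [q2 q3] := jump_cutoff_params r0 eta0.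
have -> : kap o s h = cutoff_quot (expR (- (r + eta))) (expR (- (r + 2 * eta)))
    (expR (X s o - X (s + h) o)) * (1 - expR (X s o - X (s + h) o)) ^+ 2.
  by rewrite (cutoff_quotE q2 q3) /kap /jump_cutoff opprB.
have sgK : 0 <= expR (X s o - X (s + h) o) <= expR K.
  by rewrite expR_ge0 ler_expR lerBlDr (le_trans yK)// lerDl X0.
have := pdel sgK; move: (cutoff_quot _ _ _) => Fq hFq.
have -> : a o * (Fq * (1 - expR (X s o - X (s + h) o)) ^+ 2 * expR (- (w * X (s + h) o))) -
  a o * expR (- (w * X (s + h) o)) *
    (p.[expR (X s o - X (s + h) o)] * (1 - expR (X s o - X (s + h) o)) ^+ 2) =
  (Fq - p.[expR (X s o - X (s + h) o)]) *
    (a o * expR (- (w * X (s + h) o)) * (1 - expR (X s o - X (s + h) o)) ^+ 2) by ring.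
have n0 : 0 <= a o * expR (- (w * X (s + h) o)) * (1 - expR (X s o - X (s + h) o)) ^+ 2.
  by apply: mulr_ge0; [apply: mulr_ge0 => //; exact: expR_ge0|exact: sqr_ge0].
by rewrite normrM (ger0_norm n0); apply: ler_wpM2r.
Qed.

(** The kept part is the full mean minus the cut part. The latter is replaced by its polynomial
    form, and the Markov property moves everything to time [s], where [increment_pointwise] applies.
    [del] enters twice: through [cutoff_compare] and through [poly_jump_rate]. *)
Lemma one_step (C1 : R) : 0 <= C1 -> exists C h1 : R, [/\ 0 <= C, 0 < h1 &
  forall (s h w w' : R) (a : T -> R), 0 <= s -> 0 <= h <= h1 -> 0 <= w <= W ->
    0 <= w' ->
    `|w' - w - h * psi w| <= C1 * h ^+ 2 ->
    measurable_fun [set: past X s] a -> (forall o, 0 <= a o <= 1) ->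
    (forall o, K < X s o -> a o = 0) ->
    `|\int[P]_o (a o * ((1 - kap o s h) * expR (- (w * X (s + h) o))))
      - \int[P]_o (a o * expR (- (w' * X s o)))|
    <= h * K * (2 * del * (2 * c + min_sqr_mass m) + jump_gap m r eta) + C * h ^+ 2].
Proof.
move=> C10; have [C2 [C3 [h1 [C20 C30 h10 eD2 eM]]]] := increment_pointwise C10.
pose M := 2 * c + min_sqr_mass m.
have M0 : 0 <= M by apply: addr_ge0; [exact: mulr_ge0|exact: min_sqr_mass_ge0].
exists (C3 + del * C2), h1; split => //; first by apply: addr_ge0 => //; exact: mulr_ge0.
move=> s h w w' a s0 hh wW w'0 hw ma a01 aK.
have /andP[h0 _] := hh; have /andP[w0 wleW] := wW.
have hK : 0 <= h * K by exact: mulr_ge0.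
have sh0 : 0 <= s + h by exact: addr_ge0.
have y0 o : 0 <= X s o by exact: X0.
have x0 o : 0 <= X (s + h) o by exact: X0.
have my := measurable_funPT (X s); have mx := measurable_funPT (X (s + h)).
have ba : bounded_measurable a.
  split; first exact: (past_measurable_fun ma).
  by exists 1 => o; have /andP[? ?] := a01 o; rewrite ger0_norm.
have bx := bexp w0 mx x0.
have by_ := bexp w0 my y0.
have by' := bexp w'0 my y0.
have [bT3 [bT3' T3]] := laplace_increment p s0 h0 w0 ma a01 aK.
(* The polynomial 1 gives the weighted mean of (1 - sg)^2, which multiplies the approximation
   error. *)
have [bT4 [bT4' T4]] := laplace_increment 1%:P s0 h0 w0 ma a01 aK.
have [vh0 _ _] := vs w0 h0.
have T1 : \int[P]_o (a o * expR (- (w * X (s + h) o))) =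
    \int[P]_o (a o * expR (- (w * X s o)) * e h w (X s o)).
  rewrite (markov_laplace X0 Qv QX s0 h0 w0 vh0 ma a01).
  by apply: eq_Rintegral => o _; rewrite /e -mulrA -expRD; congr (_ * expR _); ring.
have T2 : \int[P]_o (a o * expR (- (w' * X s o))) =
    \int[P]_o (a o * expR (- (w * X s o)) * expR (- ((w' - w) * X s o))).
  by apply: eq_Rintegral => o _; rewrite -mulrA -expRD; congr (_ * expR _); ring.
have y_le o : a o != 0 -> 0 <= X s o <= K.
  by move=> ao; rewrite y0 leNgt; apply: contra_neqN ao => /aK.
have T4b : \int[P]_o (a o * expR (- (w * X s o)) *
      \sum_(j < size (1%:P : {poly R})) (1%:P : {poly R})`_j *
        second_diff (e h ^~ (X s o)) (w + j%:R)) <= h * K * M + C2 * h ^+ 2.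
  apply: (le_trans (ler_norm _)); apply: (weighted_expect_le w0 _ a01 y0 bT4').
    exact: addr_ge0 (mulr_ge0 hK M0) (mulr_ge0 C20 (sqr_ge0 h)).
  move=> o /y_le yK; rewrite size_polyC oner_eq0 /= big_ord1 coefC eqxx mul1r addr0.
  exact: eD2.
have A2 : `|\int[P]_o (a o * (kap o s h * expR (- (w * X (s + h) o)))) -
    \int[P]_o (a o * expR (- (w * X s o)) *
      \sum_(j < size p) p`_j * second_diff (e h ^~ (X s o)) (w + j%:R))| <=
    del * (h * K * M + C2 * h ^+ 2).
  rewrite -T3; apply: (cutoff_compare sh0 w0 ba a01 aK bT3 bT4).
  by rewrite T4.
have A4 : `|\int[P]_o (a o * expR (- (w * X s o)) * e h w (X s o))
    - \int[P]_o (a o * expR (- (w * X s o)) * expR (- ((w' - w) * X s o)))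
    - \int[P]_o (a o * expR (- (w * X s o)) *
        \sum_(j < size p) p`_j * second_diff (e h ^~ (X s o)) (w + j%:R))|
    <= h * K * (del * M + jump_gap m r eta) + C3 * h ^+ 2.
  have bE1 : bounded_measurable (fun o => a o * expR (- (w * X s o)) * e h w (X s o)).
    have -> : (fun o => a o * expR (- (w * X s o)) * e h w (X s o)) =
        (fun o => a o * expR (- (v h w * X s o))).
      by apply/funext => o; rewrite /e -mulrA -expRD; congr (_ * expR _); ring.
    exact: bounded_measurableM ba (bexp vh0 my y0).
  have bE2 : bounded_measurable
      (fun o => a o * expR (- (w * X s o)) * expR (- ((w' - w) * X s o))).
    have -> : (fun o => a o * expR (- (w * X s o)) * expR (- ((w' - w) * X s o))) =
        (fun o => a o * expR (- (w' * X s o))).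
      by apply/funext => o; rewrite -mulrA -expRD; congr (_ * expR _); ring.
    exact: bounded_measurableM ba by'.
  have bE3 := bounded_measurableB (bounded_measurableB bE1 bE2) bT3'.
  rewrite -(expectB P bE1 bE2) -(expectB P (bounded_measurableB bE1 bE2) bT3').
  have FE : (fun o => a o * expR (- (w * X s o)) * e h w (X s o)
    - a o * expR (- (w * X s o)) * expR (- ((w' - w) * X s o))
    - a o * expR (- (w * X s o)) *
        \sum_(j < size p) p`_j * second_diff (e h ^~ (X s o)) (w + j%:R)) =
    (fun o => a o * expR (- (w * X s o)) *
      (e h w (X s o) - expR (- ((w' - w) * X s o)) -
        \sum_(j < size p) p`_j * second_diff (e h ^~ (X s o)) (w + j%:R))).
    by apply/funext => o; rewrite -!mulrBr.
  rewrite FE in bE3 *; apply: (weighted_expect_le w0 _ a01 y0 bE3).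
    exact: addr_ge0 (mulr_ge0 hK (addr_ge0 (mulr_ge0 del0 M0) (jump_gap_ge0 m r eta)))
      (mulr_ge0 C30 (sqr_ge0 h)).
  by move=> o /y_le yK; exact: eM.
have A1 : \int[P]_o (a o * ((1 - kap o s h) * expR (- (w * X (s + h) o)))) =
   \int[P]_o (a o * expR (- (w * X (s + h) o))) -
   \int[P]_o (a o * (kap o s h * expR (- (w * X (s + h) o)))).
  rewrite -(expectB P (bounded_measurableM ba bx)
    (bounded_measurableM ba (bounded_measurableM (bounded_kap s h) bx))).
  by apply: eq_Rintegral => o _; ring.
rewrite A1 T1 T2.
set z1 := \int[P]_o (a o * _ * e h w _) in A4 *.
set z2 := \int[P]_o (a o * _ * expR _) in A4 *.
set z3 := \int[P]_o (a o * _ * \sum_(j < _) _) in A4 A2.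
set z4 := \int[P]_o (a o * (_ * _)) in A2 *.
have -> : z1 - z4 - z2 = (z1 - z2 - z3) - (z4 - z3) by ring.
apply: (le_trans (ler_normB _ _)); apply: (le_trans (lerD A4 A2)).
by rewrite le_eqVlt; apply/orP; left; apply/eqP; rewrite -/M; ring.
Qed.

End OneStep.

(** * Telescoping along dyadic partitions *)

Section Telescoping.
Context {R : realType} {d : measure_display} {T : measurableType d}.
Context (P : probability T R).
Local Notation RR := (measurableTypeR R).
Variables (X : R -> {RV P >-> R}) (b c x : R) (m : {measure set RR -> \bar R}).
Hypothesis x0 : 0 <= x.
Hypothesis hX : cadlag_CB_process (phi b c m) x X.
Variables (r t : R) (U : R -> R).
Hypothesis t0 : 0 < t.
Hypothesis hU : ode_solution (phi_trunc r b c m) (fine (m `]r, +oo[%classic)) U.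

Let X0 (s : R) w : 0 <= s -> 0 <= X s w.
Proof. by have [h _ _ _] := hX; exact: h. Qed.

Let cX w : cadlag (fun s => X s w).
Proof. by have [_ h _ _] := hX; exact: h. Qed.

Let D n k : R := dyadic t n k.

Let D0 n k : 0 <= D n k. Proof. exact/dyadic_ge0/ltW. Qed.

(** Only dyadic times, for measurability, but of all levels at once, so that the bound is uniform in
    the partition. *)
Definition exceed (K : nat) : set T :=
  [set w | exists n k, (k <= 2 ^ n)%N /\ K%:R < X (D n k) w].

Lemma measurable_exceed K : measurable (exceed K).
Proof.
have -> : exceed K = \bigcup_n \bigcup_(k in [set k | (k <= 2 ^ n)%N])
    (X (D n k) @^-1` `]K%:R, +oo[).
  apply/seteqP; split => w.
    by move=> [n [k [kn h]]]; exists n => //; exists k => //=; rewrite in_itv/= h.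
  by move=> [n _ [k /= kn]]; rewrite in_itv/= andbT => h; exists n, k.
apply: bigcup_measurable => n _; apply: bigcup_measurable => k _.
by rewrite -[Y in measurable Y]setTI; apply: measurable_funPT => //; exact: measurable_itv.
Qed.

(** The events decrease to the empty set because each cadlag path is bounded above on [0, t]. *)
Lemma exceed_small eps : 0 < eps -> exists K : nat, fine (P (exceed K)) <= eps.
Proof.
move=> eps0.
have capE : \bigcap_K exceed K = set0.
  rewrite -subset0 => w hw; have [K hK] := cadlag_bounded t (cX w).
  have [n [k [kn h]]] := hw K I.
  have : X (D n k) w <= K%:R.
    by apply: hK; rewrite D0/= -(dyadicE t n); apply: dyadic_le => //; exact: ltW.
  by rewrite leNgt h.
have := @nonincreasing_cvg_mu _ _ _ P exceed _ measurable_exceed.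
rewrite capE measure0 => /(_ _ measurable0 _) H.
have /fine_cvgP[_ /cvgrPdist_le/(_ _ eps0)[N _ hN]] : (P \o exceed) @ \oo --> 0%E.
  apply: H; first by rewrite ltey_eq fin_num_measure//; exact: measurable_exceed.
  apply/nonincreasing_seqP => K; apply/subsetPset => w [n [k [kn h]]].
  by exists n, k; split => //; apply: le_lt_trans h; rewrite ler_nat.
exists N; have := hN N (leqnn N); rewrite /= sub0r normrN.
exact: le_trans (ler_norm _).
Qed.

Section Fixed.
Variables (eta : R) (K : nat) (n : nat).

Let N : nat := (2 ^ n)%N.

Let keep (k : nat) (w : T) : R :=
  1 - jump_cutoff r eta (X (D n k.+1) w - X (D n k) w).
Let below (k : nat) (w : T) : R := \1_(X (D n k) @^-1` `]-oo, K%:R]) w.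

Definition survival (k : nat) (w : T) : R := \prod_(j < k) keep j w.

(** [survival] killed at partition times where the path is above [K]. The last factor [keep] looks
    ahead to time D n k, so [A k] belongs to the past of exactly that time. *)
Let A (k : nat) (w : T) : R := \prod_(j < k) (keep j w * below j w).
Let B (k : nat) (w : T) : R := \prod_(j < k) below j w.

Let keep01 k w : 0 <= keep k w <= 1.
Proof.
have /andP[h0 h1] := jump_cutoff01 r eta (X (D n k.+1) w - X (D n k) w).
by rewrite /keep subr_ge0 h1 gerBl.
Qed.

Let belowE k w : below k w = (X (D n k) w <= K%:R)%R%:R.
Proof.
rewrite /below indicE; congr (nat_of_bool _)%:R.
by apply/idP/idP; rewrite ?inE/= in_itv/=.
Qed.

Let below01 k w : 0 <= below k w <= 1.
Proof. by rewrite belowE; case: (X (D n k) w <= K%:R); rewrite ?lexx ?ler01. Qed.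

Let kb01 k w : 0 <= keep k w * below k w <= 1.
Proof.
have /andP[? ?] := keep01 k w; have /andP[? ?] := below01 k w.
by rewrite mulr_ge0//= mulr_ile1.
Qed.

Let prod01 (g : nat -> R) k : (forall j, 0 <= g j <= 1) -> 0 <= \prod_(j < k) g j <= 1.
Proof.
move=> g01; elim: k => [|k IH]; first by rewrite big_ord0 lexx ler01.
have /andP[? ?] := g01 k; have /andP[? ?] := IH.
by rewrite big_ord_recr/= mulr_ge0//= mulr_ile1.
Qed.

Let A01 k w : 0 <= A k w <= 1.
Proof. exact: (prod01 k (kb01 ^~ w)). Qed.

Let B01 k w : 0 <= B k w <= 1.
Proof. exact: (prod01 k (below01 ^~ w)). Qed.

Lemma survival01 k w : 0 <= survival k w <= 1.
Proof. exact: (prod01 k (keep01 ^~ w)). Qed.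

Let AE k w : A k w = survival k w * B k w.
Proof. by rewrite /A /survival /B big_split. Qed.

Let past_keep k : measurable_fun [set: past X (D n k.+1)] (keep k).
Proof.
apply: measurable_funB; first exact: measurable_cst.
apply: measurable_jump_cutoff; apply: measurable_funB; apply: past_RV => //.
by apply: dyadic_le => //; exact: ltW.
Qed.

Let past_below k l : (k <= l)%N -> measurable_fun [set: past X (D n l)] (below k).
Proof.
move=> kl; apply: measurable_indic.
have := @past_RV _ _ _ P X (D n k) (D n l) (D0 n k).
move=> /(_ (dyadic_le n (ltW t0) kl) measurableT `]-oo, K%:R]%classic).
by rewrite setTI; apply; exact: measurable_itv.
Qed.

Let past_A k : measurable_fun [set: past X (D n k)] (A k).
Proof.
elim: k => [|k IH].
  by rewrite (_ : A 0 = cst 1) //; apply/funext => w; rewrite /A big_ord0.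
rewrite (_ : A k.+1 = fun w => A k w * (keep k w * below k w)); last first.
  by apply/funext => w; rewrite /A big_ord_recr.
apply: measurable_funM.
  by apply: (past_le (dyadic_le n (ltW t0) (leqnSn k))); exact: IH.
by apply: measurable_funM; [exact: past_keep|exact: past_below].
Qed.

Let unit_bounded (g : T -> R) : measurable_fun setT g -> (forall w, 0 <= g w <= 1) ->
  bounded_measurable g.
Proof.
move=> mg g01; split => //; exists 1 => w.
by have /andP[? ?] := g01 w; rewrite ger0_norm.
Qed.

Let bA k : bounded_measurable (A k).
Proof. by apply: unit_bounded => //; exact: past_measurable_fun (@past_A k). Qed.

Let bbelow k : bounded_measurable (below k).
Proof. by apply: unit_bounded => //; exact: past_measurable_fun (@past_below k k (leqnn k)). Qed.

Let bB k : bounded_measurable (B k).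
Proof.
elim: k => [|k IH].
  rewrite (_ : B 0 = cst 1); first exact: bounded_measurable_cst.
  by apply/funext => w; rewrite /B big_ord0.
rewrite (_ : B k.+1 = fun w => B k w * below k w); first exact: bounded_measurableM.
by apply/funext => w; rewrite /B big_ord_recr.
Qed.

Lemma bounded_survival k : bounded_measurable (survival k).
Proof.
elim: k => [|k IH].
  rewrite (_ : survival 0 = cst 1); first exact: bounded_measurable_cst.
  by apply/funext => w; rewrite /survival big_ord0.
rewrite (_ : survival k.+1 = fun w => survival k w * keep k w); last first.
  by apply/funext => w; rewrite /survival big_ord_recr.
apply: bounded_measurableM => //.
by apply: unit_bounded => //; exact: past_measurable_fun (@past_keep k).
Qed.

Let B_exceed w : 1 - B N w <= \1_(exceed K) w.
Proof.
rewrite indicE; have [_|hw] := boolP (w \in exceed K).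
  by rewrite gerBl; case/andP: (B01 N w).
rewrite /B big1 ?subrr// => -[k kN] _ /=; rewrite belowE.
rewrite leNgt; case: ltP => // KX; move: hw; rewrite notin_setE => /(_ _) [].
by exists n, k; split => //; exact: ltnW.
Qed.

Lemma expect_B_exceed : \int[P]_w (1 - B N w) <= fine (P (exceed K)).
Proof.
have -> : fine (P (exceed K)) = \int[P]_w \1_(exceed K) w.
  by rewrite /Rintegral integral_indic ?setIT//; exact: measurable_exceed.
apply: expect_le => //.
- by apply: bounded_measurableB => //; exact: bounded_measurable_cst.
- apply: unit_bounded; first by apply: measurable_indic; exact: measurable_exceed.
  by move=> w; rewrite indicE; case: (_ \in _); rewrite ?lexx ?ler01.
Qed.

Let U0 : U 0 = 0. Proof. by have [? _ _ _] := hU. Qed.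
Let Up s : 0 <= s -> 0 <= U s. Proof. by have [_ hp _ _] := hU; exact: hp. Qed.

(** Interpolates between the two sides: U 0 = 0 makes V N the mean of A N, and X 0 = x almost surely
    makes V 0 equal to e^{-x U(t)}. *)
Let V (k : nat) : R := \int[P]_w (A k w * expR (- (U (t - D n k) * X (D n k) w))).

(** A path is cut at most once: each term is at most B j - B j.+1, and these telescope. *)
Let sum_cut k w : \sum_(j < k) (A j w - A j w * below j w) <= 1 - B k w.
Proof.
elim: k => [|k IH]; first by rewrite big_ord0 /B big_ord0 subrr.
rewrite big_ord_recr/=; apply: (le_trans (lerD IH (lexx _))).
have -> : B k.+1 w = B k w * below k w by rewrite /B big_ord_recr.
have /andP[s1 s2] := survival01 k w; have /andP[b1 b2] := below01 k w.
have /andP[B1 B2] := B01 k w; rewrite AE.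
have : survival k w * (B k w * (1 - below k w)) <= B k w * (1 - below k w).
  by rewrite ler_piMl// mulr_ge0// subr_ge0.
by lra.
Qed.

(** The one-step bound requires a weight vanishing above [K], so [A k] is first replaced by [a k].
    By [sum_cut] all these replacements cost one P (exceed K) together; passing from [A N] back to
    [survival] costs the other. *)
Lemma telescope_bound (E : R) :
  (forall (k : nat) (a : T -> R), (k < N)%N ->
    measurable_fun [set: past X (D n k)] a -> (forall w, 0 <= a w <= 1) ->
    (forall w, K%:R < X (D n k) w -> a w = 0) ->
    `|\int[P]_w (a w * (keep k w * expR (- (U (t - D n k.+1) * X (D n k.+1) w))))
      - \int[P]_w (a w * expR (- (U (t - D n k) * X (D n k) w)))| <= E) ->
  P [set w | X 0 w = x] = 1%E ->
  `|\int[P]_w survival N w - expR (- (x * U t))| <= N%:R * E + 2 * fine (P (exceed K)).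
Proof.
move=> hE PX0.
pose a k w := A k w * below k w.
have ba k : bounded_measurable (a k) by exact: bounded_measurableM.
have bd k : bounded_measurable (fun w => A k w - a k w) by exact: bounded_measurableB.
have a01 k w : 0 <= a k w <= 1.
  have /andP[? ?] := A01 k w; have /andP[? ?] := below01 k w.
  by rewrite mulr_ge0//= mulr_ile1.
have tD k : (k <= N)%N -> 0 <= t - D n k.
  move=> kN; rewrite subr_ge0 -[leRHS](dyadicE t n).
  by apply: dyadic_le => //; exact: ltW.
have bexp k : (k <= N)%N ->
    bounded_measurable (fun w => expR (- (U (t - D n k) * X (D n k) w))).
  move=> kN; have u0 := Up (tD k kN); split.
    exact: measurable_expRNM_comp (measurable_funPT (X (D n k))).
  exists 1 => w; rewrite ger0_norm ?expR_ge0//; apply: expRN_le1.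
  by apply: mulr_ge0 => //; exact: X0.
have bkeep k : bounded_measurable (keep k).
  by apply: unit_bounded => //; exact: past_measurable_fun (@past_keep k).
have stp k : (k < N)%N -> `|V k.+1 - V k| <= E + \int[P]_w (A k w - a k w).
  move=> kN; have b1 := bexp k.+1 kN; have b0 := bexp k (ltnW kN).
  have F1 : V k.+1 = \int[P]_w (a k w *
      (keep k w * expR (- (U (t - D n k.+1) * X (D n k.+1) w)))).
    apply: eq_Rintegral => w _; rewrite /a /A big_ord_recr/=; ring.
  have F2 : V k = \int[P]_w (a k w * expR (- (U (t - D n k) * X (D n k) w))) +
      \int[P]_w ((A k w - a k w) * expR (- (U (t - D n k) * X (D n k) w))).
    rewrite -(expectD P (bounded_measurableM (ba k) b0) (bounded_measurableM (bd k) b0)).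
    by apply: eq_Rintegral => w _; ring.
  rewrite F1 F2 opprD addrA; apply: (le_trans (ler_normB _ _)); apply: lerD.
    apply: hE => //.
    - apply: measurable_funM; first exact: past_A.
      exact: past_below.
    - by move=> w Kw; rewrite /a belowE leNgt Kw mulr0.
  apply: expect_norm_le => //; first exact: bounded_measurableM (bd k) b0.
  move=> w; have /andP[A0 A1] := A01 k w; have /andP[l0 l1] := below01 k w.
  have d0 : 0 <= A k w - a k w by rewrite subr_ge0 /a ler_piMr.
  have e1 : expR (- (U (t - D n k) * X (D n k) w)) <= 1.
    by apply: expRN_le1; apply: mulr_ge0; [exact/Up/tD/ltnW|exact: X0].
  rewrite ger0_norm; first by rewrite ler_piMr.
  by apply: mulr_ge0 => //; exact: expR_ge0.
have tel k : (k <= N)%N ->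
    `|V k - V 0| <= k%:R * E + \sum_(j < k) \int[P]_w (A j w - a j w).
  elim: k => [|k IH] kN; first by rewrite subrr normr0 big_ord0 mul0r addr0.
  rewrite -(subrKA (V k) (V k.+1)).
  apply: (le_trans (ler_normD _ _)); apply: (le_trans (lerD (stp k kN) (IH (ltnW kN)))).
  by rewrite big_ord_recr/= -natr1 le_eqVlt; apply/orP; left; apply/eqP; ring.
have sumB : \sum_(j < N) \int[P]_w (A j w - a j w) <= fine (P (exceed K)).
  rewrite -(expect_sum P N bd); apply: le_trans expect_B_exceed; apply: expect_le.
  - exact: (bounded_measurable_sum N bd).
  - by apply: bounded_measurableB => //; exact: bounded_measurable_cst.
  - by move=> w; exact: sum_cut.
have VN : V N = \int[P]_w A N w.
  apply: eq_Rintegral => w _.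
  by rewrite /D /N dyadicE subrr U0 mul0r oppr0 expR0 mulr1.
have V0 : V 0 = expR (- (x * U t)).
  have mS : measurable [set w | X 0 w = x].
    have mx : measurable ([set x] : set RR) by exact: measurable_set1.
    by have := measurable_funPT (X 0) measurableT [set x] mx; rewrite setTI.
  pose g w := expR (- (U t * X 0 w)).
  have bg : bounded_measurable g.
    by have := bexp 0%N (leq0n N); rewrite /D dyadic0 subr0.
  have VE : V 0 = \int[P]_w g w.
    apply: eq_Rintegral => w _.
    by rewrite /A big_ord0 mul1r /D dyadic0 subr0.
  (* X 0 = x holds only almost surely; the difference is dominated by the indicator of the
     exceptional null set. *)
  apply/eqP; rewrite -subr_eq0 -normr_le0 VE -(expect_cst P (expR (- (x * U t)))).
  have bc := @bounded_measurable_cst R _ T (expR (- (x * U t))).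
  rewrite -(expectB P bg bc).
  have PS : \int[P]_w \1_(~` [set w | X 0 w = x]) w = 0.
    rewrite /Rintegral integral_indic ?setIT; [|by []|exact: measurableC].
    by have := probability_setC P mS; rewrite PX0 subee// => PC; exact: (congr1 fine PC).
  rewrite -[leRHS]PS; apply: expect_norm_le.
  - exact: bounded_measurableB.
  - apply: unit_bounded; first by apply: measurable_indic; exact: measurableC.
    by move=> w; rewrite indicE; case: (_ \in _); rewrite ?lexx ?ler01.
  - move=> w; rewrite indicE; have [xw|xw] := pselect (X 0 w = x).
      by rewrite /g xw mulrC subrr normr0.
    rewrite mem_set//= ler_norml /g.
    have u0 : 0 <= U t by apply: Up; exact: ltW.
    have h1 : expR (- (U t * X 0 w)) <= 1.
      by apply: expRN_le1; apply: mulr_ge0 => //; exact: X0.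
    have h2 : expR (- (x * U t)) <= 1 by apply: expRN_le1; exact: mulr_ge0.
    have := expR_ge0 (- (U t * X 0 w)); have := expR_ge0 (- (x * U t)).
    by move: h1 h2; move: (expR _) (expR _) => q1 q2; lra.
have surv : `|\int[P]_w survival N w - \int[P]_w A N w| <= fine (P (exceed K)).
  rewrite -(expectB P (bounded_survival N) (bA N)).
  apply: le_trans expect_B_exceed; apply: expect_norm_le.
  - exact: bounded_measurableB (bounded_survival N) (bA N).
  - by apply: bounded_measurableB => //; exact: bounded_measurable_cst.
  - move=> w; rewrite AE; have /andP[s1 s2] := survival01 N w.
    have /andP[B1 B2] := B01 N w.
    have -> : survival N w - survival N w * B N w = survival N w * (1 - B N w) by ring.
    rewrite ger0_norm; first by rewrite ler_piMl// subr_ge0.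
    by apply: mulr_ge0 => //; rewrite subr_ge0.
have := tel N (leqnn N); rewrite VN V0 => tl.
have -> : \int[P]_w survival N w - expR (- (x * U t)) =
  (\int[P]_w survival N w - \int[P]_w A N w) + (\int[P]_w A N w - expR (- (x * U t))) by ring.
apply: (le_trans (ler_normD _ _)); apply: (le_trans (lerD surv tl)).
by rewrite addrCA lerD2l mulr_natl mulr2n lerD2l.
Qed.

End Fixed.

End Telescoping.

(** * The limit along dyadic partitions, then eta -> 0 *)

Section Survival.
Context {R : realType} {d : measure_display} {T : measurableType d}.
Context (P : probability T R).
Local Notation RR := (measurableTypeR R).
Variables (X : R -> {RV P >-> R}) (b c x : R) (m : {measure set RR -> \bar R}).
Hypothesis hphi : branching_parameters c m.
Hypothesis x0 : 0 <= x.
Hypothesis hX : cadlag_CB_process (phi b c m) x X.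
Variables (r t : R) (U : R -> R).
Hypothesis r0 : 0 < r.
Hypothesis t0 : 0 < t.
Hypothesis hU : ode_solution (phi_trunc r b c m) (fine (m `]r, +oo[%classic)) U.

Let Y (eta : R) (n : nat) : T -> R := survival X r t eta n (2 ^ n).

(** The gaps decrease to the empty set, being open at [r], and have finite mass. *)
Lemma jump_gap_small eps : 0 < eps ->
  exists j : nat, jump_gap m r (j.+1%:R^-1) <= eps.
Proof.
move=> eps0; have [_ _ hm] := hphi.
pose G (j : nat) : set RR := `]r, r + 2 * j.+1%:R^-1]%classic.
have mG j : measurable (G j) by exact: measurable_itv.
have G0 : (m (G 0%N) < +oo)%E.
  apply: le_lt_trans (tail_mass_lty hm r0); apply: le_measure; rewrite ?inE//.
  by move=> u; rewrite /G/= !in_itv/= => /andP[->].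
have capG : \bigcap_j G j = set0.
  rewrite -subset0 => u hu; have := hu 0%N I; rewrite /G/= in_itv/= => /andP[ru _].
  have e0 : 0 < (u - r) / 2 by rewrite divr_gt0// subr_gt0.
  pose k := Num.truncn ((u - r) / 2)^-1.
  have hk : k.+1%:R^-1 < (u - r) / 2.
    by rewrite invf_plt ?posrE// /k Num.Theory.truncnS_gt.
  have := hu k I; rewrite /G/= in_itv/= => /andP[_].
  by move: hk; move: (k.+1%:R^-1) => q; lra.
have nG : nonincreasing_seq G.
  move=> i j ij; apply/subsetPset => u; rewrite /G/= !in_itv/= => /andP[-> h] /=.
  by apply: (le_trans h); rewrite lerD2l ler_wpM2l// lef_pV2 ?posrE// ler_nat.
have := nonincreasing_cvg_mu G0 mG; rewrite capG => /(_ measurable0 nG).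
rewrite measure0 => /fine_cvgP[_ /cvgrPdist_le/(_ _ eps0)[N _ hN]].
exists N; have := hN N (leqnn N); rewrite /= sub0r normrN.
exact: le_trans (ler_norm _).
Qed.

Lemma jump_gap_mono (eta1 eta2 : R) : 0 < eta1 -> eta1 <= eta2 ->
  jump_gap m r eta1 <= jump_gap m r eta2.
Proof.
move=> e0 e12; have [_ _ hm] := hphi.
have mI e : measurable (`]r, r + 2 * e]%classic : set RR) by exact: measurable_itv.
have fin e : m `]r, r + 2 * e]%classic \is a fin_num.
  rewrite ge0_fin_numE//; apply: le_lt_trans (tail_mass_lty hm r0).
  apply: le_measure; rewrite ?inE//.
  by move=> u; rewrite /= !in_itv/= => /andP[->].
apply: fine_le => //; apply: le_measure; rewrite ?inE//.
move=> u; rewrite /= !in_itv/= => /andP[-> h] /=.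
by apply: (le_trans h); rewrite lerD2l ler_wpM2l.
Qed.

(** One [eta0] has to work for all smaller [eta], since [eta] tends to 0 later; [p], the
    second-order constant and [N] may depend on [eta]. The error splits into four parts of eps / 4:
    values above [K], polynomial approximation, gap, and second order. *)
Lemma survival_estimate eps : 0 < eps -> exists2 eta0 : R, 0 < eta0 &
  forall eta : R, 0 < eta -> eta <= eta0 -> exists N : nat, forall n, (N <= n)%N ->
    `|\int[P]_w Y eta n w - expR (- (x * U t))| <= eps.
Proof.
move=> eps0; have [c0 _ hm] := hphi.
have [X0 _ PX0 [Q [[_ [v [vs Qv]]] QX]]] := hX.
have e8 : 0 < eps / 8 by rewrite divr_gt0.
have [K hK] := exceed_small hX t0 e8.
(* Over 2^n steps of length [h] the factor h K sums to t K; the added 1 keeps denominators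
   positive. *)
pose TK : R := t * K%:R + 1.
have TK0 : 0 < TK by rewrite ltr_wpDl// mulr_ge0// ltW.
have egap : 0 < eps / (4 * TK) by rewrite divr_gt0// mulr_gt0.
have [j hj] := jump_gap_small egap.
exists (j.+1%:R^-1); first by rewrite invr_gt0.
move=> eta eta0 etaj; have gap := le_trans (jump_gap_mono eta0 etaj) hj.
pose M := 2 * c + min_sqr_mass m + 1.
have M'0 : 0 <= 2 * c + min_sqr_mass m.
  by apply: addr_ge0; [exact: mulr_ge0|exact: min_sqr_mass_ge0].
have M0 : 0 < M by rewrite ltr_wpDl.
pose del := eps / (8 * TK * M).
have del0 : 0 < del by rewrite divr_gt0// !mulr_gt0.
have [q2 q3] := jump_cutoff_params r0 eta0.
have [L L0 hL] := cutoff_quot_lipschitz q2 q3.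
have [p hp] := lipschitz_poly_approx (expR_gt0 K%:R) L0 del0 hL.
have theta0 : 0 <= fine (m `]r, +oo[%classic) by exact: fine_ge0.
have [W [C1 [W0 C10 hW hexp]]] := ode_expansion theta0 (lip_const_ge0 m _ c0)
  (phi_trunc0 b c r m) (phi_trunc_lipschitz b r c0 hm) t0 hU.
have [C [h1 [C0 h10 step]]] := one_step c0 hm X0 vs Qv QX r0 eta0 (ler0n _ K) W0
  (ltW del0) hp C10.
have Ce : 0 < eps / (4 * (t * C + 1)).
  by rewrite divr_gt0// mulr_gt0// ltr_wpDl// mulr_ge0// ltW.
(* The mesh must be admissible for [one_step] and make the accumulated 2^n C h^2 = t C h small. *)
have [N1 hN1] := dyadic_mesh (ltW t0) h10.
have [N2 hN2] := dyadic_mesh (ltW t0) Ce.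
exists (maxn N1 N2) => n; rewrite geq_max => /andP[/hN1 hh1 /hN2 hh2].
pose h := t / (2 ^ n)%:R.
have h0 : 0 <= h by rewrite divr_ge0// ltW.
pose E := h * K%:R * (2 * del * (2 * c + min_sqr_mass m) + jump_gap m r eta) + C * h ^+ 2.
have Up s : 0 <= s -> 0 <= U s by have [_ hp' _ _] := hU; exact: hp'.
have tel : forall (k : nat) (a : T -> R), (k < 2 ^ n)%N ->
    measurable_fun [set: past X (dyadic t n k)] a -> (forall w, 0 <= a w <= 1) ->
    (forall w, K%:R < X (dyadic t n k) w -> a w = 0) ->
    `|\int[P]_w (a w * ((1 - jump_cutoff r eta (X (dyadic t n k.+1) w - X (dyadic t n k) w))
        * expR (- (U (t - dyadic t n k.+1) * X (dyadic t n k.+1) w))))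
      - \int[P]_w (a w * expR (- (U (t - dyadic t n k) * X (dyadic t n k) w)))| <= E.
  move=> k a kn ma a01 aK; rewrite dyadicS -/h.
  have k0 : 0 <= dyadic t n k by apply: dyadic_ge0; exact: ltW.
  have kt : dyadic t n k + h <= t.
    by rewrite /h -dyadicS -[leRHS](dyadicE t n); apply: dyadic_le => //; exact: ltW.
  have s0 : 0 <= t - (dyadic t n k + h) by rewrite subr_ge0.
  have sE : t - (dyadic t n k + h) + h = t - dyadic t n k by ring.
  apply: step => //.
  - by rewrite h0 ltW.
  - by apply: hW; rewrite s0 lerBlDr lerDl addr_ge0.
  - by apply: Up; rewrite -sE addr_ge0.
  - by rewrite -sE; apply: hexp => //; rewrite sE lerBlDr lerDl.
have B := telescope_bound x0 hX t0 hU tel PX0.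
apply: (le_trans B).
have n0 : (2 ^ n)%:R != 0 :> R by rewrite pnatr_eq0 expn_eq0.
have -> : (2 ^ n)%:R * E = t * K%:R * (2 * del * (2 * c + min_sqr_mass m))
    + t * K%:R * jump_gap m r eta + t * C * h.
  by rewrite /E /h; field.
have tK : 0 <= t * K%:R <= TK by rewrite mulr_ge0 ?(ltW t0)//= lerDl.
have b1 : t * K%:R * (2 * del * (2 * c + min_sqr_mass m)) <= eps / 4.
  have -> : eps / 4 = TK * (2 * del * M).
    by rewrite /del; field; rewrite !gt_eqF.
  have /andP[tK0 tK1] := tK; apply: ler_pM => //.
    by apply: mulr_ge0 => //; apply: mulr_ge0 => //; exact: ltW.
  by apply: ler_wpM2l; [apply: mulr_ge0 => //; exact: ltW|rewrite lerDl].
have b2 : t * K%:R * jump_gap m r eta <= eps / 4.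
  have -> : eps / 4 = TK * (eps / (4 * TK)) by field; rewrite gt_eqF.
  by have /andP[tK0 tK1] := tK; apply: ler_pM => //; exact: jump_gap_ge0.
have b3 : t * C * h <= eps / 4.
  have D0 : 0 < t * C + 1 by rewrite ltr_wpDl// mulr_ge0// ltW.
  have -> : eps / 4 = (t * C + 1) * (eps / (4 * (t * C + 1))) by field; rewrite gt_eqF.
  apply: ler_pM => //; first by rewrite mulr_ge0// ltW.
    by rewrite lerDl.
  exact: ltW.
by lra.
Qed.

Definition no_large_jump (rho : R) : set T :=
  [set w | forall s, 0 < s <= t -> jump (fun q => X q w) s <= rho].

Let cX w : cadlag (fun s => X s w).
Proof. by have [_ h _ _] := hX; exact: h. Qed.

(** The event is an intersection over uncountably many times; [increments_small] and
    [increments_large] express it through countably many dyadic increments. *)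
Lemma measurable_no_large_jump rho : 0 <= rho -> measurable (no_large_jump rho).
Proof.
move=> rho0.
pose Inc (j n k : nat) : set T :=
  (fun w => X (dyadic t n k.+1) w - X (dyadic t n k) w) @^-1` `]-oo, rho + j.+1%:R^-1].
have mI j n k : measurable (Inc j n k).
  rewrite -[Z in measurable Z]setTI.
  have mf : measurable_fun setT
      (fun w => X (dyadic t n k.+1) w - X (dyadic t n k) w : RR).
    exact: measurable_funB.
  by apply: mf => //; exact: measurable_itv.
have -> : no_large_jump rho = \bigcap_j \bigcup_N \bigcap_(n in [set n | (N <= n)%N])
    \bigcap_(k in [set k | (k < 2 ^ n)%N]) Inc j n k.
  apply/seteqP; split => w.
    move=> hw j _; have rj : rho < rho + j.+1%:R^-1 by rewrite ltrDl invr_gt0.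
    have [N hN] := increments_small (cX w) (ltW t0) rho0 rj hw.
    exists N => // n Nn k kn; rewrite /Inc/= in_itv/=; exact: hN.
  move=> hw s st; rewrite leNgt; apply/negP => sj.
  pose dlt := jump (fun q => X q w) s - rho.
  have dlt0 : 0 < dlt by rewrite subr_gt0.
  pose j := Num.truncn dlt^-1.
  have hj : rho + j.+1%:R^-1 < jump (fun q => X q w) s.
    by rewrite addrC -ltrBrDr invf_plt ?posrE// Num.Theory.truncnS_gt.
  have [N1 hN1] := increments_large (cX w) st hj.
  have [N2 _ hN2] := hw j I.
  have [k kn hk] := hN1 _ (leq_maxl N1 N2).
  have := hN2 _ (leq_maxr N1 N2) k kn.
  by rewrite /Inc/= in_itv/= leNgt hk.
apply: bigcap_measurable => [|j _]; first by exists 0%N.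
apply: bigcup_measurable => N _.
apply: bigcap_measurable => [|n _]; first by exists N => /=.
apply: bigcap_measurable => [|k _]; first by exists 0%N; rewrite /= expn_gt0.
exact: mI.
Qed.

(** Continuity from below along the sets where [g n] is 1 from index N on. It is applied to the
    survival product on paths without large jumps, and to 1 minus the product on the others. *)
Lemma eventually_one_expect (g : nat -> T -> R) (A : set T) (eps : R) : measurable A ->
  (forall n, bounded_measurable (g n)) -> (forall n w, 0 <= g n w <= 1) ->
  (forall w, A w -> exists N : nat, forall n, (N <= n)%N -> g n w = 1) -> 0 < eps ->
  exists N : nat, forall n, (N <= n)%N -> fine (P A) - eps <= \int[P]_w g n w.
Proof.
move=> mA bg g01 gA eps0.
pose F (N : nat) : set T := A `&` \bigcap_(n in [set n | (N <= n)%N]) g n @^-1` [set 1].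
have mF N : measurable (F N).
  apply: measurableI => //; apply: bigcap_measurable => [|n _]; first by exists N => /=.
  have [mg _] := bg n; rewrite -[Z in measurable Z]setTI.
  have m1 : measurable ([set 1] : set RR) by exact: measurable_set1.
  exact: mg.
have FA : \bigcup_N F N = A.
  apply/seteqP; split => w; first by move=> [N _ []].
  by move=> Aw; have [N hN] := gA w Aw; exists N => //; split => // n Nn; exact: hN.
have nF : nondecreasing_seq F.
  move=> i j ij; apply/subsetPset => w [Aw h]; split => // n jn; apply: h.
  exact: leq_trans jn.
have mU : measurable (\bigcup_N F N) by rewrite FA.
have := nondecreasing_cvg_mu mF mU nF; rewrite FA => cv.
have finA : P A \is a fin_num by exact: fin_num_measure.
have /fine_cvgP[_ /cvgrPdist_le/(_ _ eps0)[N _ hN]] : (P \o F) @ \oo --> (fine (P A))%:E.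
  by rewrite fineK//; exact: cv.
exists N => n Nn.
have := hN N (leqnn N); rewrite /= ler_norml => /andP[_ h1].
apply: (@le_trans _ _ (fine (P (F N)))); first by lra.
have -> : fine (P (F N)) = \int[P]_w \1_(F N) w.
  by rewrite /Rintegral integral_indic ?setIT.
apply: expect_le => //.
  split; first exact: measurable_indic.
  by exists 1 => w; rewrite indicE; case: (_ \in _); rewrite ?normr1 ?normr0.
move=> w; rewrite indicE; have [|_] := boolP (w \in F N).
  by rewrite inE => -[_ h]; rewrite (h n Nn).
by case/andP: (g01 n w).
Qed.

Let bY eta n : bounded_measurable (Y eta n).
Proof. exact: bounded_survival. Qed.

Let Y01 eta n w : 0 <= Y eta n w <= 1.
Proof. exact: survival01. Qed.

(** Without jumps above [r], all increments on fine partitions are at most r + eta, where the cutoff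
    vanishes, so every factor of the product is 1. *)
Lemma no_large_jump_le : fine (P (no_large_jump r)) <= expR (- (x * U t)).
Proof.
apply/ler_addgt0Pr => eps eps0; have e2 : 0 < eps / 2 by rewrite divr_gt0.
have [eta0 eta00 hest] := survival_estimate e2.
have [N1 hN1] := hest _ eta00 (lexx _).
have [|N2 hN2] := @eventually_one_expect (Y eta0) _ (eps / 2)
    (measurable_no_large_jump (ltW r0)) (bY eta0) (Y01 eta0) _ e2.
  move=> w hw; have re : r < r + eta0 by rewrite ltrDl.
  have [N hN] := increments_small (cX w) (ltW t0) (ltW r0) re hw.
  exists N => n Nn; rewrite /Y /survival big1// => -[k kn] _ /=.
  by rewrite jump_cutoff_small ?subr0//; exact: hN.
have := hN1 _ (leq_maxl N1 N2); have := hN2 _ (leq_maxr N1 N2).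
by rewrite ler_norml => h1 /andP[h2 h3]; lra.
Qed.

(** A jump above r + 2 eta forces such an increment on every fine partition; there the cutoff is 1,
    so one factor and hence the product is 0. *)
Lemma no_large_jump_ge eps : 0 < eps -> exists2 eta0 : R, 0 < eta0 &
  forall eta : R, 0 < eta -> eta <= eta0 ->
    expR (- (x * U t)) - eps <= fine (P (no_large_jump (r + 2 * eta))).
Proof.
move=> eps0; have e2 : 0 < eps / 2 by rewrite divr_gt0.
have [eta0 eta00 hest] := survival_estimate e2.
exists eta0 => // eta eta1 eta2; have [N1 hN1] := hest _ eta1 eta2.
have rho0 : 0 <= r + 2 * eta by have := r0; lra.
pose J := no_large_jump (r + 2 * eta).
have mJ : measurable J by exact: measurable_no_large_jump.
have [|||N2 hN2] := @eventually_one_expect (fun n w => 1 - Y eta n w) (~` J) (eps / 2)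
    (measurableC mJ) _ _ _ e2.
- by move=> n; apply: bounded_measurableB => //; exact: bounded_measurable_cst.
- by move=> n w; have := Y01 eta n w; lra.
- move=> w /existsNP[s /not_implyP[st /negP]]; rewrite -ltNge => sj.
  have [N hN] := increments_large (cX w) st sj.
  exists N => n /hN[k kn hk].
  have kz : 1 - jump_cutoff r eta (X (dyadic t n k.+1) w - X (dyadic t n k) w) = 0.
    by rewrite jump_cutoff_large ?subrr// ltW.
  by rewrite /Y /survival (bigD1 (Ordinal kn))//= kz mul0r subr0.
have := hN1 _ (leq_maxl N1 N2); have := hN2 _ (leq_maxr N1 N2).
have b1 := @bounded_measurable_cst R _ T 1.
rewrite (expectB P b1 (bY eta _)) expect_cst.
have -> : fine (P (~` J)) = 1 - fine (P J).
  have PC := probability_setC P mJ.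
  by rewrite (congr1 fine PC : fine (P (~` J)) = _) fineB// fin_num_measure.
by rewrite ler_norml => h1 /andP[h2 h3]; lra.
Qed.

(** The lower bound concerns r + 2 eta; the events for r + 2 / (j + 1) decrease to the event for
    [r], and continuity from above concludes. *)
Lemma no_large_jump_prob : P (no_large_jump r) = (expR (- (x * U t)))%:E.
Proof.
have mJ rho : 0 <= rho -> measurable (no_large_jump rho) by exact: measurable_no_large_jump.
rewrite -(fineK (fin_num_measure P _ (mJ _ (ltW r0)))); congr EFin.
apply/eqP; rewrite eq_le no_large_jump_le/=.
apply/ler_addgt0Pr => eps eps0; have e2 : 0 < eps / 2 by rewrite divr_gt0.
have [eta0 eta00 hge] := no_large_jump_ge e2.
pose F (j : nat) := no_large_jump (r + 2 * j.+1%:R^-1).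
have jp (j : nat) : 0 < j.+1%:R^-1 :> R by rewrite invr_gt0.
have mF j : measurable (F j).
  by apply: mJ; apply: addr_ge0; [exact: ltW|apply: mulr_ge0 => //; exact: ltW].
have capF : \bigcap_j F j = no_large_jump r.
  apply/seteqP; split => w hw; last first.
    by move=> j _ s st; apply: (le_trans (hw s st)); rewrite lerDl mulr_ge0 ?ltW.
  move=> s st; rewrite leNgt; apply/negP => sj.
  pose dlt := (jump (fun q => X q w) s - r) / 2.
  have dlt0 : 0 < dlt by rewrite divr_gt0// subr_gt0.
  pose k := Num.truncn dlt^-1.
  have hk : k.+1%:R^-1 < dlt by rewrite invf_plt ?posrE// Num.Theory.truncnS_gt.
  have := hw k I s st; rewrite leNgt => /negP; apply.
  by move: hk; rewrite /dlt; move: (k.+1%:R^-1) => q; lra.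
have nF : nonincreasing_seq F.
  move=> i j ij; apply/subsetPset => w hw s st; apply: (le_trans (hw s st)).
  by rewrite lerD2l ler_wpM2l// lef_pV2 ?posrE// ler_nat.
have F0 : (P (F 0%N) < +oo)%E by rewrite ltey_eq fin_num_measure//; exact: mF.
have mc : measurable (\bigcap_j F j) by rewrite capF; exact/mJ/ltW.
have := nonincreasing_cvg_mu F0 mF mc nF; rewrite capF => cv.
have finJ : P (no_large_jump r) \is a fin_num by apply: fin_num_measure; exact/mJ/ltW.
have /fine_cvgP[_ /cvgrPdist_le/(_ _ e2)[N _ hN]] :
    (P \o F) @ \oo --> (fine (P (no_large_jump r)))%:E by rewrite fineK//; exact: cv.
pose k := maxn N (Num.truncn eta0^-1).
have ke : k.+1%:R^-1 <= eta0.
  rewrite invf_ple ?posrE//; apply: (le_trans (ltW (Num.Theory.truncnS_gt _))).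
  by rewrite ler_nat ltnS leq_maxr.
have := hN k (leq_maxl _ _); rewrite /= ler_norml => /andP[h1 _].
have := hge _ (jp k) ke; rewrite -/(F k); lra.
Qed.

End Survival.

Theorem theorem9p1 (R : realType) (b c : R)
    (m : {measure set (measurableTypeR R) -> \bar R})
    (hphi : branching_parameters c m)
    (d : measure_display) (T : measurableType d) (x : R) (hx : 0 <= x)
    (Px : probability T R) (X : R -> {RV Px >-> R})
    (hX : cadlag_CB_process (phi b c m) x X)
    (r : R) (hr : 0 < r) :
  exists u : R -> R -> R,
    (forall theta : R, 0 <= theta ->
       unique_ode_solution (phi_trunc r b c m) theta (fun t => u t theta)) /\
    (forall t : R, 0 < t ->
       Px [set w | exists2 y : R,
              is_max [set jump (fun q => X q w) s | s in `]0, t]] y & y <= r]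
       = (expR (- (x * u t (fine (m `]r, +oo[%classic)))))%:E).
Proof.
have [u hu] := trunc_ode_solution b hphi hr.
exists u; split=> // t t0.
have [hU _] := hu _ (fine_ge0 (measure_ge0 m `]r, +oo[%classic)).
rewrite -(no_large_jump_prob hphi hx hX hr t0 hU); congr (Px _).
apply/seteqP; split => w.
  move=> [y [_ ymax] yr] s st; apply: le_trans yr; apply: ymax.
  by exists s => //; rewrite /= in_itv.
(* The event also asserts that the maximum exists, which follows once all jumps are bounded by
   [r]. *)
move=> hw; have [_ cX _ _] := hX.
have [y ymax] := exists_max_jump (cX w) t0 hw.
exists y => //; have [[s + <-] _] := ymax.
by rewrite /= in_itv/=; exact: hw.
Qed.
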